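(* There exists an absolute constant $c>0$ (independent of $n$ and $N$) with the following property. For every $n\in\mathbb N$ and every extremal function $f$ for $M_n$, the number $N$ of atoms of $f$ satisfies $N\geq cn$.
   Context: $\mathbb D$ is the open unit disc. $\mathcal B_0=\{f \text{ holomorphic on }\mathbb D : 0<|f(z)|\le 1 \text{ for all } z\in\mathbb D\}$. For $f(z)=\sum_{j\ge0}a_jz^j$ and $n\in\mathbb N$, $M_n(f)=\mathrm{Re}\,a_n$. A function $f\in\mathcal B_0$ is extremal for $M_n$ if $M_n(f)\ge M_n(F)$ for all $F\in\mathcal B_0$. It is known that every extremal function $f$ for $M_n$ can be written as $f(z)=\gamma\exp\big(-\sum_{j=1}^N\lambda_j\frac{1+\alpha_jz}{1-\alpha_jz}\big)$ with $\gamma\in\partial\mathbb D$ (and $\gamma=1$ if $f(0)>0$), an integer $1\le N\le n$, weights $\lambda_1,\dots,\lambda_N>0$ and distinct points $\alpha_1,\dots,\alpha_N\in\partial\mathbb D$; $N$ is called the number of atoms of $f$. *)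

(* Defs.v *)
From Stdlib Require Import Reals List.
From Coquelicot Require Import Coquelicot.
Open Scope R_scope.

Definition inD (z : C) : Prop := Cmod z < 1.

Definition cexp (z : C) : C :=
  (exp (Re z) * cos (Im z), exp (Re z) * sin (Im z)).

Definition holo_on_D (f : C -> C) : Prop :=
  forall z : C, inD z -> @ex_derive C_AbsRing C_NormedModule f z.

Definition B0 (f : C -> C) : Prop :=
  holo_on_D f /\ forall z : C, inD z -> 0 < Cmod (f z) /\ Cmod (f z) <= 1.

Definition taylor_coeffs (f : C -> C) (a : nat -> C) : Prop :=
  forall z : C, inD z ->
    @is_series C_AbsRing C_NormedModule
      (fun j => Cmult (a j) (@pow_n C_Ring z j)) (f z).

Definition M (n : nat) (a : nat -> C) : R := Re (a n).

Definition extremal (n : nat) (f : C -> C) : Prop :=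
  B0 f /\
  exists a : nat -> C, taylor_coeffs f a /\
    forall (F : C -> C) (b : nat -> C), B0 F -> taylor_coeffs F b ->
      M n b <= M n a.

Definition csum (N : nat) (g : nat -> C) : C :=
  fold_right Cplus (RtoC 0) (map g (seq 0 N)).

Definition atom_rep (f : C -> C) (gamma : C) (N : nat)
    (lam : nat -> R) (alpha : nat -> C) : Prop :=
  Cmod gamma = 1 /\
  (forall j, (j < N)%nat -> 0 < lam j) /\
  (forall j, (j < N)%nat -> Cmod (alpha j) = 1) /\
  (forall i j, (i < N)%nat -> (j < N)%nat -> alpha i = alpha j -> i = j) /\
  (forall z : C, inD z ->
     f z = Cmult gamma
             (cexp (Copp (csum N (fun j =>
                Cmult (RtoC (lam j))
                  (Cdiv (Cplus (RtoC 1) (Cmult (alpha j) z))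
                        (Cminus (RtoC 1) (Cmult (alpha j) z)))))))).

(* Main.v *)
(** The weights of the atoms enter through z f'/f = Phi, which on the unit circle is the
    positive function phi = sum_j 2 lambda_j / |1 - alpha_j w|^2.  Testing extremality
    against f exp(tQ) shows that the trigonometric polynomial
    T(w) = Re (a_n + 2 sum_k a_(n-k) w^(-k)) is nonnegative, vanishes at the atoms, and
    satisfies phi T = n T - |D| T, where |D| is the Fourier multiplier |k|.  As a_n >= 1/2
    and the L^2 norm of T is bounded, T is spread over a set of positive measure.

    Suppose N is much smaller than n.  Averaging phi T = n T - |D| T with Poisson kernels
    at height B/n gives Phi = n (1 + small) at most points at this height above the bulk
    of T, because there Phi is nearly constant at that scale; and |Phi| <= C n holds on
    the whole region Omega above the bulk of T.  But Phi(0) = 0.  This contradicts a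
    two-constants argument: with U = Re GG the harmonic extension of T - T^2/128, minus
    Poisson kernels at the atoms, and Omega = {U >= 1/8, |z| <= 1 - B/n}, the function
    F = (Phi/n - 1) exp(K GG) / (1 + G)^2, where Re G extends T, violates the maximum
    principle on Omega. *)

Require Import Defs.
From Stdlib Require Import Reals List Lra Lia ClassicalEpsilon.
From Coquelicot Require Import Coquelicot.
Open Scope R_scope.

(** * Finite sums and second order complex expansions *)

(** The obstacle is that [T] has no pointwise bound uniform in n: only its mean (at least 1/2) and
    mean square (at most 16) are controlled. The truncation [T - T^2/128] is at most 32 and keeps
    mean at least 1/2 - 16/128 = 3/8, so where its extension exceeds 1/8, [T] has mass at that very
    scale; this mass converts averages of [phi T] into bounds for [Phi]. The number of atoms enters
    through the subtracted Poisson kernels. At height B/n each is of order n within distance of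
    order 1/n of its atom. Given weights of order 1/n, they expel these neighbourhoods from Omega
    and lower the value at 0 only by a multiple of N/n. The factor exp(K GG) makes the step of U
    from 1/8 on the sides to 1/4 at 0 outweigh the constant bounding Phi/n; on the floor it is at
    most exp(32 K), which the smallness of Phi/n - 1 absorbs. The denominator (1 + G)^2 is there
    because the bounds for Phi/n grow with Re G, which is not bounded above. *)

Fixpoint rsum (f : nat -> R) (n : nat) : R :=
  match n with O => 0 | S m => rsum f m + f m end.

Fixpoint zsum (f : nat -> C) (n : nat) : C :=
  match n with O => RtoC 0 | S m => Cplus (zsum f m) (f m) end.

Lemma C_eq (a b : C) : Re a = Re b -> Im a = Im b -> a = b.
Proof. destruct a, b; unfold Re, Im; simpl; intros; subst; reflexivity. Qed.

Lemma Re_plus (a b : C) : Re (a + b)%C = Re a + Re b. Proof. reflexivity. Qed.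
Lemma Im_plus (a b : C) : Im (a + b)%C = Im a + Im b. Proof. reflexivity. Qed.
Lemma Re_opp (a : C) : Re (- a)%C = - Re a. Proof. reflexivity. Qed.
Lemma Re_minus (a b : C) : Re (a - b)%C = Re a - Re b. Proof. reflexivity. Qed.
Lemma Im_minus (a b : C) : Im (a - b)%C = Im a - Im b. Proof. reflexivity. Qed.
Lemma Re_mult (a b : C) : Re (a * b)%C = Re a * Re b - Im a * Im b.
Proof. reflexivity. Qed.
Lemma Im_mult (a b : C) : Im (a * b)%C = Re a * Im b + Im a * Re b.
Proof. reflexivity. Qed.
Lemma Re_RtoC (x : R) : Re (RtoC x) = x. Proof. reflexivity. Qed.
Lemma Im_RtoC (x : R) : Im (RtoC x) = 0. Proof. reflexivity. Qed.
Lemma Re_scal (x : R) (a : C) : Re (RtoC x * a)%C = x * Re a.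
Proof. rewrite Re_mult, Re_RtoC, Im_RtoC; ring. Qed.
Lemma Im_scal (x : R) (a : C) : Im (RtoC x * a)%C = x * Im a.
Proof. rewrite Im_mult, Re_RtoC, Im_RtoC; ring. Qed.

Lemma RtoC_m1 : RtoC (-1) = (- RtoC 1)%C.
Proof. rewrite <- RtoC_opp. reflexivity. Qed.

Lemma RtoC_nz (x : R) : x <> 0 -> RtoC x <> RtoC 0.
Proof. intros H E. apply H. apply (f_equal Re) in E. exact E. Qed.

Lemma Cmod_sqr (z : C) : Cmod z ^ 2 = Re z ^ 2 + Im z ^ 2.
Proof. apply Cmod2_alt. Qed.

Lemma Re_le_Cmod (z : C) : Re z <= Cmod z.
Proof. pose proof (re_le_Cmod z). pose proof (Rle_abs (Re z)). lra. Qed.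

Lemma Im_le_Cmod (z : C) : Rabs (Im z) <= Cmod z.
Proof.
  pose proof (Rmax_Cmod z) as H. pose proof (Rmax_r (Rabs (fst z)) (Rabs (snd z))).
  unfold Im. lra.
Qed.

Lemma Cmod_le_ReIm (z : C) : Cmod z <= Rabs (Re z) + Rabs (Im z).
Proof.
  assert (H := Cmod_sqr z). assert (H0 := Cmod_ge_0 z).
  rewrite <- (pow2_abs (Re z)), <- (pow2_abs (Im z)) in H.
  pose proof (Rabs_pos (Re z)). pose proof (Rabs_pos (Im z)). nra.
Qed.

Lemma Cmod_minus_sym (a b : C) : Cmod (a - b)%C = Cmod (b - a)%C.
Proof. rewrite <- Cmod_opp. f_equal. ring. Qed.

Lemma Cmod_triangle_minus (a b : C) : Cmod (a - b)%C <= Cmod a + Cmod b.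
Proof. unfold Cminus. eapply Rle_trans; [apply Cmod_triangle|]. rewrite Cmod_opp; lra. Qed.

Lemma Cmod_triangle_inv (a b : C) : Cmod a - Cmod b <= Cmod (a - b)%C.
Proof.
  pose proof (Cmod_triangle (a - b)%C b) as H.
  replace (a - b + b)%C with a in H by ring. lra.
Qed.

Lemma Cmod_RtoC_pos (x : R) : 0 <= x -> Cmod (RtoC x) = x.
Proof. intros; rewrite Cmod_R, Rabs_pos_eq; lra. Qed.

Lemma zsum_ext (f g : nat -> C) n :
  (forall k, (k < n)%nat -> f k = g k) -> zsum f n = zsum g n.
Proof.
  induction n; intros H; simpl; [reflexivity|].
  rewrite IHn by (intros; apply H; lia). rewrite H by lia. reflexivity.
Qed.

Lemma rsum_ext (f g : nat -> R) n :
  (forall k, (k < n)%nat -> f k = g k) -> rsum f n = rsum g n.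
Proof.
  induction n; intros H; simpl; [reflexivity|].
  rewrite IHn by (intros; apply H; lia). rewrite H by lia. reflexivity.
Qed.

Lemma zsum_plus f g n : zsum (fun k => f k + g k)%C n = (zsum f n + zsum g n)%C.
Proof. induction n; simpl; [ring|]. rewrite IHn; ring. Qed.

Lemma zsum_mult_l c f n : zsum (fun k => c * f k)%C n = (c * zsum f n)%C.
Proof. induction n; simpl; [ring|]. rewrite IHn; ring. Qed.

Lemma zsum_opp f n : zsum (fun k => - f k)%C n = (- zsum f n)%C.
Proof. induction n; simpl; [ring|]. rewrite IHn; ring. Qed.

Lemma zsum_0 f n : (forall k, (k < n)%nat -> f k = RtoC 0) -> zsum f n = RtoC 0.
Proof.
  induction n; intros H; simpl; [reflexivity|].
  rewrite IHn by (intros; apply H; lia). rewrite H by lia. ring.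
Qed.

Lemma zsum_head f n : zsum f (S n) = (f O + zsum (fun k => f (S k)) n)%C.
Proof. induction n; simpl in *; [ring|]. rewrite IHn; ring. Qed.

Lemma zsum_swap (f : nat -> nat -> C) m n :
  zsum (fun i => zsum (fun j => f i j) n) m = zsum (fun j => zsum (fun i => f i j) m) n.
Proof.
  induction m; simpl.
  - symmetry; apply zsum_0; reflexivity.
  - rewrite IHm, <- zsum_plus. reflexivity.
Qed.

Lemma zsum_triangle (f : nat -> nat -> C) n :
  zsum (fun k => zsum (fun j => f k j) (S k)) n =
  zsum (fun j => zsum (fun i => f (j + i)%nat j) (n - j)) n.
Proof.
  induction n; [reflexivity|].
  change (zsum (fun k => zsum (fun j => f k j) (S k)) n + zsum (fun j => f n j) (S n)
    = zsum (fun j => zsum (fun i => f (j + i)%nat j) (S n - j)) n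
      + zsum (fun i => f (n + i)%nat n) (S n - n))%C.
  rewrite IHn. replace (S n - n)%nat with 1%nat by lia.
  simpl (zsum _ 1). rewrite Nat.add_0_r.
  change (zsum (fun j => f n j) (S n)) with (zsum (fun j => f n j) n + f n n)%C.
  rewrite (zsum_ext (fun j => zsum (fun i => f (j + i)%nat j) (S n - j))
             (fun j => zsum (fun i => f (j + i)%nat j) (n - j) + f n j)%C).
  - rewrite zsum_plus. change (zsum (f n) n) with (zsum (fun j => f n j) n). ring.
  - intros j Hj. replace (S n - j)%nat with (S (n - j)) by lia. simpl.
    replace (j + (n - j))%nat with n by lia. reflexivity.
Qed.

Lemma zsum_rev f n : zsum f n = zsum (fun k => f (n - 1 - k)%nat) n.
Proof.
  induction n; [reflexivity|].
  rewrite (zsum_head (fun k => f (S n - 1 - k)%nat)). simpl zsum at 1.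
  rewrite IHn. replace (S n - 1 - 0)%nat with n by lia.
  rewrite (zsum_ext (fun k => f (n - 1 - k)%nat) (fun k => f (S n - 1 - S k)%nat)).
  - ring.
  - intros; f_equal; lia.
Qed.

Lemma Re_zsum f n : Re (zsum f n) = rsum (fun k => Re (f k)) n.
Proof. induction n; cbn [zsum rsum]; [reflexivity|]. rewrite Re_plus, IHn; reflexivity. Qed.
Lemma Im_zsum f n : Im (zsum f n) = rsum (fun k => Im (f k)) n.
Proof. induction n; cbn [zsum rsum]; [reflexivity|]. rewrite Im_plus, IHn; reflexivity. Qed.

Lemma zsum_RtoC f n : zsum (fun k => RtoC (f k)) n = RtoC (rsum f n).
Proof. induction n; simpl; [reflexivity|]. rewrite IHn, RtoC_plus; reflexivity. Qed.

Lemma Cmod_zsum_le f n : Cmod (zsum f n) <= rsum (fun k => Cmod (f k)) n.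
Proof.
  induction n; simpl; [rewrite Cmod_0; lra|].
  eapply Rle_trans; [apply Cmod_triangle|]. lra.
Qed.

Lemma rsum_le f g n : (forall k, (k < n)%nat -> f k <= g k) -> rsum f n <= rsum g n.
Proof.
  induction n; intros H; simpl; [lra|].
  specialize (IHn (fun k Hk => H k (Nat.lt_lt_succ_r _ _ Hk))).
  specialize (H n (Nat.lt_succ_diag_r n)). lra.
Qed.

Lemma rsum_ge_0 f n : (forall k, (k < n)%nat -> 0 <= f k) -> 0 <= rsum f n.
Proof.
  intros H. replace 0 with (rsum (fun _ => 0) n).
  - apply rsum_le; assumption.
  - induction n; simpl; [reflexivity|]. rewrite IHn; [ring|intros; apply H; lia].
Qed.

Lemma rsum_scal c f n : rsum (fun k => c * f k) n = c * rsum f n.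
Proof. induction n; simpl; [ring|]. rewrite IHn; ring. Qed.

Lemma rsum_plus f g n : rsum (fun k => f k + g k) n = rsum f n + rsum g n.
Proof. induction n; simpl; [ring|]. rewrite IHn; ring. Qed.

Lemma rsum_const c n : rsum (fun _ => c) n = INR n * c.
Proof. induction n; [simpl; ring|]. rewrite S_INR; simpl; rewrite IHn; ring. Qed.

Lemma rsum_term_le f n k : (forall i, (i < n)%nat -> 0 <= f i) -> (k < n)%nat -> f k <= rsum f n.
Proof.
  induction n; intros H Hk; [lia|]. simpl.
  assert (H0 : 0 <= rsum f n) by (apply rsum_ge_0; intros; apply H; lia).
  assert (Hn := H n (Nat.lt_succ_diag_r n)).
  destruct (Nat.eq_dec k n) as [->|]; [lra|].
  assert (f k <= rsum f n) by (apply IHn; [intros; apply H; lia|lia]). lra.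
Qed.

Lemma rsum_0_inv f n : (forall i, (i < n)%nat -> 0 <= f i) -> rsum f n <= 0 ->
  forall k, (k < n)%nat -> f k = 0.
Proof.
  intros H H0 k Hk. pose proof (rsum_term_le f n k H Hk). specialize (H k Hk). lra.
Qed.

Lemma csum_zsum N g : csum N g = zsum g N.
Proof.
  unfold csum.
  assert (Hc : forall l c, fold_right Cplus c l = (fold_right Cplus (RtoC 0) l + c)%C).
  { induction l; intros; simpl; [ring|]. rewrite IHl; ring. }
  induction N; [reflexivity|].
  rewrite seq_S, map_app, fold_right_app. simpl. rewrite Hc, IHN. ring.
Qed.

(** This pointwise expansion with cubic remainder stands in for holomorphy. It passes through sums,
    products, quotients and [cexp], yields the complex derivative, and is precise enough for a
    discrete mean value inequality, so neither Cauchy theory nor second derivatives occur. *)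
Definition quad (F : C -> C) (z : C) : Prop :=
  exists (a b : C) (d K : R), 0 < d /\ 0 <= K /\ forall h : C, Cmod h < d ->
    Cmod (F (z + h)%C - (F z + a * h + b * h ^ 2))%C <= K * Cmod h ^ 3.

Lemma quad_const c z : quad (fun _ => c) z.
Proof.
  exists (RtoC 0), (RtoC 0), 1, 0. repeat split; try lra. intros h _.
  replace (c - (c + 0 * h + 0 * h ^ 2))%C with (RtoC 0) by ring.
  rewrite Cmod_0. lra.
Qed.

Lemma quad_id z : quad (fun x => x) z.
Proof.
  exists (RtoC 1), (RtoC 0), 1, 0. repeat split; try lra. intros h _.
  replace (z + h - (z + 1 * h + 0 * h ^ 2))%C with (RtoC 0) by ring.
  rewrite Cmod_0. lra.
Qed.

Lemma quad_ext_loc F G z d : 0 < d -> quad F z ->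
  (forall x, Cmod (x - z)%C < d -> F x = G x) -> quad G z.
Proof.
  intros Hd (a & b & d' & K & Hd' & HK & H) E.
  exists a, b, (Rmin d d'), K. repeat split; auto.
  - apply Rmin_glb_lt; auto.
  - intros h Hh. pose proof (Rmin_l d d'). pose proof (Rmin_r d d').
    rewrite <- (E (z + h)%C), <- (E z).
    + apply H; lra.
    + replace (z - z)%C with (RtoC 0) by ring. rewrite Cmod_0; lra.
    + replace (z + h - z)%C with h by ring. lra.
Qed.

Lemma quad_ext F G z : (forall x, F x = G x) -> quad F z -> quad G z.
Proof. intros E H. apply (quad_ext_loc F G z 1); auto; lra. Qed.

Lemma quad_plus F G z : quad F z -> quad G z -> quad (fun x => F x + G x)%C z.
Proof.
  intros (a & b & d & K & Hd & HK & H) (a' & b' & d' & K' & Hd' & HK' & H').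
  exists (a + a')%C, (b + b')%C, (Rmin d d'), (K + K'). repeat split.
  - apply Rmin_glb_lt; auto.
  - lra.
  - intros h Hh. pose proof (Rmin_l d d'). pose proof (Rmin_r d d').
    specialize (H h ltac:(lra)). specialize (H' h ltac:(lra)).
    eapply Rle_trans; [|rewrite Rmult_plus_distr_r; apply Rplus_le_compat; [exact H|exact H']].
    eapply Rle_trans; [|apply Cmod_triangle]. right; f_equal; ring.
Qed.

Lemma Cmod_mult_le (a b : C) A B : Cmod a <= A -> Cmod b <= B -> Cmod (a * b)%C <= A * B.
Proof.
  intros. rewrite Cmod_mult. apply Rmult_le_compat; auto; apply Cmod_ge_0.
Qed.

Lemma Cmod_plus_le (a b : C) A B : Cmod a <= A -> Cmod b <= B -> Cmod (a + b)%C <= A + B.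
Proof. intros. eapply Rle_trans; [apply Cmod_triangle|]. lra. Qed.

Lemma quad_mult F G z : quad F z -> quad G z -> quad (fun x => F x * G x)%C z.
Proof.
  intros (a & b & d & K & Hd & HK & H) (a' & b' & d' & K' & Hd' & HK' & H').
  set (f := F z). set (g := G z).
  set (L := Cmod f + Cmod a + Cmod b). set (L' := Cmod g + Cmod a' + Cmod b').
  exists (f * a' + a * g)%C, (f * b' + a * a' + b * g)%C, (Rmin 1 (Rmin d d')),
    (K * (L' + K') + L * K' + (Cmod a * Cmod b' + Cmod b * Cmod a' + Cmod b * Cmod b')).
  pose proof (Cmod_ge_0 f). pose proof (Cmod_ge_0 a). pose proof (Cmod_ge_0 b).
  pose proof (Cmod_ge_0 g). pose proof (Cmod_ge_0 a'). pose proof (Cmod_ge_0 b').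
  repeat split.
  - repeat apply Rmin_glb_lt; lra.
  - unfold L, L'. repeat apply Rplus_le_le_0_compat; apply Rmult_le_pos; lra.
  - intros h Hh. cbv beta.
    pose proof (Rmin_l 1 (Rmin d d')). pose proof (Rmin_r 1 (Rmin d d')).
    pose proof (Rmin_l d d'). pose proof (Rmin_r d d').
    specialize (H h ltac:(lra)). specialize (H' h ltac:(lra)).
    set (r := Cmod h) in *. assert (Hr : 0 <= r) by apply Cmod_ge_0.
    assert (Hr1 : r <= 1) by lra.
    set (p := (f + a * h + b * h ^ 2)%C) in *. set (p' := (g + a' * h + b' * h ^ 2)%C) in *.
    fold f in H. fold g in H'. fold p in H. fold p' in H'.
    assert (Hp : Cmod p <= L).
    { unfold p, L. repeat apply Cmod_plus_le; try lra.
      - rewrite Cmod_mult. fold r. nra.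
      - rewrite Cmod_mult, Cmod_pow. fold r. assert (r ^ 2 <= 1) by nra. nra. }
    assert (Hp' : Cmod p' <= L').
    { unfold p', L'. repeat apply Cmod_plus_le; try lra.
      - rewrite Cmod_mult. fold r. nra.
      - rewrite Cmod_mult, Cmod_pow. fold r. assert (r ^ 2 <= 1) by nra. nra. }
    assert (Hr3 : 0 <= r ^ 3) by (apply pow_le; auto).
    assert (Hr31 : r ^ 3 <= 1) by (rewrite <- (pow1 3); apply pow_incr; lra).
    assert (HG : Cmod (G (z + h)%C) <= L' + K').
    { replace (G (z + h)%C) with (p' + (G (z + h) - p'))%C by ring.
      apply Cmod_plus_le; auto. eapply Rle_trans; [exact H'|]. nra. }
    cbv beta. fold f g.
    replace (F (z + h) * G (z + h) - (f * g + (f * a' + a * g) * h + (f * b' + a * a' + b * g) * h ^ 2))%C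
      with ((F (z + h) - p) * G (z + h) + p * (G (z + h) - p')
            + (a * b' + b * a' + b * b' * h) * h ^ 3)%C by (unfold p, p'; ring).
    rewrite (Rmult_plus_distr_r (K * (L' + K') + L * K')), (Rmult_plus_distr_r (K * (L' + K'))).
    apply Cmod_plus_le; [apply Cmod_plus_le|].
    + replace (K * (L' + K') * r ^ 3) with ((K * r ^ 3) * (L' + K')) by ring.
      apply Cmod_mult_le; auto.
    + rewrite Rmult_assoc. apply Cmod_mult_le; auto.
    + apply Cmod_mult_le.
      * repeat apply Cmod_plus_le; try (rewrite Cmod_mult; lra).
        rewrite !Cmod_mult. fold r. assert (0 <= Cmod b * Cmod b') by (apply Rmult_le_pos; lra). nra.
      * rewrite Cmod_pow. fold r. lra.
Qed.

Lemma quad_scal c F z : quad F z -> quad (fun x => c * F x)%C z.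
Proof. intros. apply quad_mult; auto. apply quad_const. Qed.

Lemma quad_opp F z : quad F z -> quad (fun x => - F x)%C z.
Proof.
  intros. apply (quad_ext (fun x => (RtoC (-1)) * F x)%C).
  - intros. replace (RtoC (-1)) with (- RtoC 1)%C by (rewrite <- RtoC_opp; reflexivity). ring.
  - apply quad_scal; auto.
Qed.

Lemma quad_minus F G z : quad F z -> quad G z -> quad (fun x => F x - G x)%C z.
Proof. intros. apply quad_plus; auto. apply quad_opp; auto. Qed.

Lemma quad_pow F z n : quad F z -> quad (fun x => F x ^ n)%C z.
Proof.
  intros H. induction n.
  - exact (quad_const (RtoC 1) z).
  - apply (quad_ext (fun x => F x * F x ^ n)%C); [reflexivity|]. apply quad_mult; auto.
Qed.

Lemma quad_zsum (F : nat -> C -> C) z n :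
  (forall k, (k < n)%nat -> quad (F k) z) -> quad (fun x => zsum (fun k => F k x) n) z.
Proof.
  induction n; intros H; simpl.
  - exact (quad_const (RtoC 0) z).
  - apply quad_plus; [apply IHn; intros; apply H; lia | apply H; lia].
Qed.

Definition ccont (F : C -> C) (z : C) : Prop :=
  forall eps, 0 < eps -> exists d, 0 < d /\ forall x, Cmod (x - z)%C < d -> Cmod (F x - F z)%C < eps.

Lemma quad_lip F z : quad F z -> exists d L, 0 < d /\ 0 < L /\
  forall h, Cmod h < d -> Cmod (F (z + h) - F z)%C <= L * Cmod h.
Proof.
  intros (a & b & d & K & Hd & HK & H).
  exists (Rmin 1 d), (Cmod a + Cmod b + K + 1).
  pose proof (Cmod_ge_0 a). pose proof (Cmod_ge_0 b).
  repeat split; [apply Rmin_glb_lt; lra | lra |].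
  intros h Hh. pose proof (Rmin_l 1 d). pose proof (Rmin_r 1 d).
  specialize (H h ltac:(lra)). set (r := Cmod h) in *.
  assert (Hr : 0 <= r) by apply Cmod_ge_0.
  replace (F (z + h) - F z)%C with
    ((F (z + h) - (F z + a * h + b * h ^ 2)) + (a * h + b * h ^ 2))%C by ring.
  assert (r ^ 2 <= r) by nra. assert (r ^ 3 <= r) by (simpl; nra).
  eapply Rle_trans.
  - apply Cmod_plus_le; [exact H|apply Cmod_plus_le; rewrite Cmod_mult; [right; reflexivity|]].
    rewrite Cmod_pow; right; reflexivity.
  - fold r. nra.
Qed.

Lemma quad_ccont F z : quad F z -> ccont F z.
Proof.
  intros H eps He. destruct (quad_lip F z H) as (d & L & Hd & HL & HLip).
  exists (Rmin d (eps / (2 * L))). split.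
  - apply Rmin_glb_lt; auto. apply Rdiv_lt_0_compat; lra.
  - intros x Hx. pose proof (Rmin_l d (eps / (2 * L))). pose proof (Rmin_r d (eps / (2 * L))).
    specialize (HLip (x - z)%C ltac:(lra)). replace (z + (x - z))%C with x in HLip by ring.
    eapply Rle_lt_trans; [exact HLip|].
    apply Rle_lt_trans with (L * (eps / (2 * L))).
    + apply Rmult_le_compat_l; lra.
    + replace (L * (eps / (2 * L))) with (eps / 2) by (field; lra). lra.
Qed.

Lemma quad_inv F z : quad F z -> F z <> RtoC 0 -> quad (fun x => / F x)%C z.
Proof.
  intros HF Hf. pose proof (quad_ccont F z HF) as Hc.
  destruct HF as (a & b & d & K & Hd & HK & H).
  set (f := F z) in *.
  assert (Hm : 0 < Cmod f) by (apply Cmod_gt_0; auto).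
  destruct (Hc (Cmod f / 2) ltac:(lra)) as (d' & Hd' & Hc').
  (* 1/(f + a h + b h^2) = 1/f - (a/f^2) h + (a^2/f^3 - b/f^2) h^2 + O(h^3) *)
  set (a' := (- a / f ^ 2)%C). set (b' := (a ^ 2 / f ^ 3 - b / f ^ 2)%C).
  set (L := Cmod (/ f)%C + Cmod a' + Cmod b').
  pose proof (Cmod_ge_0 (/ f)%C). pose proof (Cmod_ge_0 a'). pose proof (Cmod_ge_0 b').
  pose proof (Cmod_ge_0 (a * b' + b * a')%C). pose proof (Cmod_ge_0 (b * b')%C).
  set (K0 := K * L + (Cmod (a * b' + b * a')%C + Cmod (b * b')%C)).
  assert (HK0 : 0 <= K0).
  { unfold K0, L. assert (0 <= K * (Cmod (/ f) + Cmod a' + Cmod b')) by (apply Rmult_le_pos; lra). lra. }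
  exists a', b', (Rmin 1 (Rmin d d')), (K0 * (2 / Cmod f)). repeat split.
  - repeat apply Rmin_glb_lt; lra.
  - apply Rmult_le_pos; auto. apply Rlt_le, Rdiv_lt_0_compat; lra.
  - intros h Hh. cbv beta.
    pose proof (Rmin_l 1 (Rmin d d')). pose proof (Rmin_r 1 (Rmin d d')).
    pose proof (Rmin_l d d'). pose proof (Rmin_r d d').
    specialize (H h ltac:(lra)).
    assert (Hfh : Cmod f / 2 <= Cmod (F (z + h)%C)).
    { specialize (Hc' (z + h)%C).
      replace (z + h - z)%C with h in Hc' by ring. specialize (Hc' ltac:(lra)).
      rewrite Cmod_minus_sym in Hc'. fold f in Hc'.
      pose proof (Cmod_triangle_inv f (F (z + h)%C)). lra. }
    set (w := F (z + h)%C) in *.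
    assert (Hw : w <> RtoC 0) by (apply Cmod_gt_0; lra).
    set (r := Cmod h) in *. assert (Hr : 0 <= r) by apply Cmod_ge_0.
    set (q := (/ f + a' * h + b' * h ^ 2)%C).
    assert (Hr3 : 0 <= r ^ 3) by (apply pow_le; auto).
    assert (Hq : Cmod q <= L).
    { unfold q, L. repeat apply Cmod_plus_le; try lra.
      - rewrite Cmod_mult. fold r. nra.
      - rewrite Cmod_mult, Cmod_pow. fold r. assert (r ^ 2 <= 1) by nra. nra. }
    assert (E : (1 - w * q)%C =
      (- ((w - (f + a * h + b * h ^ 2)) * q) - ((a * b' + b * a') + b * b' * h) * h ^ 3)%C).
    { unfold q, a', b'. field. auto. }
    cbv beta. fold f w. fold q.
    replace (/ w - q)%C with ((1 - w * q) * / w)%C by (field; auto).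
    replace (K0 * (2 / Cmod f) * r ^ 3) with ((K0 * r ^ 3) * (2 / Cmod f)) by ring.
    apply Cmod_mult_le.
    + rewrite E. eapply Rle_trans; [apply Cmod_triangle_minus|]. rewrite Cmod_opp.
      unfold K0. rewrite Rmult_plus_distr_r. apply Rplus_le_compat.
      * replace (K * L * r ^ 3) with ((K * r ^ 3) * L) by ring. apply Cmod_mult_le; auto.
      * apply Cmod_mult_le; [|rewrite Cmod_pow; fold r; lra].
        apply Cmod_plus_le; [lra|]. rewrite (Cmod_mult (b * b')%C). fold r. nra.
    + rewrite Cmod_inv by auto. replace (2 / Cmod f) with (/ (Cmod f / 2)) by (field; lra).
      apply Rinv_le_contravar; lra.
Qed.

Lemma quad_div F G z : quad F z -> quad G z -> G z <> RtoC 0 -> quad (fun x => F x / G x)%C z.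
Proof. intros. apply quad_mult; auto. apply quad_inv; auto. Qed.

(** * The complex exponential *)

Definition cis (t : R) : C := (cos t, sin t).

Lemma Re_cis t : Re (cis t) = cos t. Proof. reflexivity. Qed.
Lemma Im_cis t : Im (cis t) = sin t. Proof. reflexivity. Qed.

Lemma Cmod_cis t : Cmod (cis t) = 1.
Proof.
  unfold cis, Cmod; simpl. pose proof (sin2_cos2 t) as H. unfold Rsqr in H.
  replace (cos t * (cos t * 1) + sin t * (sin t * 1)) with 1 by lra. apply sqrt_1.
Qed.

Lemma cis_plus a b : cis (a + b) = (cis a * cis b)%C.
Proof. apply C_eq; unfold cis, Re, Im; simpl; [rewrite cos_plus|rewrite sin_plus]; ring. Qed.

Lemma cis_0 : cis 0 = RtoC 1.
Proof. unfold cis. rewrite cos_0, sin_0. reflexivity. Qed.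

Lemma cis_conj t : Cconj (cis t) = cis (- t).
Proof. unfold cis, Cconj; simpl. rewrite cos_neg, sin_neg. reflexivity. Qed.

Lemma cis_pow t k : (cis t ^ k)%C = cis (INR k * t).
Proof.
  induction k.
  - simpl. rewrite Rmult_0_l, cis_0. reflexivity.
  - rewrite Cpow_S, IHk, S_INR, <- cis_plus. f_equal; ring.
Qed.

Lemma cexp_cis z : cexp z = (RtoC (exp (Re z)) * cis (Im z))%C.
Proof. apply C_eq; unfold cexp, cis, Re, Im; simpl; ring. Qed.

Lemma cexp_plus a b : cexp (a + b)%C = (cexp a * cexp b)%C.
Proof. rewrite !cexp_cis, Re_plus, Im_plus, exp_plus, cis_plus, RtoC_mult. ring. Qed.

Lemma Cmod_cexp z : Cmod (cexp z) = exp (Re z).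
Proof.
  rewrite cexp_cis, Cmod_mult, Cmod_cis, Cmod_RtoC_pos; [ring|]. apply Rlt_le, exp_pos.
Qed.

(** Integrating from 0 raises the order of vanishing by one. Iterated from a bounded top derivative,
    this yields the Taylor remainders of [exp], [sin] and [cos]. *)
Lemma deriv_power_bound (g g' : R -> R) K m :
  0 <= K -> (forall x, is_derive g x (g' x)) -> g 0 = 0 ->
  (forall x, Rabs x <= 1 -> Rabs (g' x) <= K * Rabs x ^ m) ->
  forall x, Rabs x <= 1 -> Rabs (g x) <= K * Rabs x ^ S m.
Proof.
  intros HK Hd H0 Hb x Hx.
  destruct (MVT_gen g 0 x g') as (c & Hc & E).
  - intros; apply Hd.
  - intros y _. apply continuity_pt_filterlim. apply (@ex_derive_continuous R_AbsRing R_NormedModule).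
    exists (g' y); apply Hd.
  - rewrite H0, !Rminus_0_r in E. rewrite E, Rabs_mult.
    assert (Hcx : Rabs c <= Rabs x).
    { unfold Rmin, Rmax in Hc. destruct (Rle_dec 0 x).
      - rewrite !Rabs_pos_eq; lra.
      - rewrite !Rabs_left1; lra. }
    specialize (Hb c ltac:(lra)).
    assert (Rabs c ^ m <= Rabs x ^ m) by (apply pow_incr; split; [apply Rabs_pos|auto]).
    pose proof (Rabs_pos x). simpl.
    apply Rle_trans with (K * Rabs c ^ m * Rabs x); [apply Rmult_le_compat_r; auto|].
    replace (K * (Rabs x * Rabs x ^ m)) with (K * Rabs x ^ m * Rabs x) by ring.
    apply Rmult_le_compat_r; auto. apply Rmult_le_compat_l; auto.
Qed.

Lemma exp_quad x : Rabs x <= 1 -> Rabs (exp x - (1 + x + x ^ 2 / 2)) <= 3 * Rabs x ^ 3.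
Proof.
  revert x.
  apply (deriv_power_bound (fun x => exp x - (1 + x + x ^ 2 / 2)) (fun x => exp x - (1 + x))); [lra| | |].
  - intros x. auto_derive; auto. field.
  - rewrite exp_0. field.
  - apply (deriv_power_bound (fun x => exp x - (1 + x)) (fun x => exp x - 1)); [lra| | |].
    + intros x. auto_derive; auto. ring.
    + rewrite exp_0. ring.
    + apply (deriv_power_bound (fun x => exp x - 1) exp); [lra| | |].
      * intros x. auto_derive; auto. ring.
      * rewrite exp_0. ring.
      * intros x Hx. simpl. rewrite Rabs_pos_eq by (apply Rlt_le, exp_pos).
        apply Rle_trans with (exp 1); [|pose proof exp_le_3; lra].
        destruct (Rle_lt_or_eq_dec x 1) as [H|H].
        { pose proof (Rle_abs x); lra. }
        { apply Rlt_le, exp_increasing; auto. }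
        { subst; lra. }
Qed.

Lemma sin_quad y : Rabs y <= 1 -> Rabs (sin y - y) <= 1 * Rabs y ^ 3.
Proof.
  revert y.
  apply (deriv_power_bound (fun y => sin y - y) (fun y => cos y - 1)); [lra| | |].
  - intros x. auto_derive; auto. ring.
  - rewrite sin_0. ring.
  - apply (deriv_power_bound (fun y => cos y - 1) (fun y => - sin y)); [lra| | |].
    + intros x. auto_derive; auto. ring.
    + rewrite cos_0. ring.
    + intros x Hx. rewrite Rabs_Ropp. revert x Hx.
      apply (deriv_power_bound sin cos); [lra| | |].
      { intros x. auto_derive; auto. ring. }
      { apply sin_0. }
      { intros x _. simpl. pose proof (COS_bound x). apply Rabs_le. lra. }
Qed.

Lemma cos_quad y : Rabs y <= 1 -> Rabs (cos y - (1 - y ^ 2 / 2)) <= 1 * Rabs y ^ 4.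
Proof.
  revert y.
  apply (deriv_power_bound (fun y => cos y - (1 - y ^ 2 / 2)) (fun y => - (sin y - y))); [lra| | |].
  - intros x. auto_derive; auto. field.
  - rewrite cos_0. field.
  - intros x Hx. rewrite Rabs_Ropp. apply sin_quad; auto.
Qed.

Lemma cexp_quad_0 w : Cmod w <= 1 -> Cmod (cexp w - (1 + w + w ^ 2 / 2))%C <= 30 * Cmod w ^ 3.
Proof.
  intros Hw. destruct w as [x y].
  set (r := Cmod (x, y)) in *. assert (Hr : 0 <= r) by apply Cmod_ge_0.
  assert (Hx : Rabs x <= r) by apply (re_le_Cmod (x, y)).
  assert (Hy : Rabs y <= r) by apply (Im_le_Cmod (x, y)).
  pose proof (Rabs_pos x). pose proof (Rabs_pos y).
  pose proof (exp_quad x ltac:(lra)) as H1.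
  pose proof (cos_quad y ltac:(lra)) as H2.
  pose proof (sin_quad y ltac:(lra)) as H3.
  rewrite cexp_cis. change (Re (x, y)) with x. change (Im (x, y)) with y.
  set (r1 := exp x - (1 + x + x ^ 2 / 2)) in *.
  set (r2 := ((cos y - (1 - y ^ 2 / 2), sin y - y) : C)).
  assert (Hr2 : Cmod r2 <= 2 * r ^ 3).
  { eapply Rle_trans; [apply Cmod_le_ReIm|]. unfold r2, Re, Im; cbn [fst snd].
    assert (Rabs y ^ 4 <= r ^ 3).
    { apply Rle_trans with (r ^ 4); [apply pow_incr; lra|]. pose proof (pow_le r 3 Hr).
      replace (r ^ 4) with (r * r ^ 3) by ring. nra. }
    assert (Rabs y ^ 3 <= r ^ 3) by (apply pow_incr; lra). lra. }
  assert (Hr1 : Rabs r1 <= 3 * r ^ 3).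
  { assert (Rabs x ^ 3 <= r ^ 3) by (apply pow_incr; lra). lra. }
  assert (E1 : RtoC (exp x) = (1 + RtoC x + RtoC x ^ 2 / 2 + RtoC r1)%C).
  { apply C_eq; unfold r1, Re, Im; simpl; field. }
  assert (E2 : cis y = (1 + Ci * RtoC y - RtoC y ^ 2 / 2 + r2)%C).
  { apply C_eq; unfold cis, r2, Re, Im; simpl; field. }
  assert (E3 : ((x, y) : C) = (RtoC x + Ci * RtoC y)%C).
  { apply C_eq; unfold Re, Im; simpl; ring. }
  assert (Hcis : Cmod (cis y) <= 1) by (rewrite Cmod_cis; lra).
  (* The two quadratic parts multiply to [1 + w + w^2 / 2] plus three mixed terms of degree 3 and 4,
     by [Ci ^ 2 = -1]. Every other term contains one of the remainders [r1], [r2]. *)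
  assert (E4 : (RtoC (exp x) * cis y - (1 + (x, y) + (x, y) ^ 2 / 2))%C =
    (RtoC r1 * cis y + (1 + RtoC x + RtoC x ^ 2 / 2) * r2
      + (RtoC x ^ 2 * RtoC y * (Ci / 2) - RtoC x * RtoC y ^ 2 * RtoC (/2) - (RtoC x ^ 2 * RtoC y ^ 2) * RtoC (/4)))%C).
  { rewrite E1, E3.
    replace r2 with (cis y - (1 + Ci * RtoC y - RtoC y ^ 2 / 2))%C by (rewrite E2; ring).
    generalize (cis y), (RtoC r1), (RtoC x), (RtoC y). intros cy R1 X Y.
    replace (RtoC (/2)) with (/ 2)%C by (symmetry; apply RtoC_inv; lra).
    replace (RtoC (/4)) with (/ 4)%C by (symmetry; apply RtoC_inv; lra).
    assert (Hi : (Ci ^ 2)%C = (- (1))%C) by (apply C_eq; unfold Re, Im; simpl; ring).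
    replace ((X + Ci * Y) ^ 2)%C with (X ^ 2 + 2 * Ci * X * Y + Ci ^ 2 * Y ^ 2)%C by ring.
    rewrite Hi. field; repeat split; apply RtoC_nz; lra. }
  rewrite E4.
  assert (Hr3 : 0 <= r ^ 3) by (apply pow_le; auto).
  assert (Hm : forall a b, 0 <= a <= r -> 0 <= b <= r -> a ^ 2 * b <= r ^ 3).
  { intros a b Ha Hb. replace (r ^ 3) with (r ^ 2 * r) by ring.
    apply Rmult_le_compat; try lra; [apply pow_le; lra|apply pow_incr; lra]. }
  apply Rle_trans with (3 * r ^ 3 * 1 + 3 * (2 * r ^ 3) + (r ^ 3 * 1 + r ^ 3 * 1 + r ^ 3 * 1)); [|lra].
  assert (Hinv2 : Cmod (RtoC (/2)) <= 1) by (rewrite Cmod_RtoC_pos; lra).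
  assert (Hinv4 : Cmod (RtoC (/4)) <= 1) by (rewrite Cmod_RtoC_pos; lra).
  assert (HCi2 : Cmod (Ci / 2)%C <= 1).
  { replace (Ci / 2)%C with (Ci * RtoC (/2))%C by (unfold Cdiv; rewrite RtoC_inv by lra; reflexivity).
    rewrite Cmod_mult, Cmod_Ci. lra. }
  apply Cmod_plus_le; [apply Cmod_plus_le|].
  - apply Cmod_mult_le; auto. rewrite Cmod_R; auto.
  - apply Cmod_mult_le; auto.
    apply Rle_trans with (1 + 1 + 1); [|lra]. apply Cmod_plus_le; [apply Cmod_plus_le|].
    + rewrite Cmod_1; lra.
    + rewrite Cmod_R; lra.
    + unfold Cdiv. rewrite <- RtoC_inv by lra. rewrite Cmod_mult, Cmod_pow, Cmod_R.
      assert (Rabs x ^ 2 <= 1) by nra. assert (0 <= Rabs x ^ 2) by (apply pow_le; auto).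
      nra.
  - unfold Cminus. apply Cmod_plus_le; [apply Cmod_plus_le|]; rewrite ?Cmod_opp; apply Cmod_mult_le; auto.
    + rewrite Cmod_mult, Cmod_pow, !Cmod_R. apply Hm; lra.
    + rewrite Cmod_mult, Cmod_pow, !Cmod_R. rewrite Rmult_comm. apply Hm; lra.
    + rewrite Cmod_mult, !Cmod_pow, !Cmod_R.
      apply Rle_trans with (Rabs x ^ 2 * Rabs y); [|apply Hm; lra].
      apply Rmult_le_compat_l; [apply pow_le; auto|]. nra.
Qed.

Lemma quad_cexp F z : quad F z -> quad (fun x => cexp (F x)) z.
Proof.
  intros HF. destruct (quad_lip F z HF) as (d1 & L & Hd1 & HL & Hlip).
  destruct HF as (a & b & d & K & Hd & HK & H).
  set (f := F z) in *.
  set (A := Cmod a + Cmod b).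
  pose proof (Cmod_ge_0 a). pose proof (Cmod_ge_0 b).
  pose proof (Cmod_ge_0 (cexp f)) as He.
  set (K0 := 30 * L ^ 3 + K + (K * (L + A) + (Cmod a * Cmod b + Cmod b * Cmod b)) ).
  assert (HK0 : 0 <= K0).
  { assert (0 <= L ^ 3) by (apply pow_le; lra).
    unfold K0, A. repeat apply Rplus_le_le_0_compat; try apply Rmult_le_pos; lra. }
  exists (cexp f * a)%C, (cexp f * (b + a ^ 2 / 2))%C, (Rmin (Rmin 1 (/ L)) (Rmin d d1)), (Cmod (cexp f) * K0).
  assert (HiL : 0 < / L) by (apply Rinv_0_lt_compat; auto).
  repeat split.
  - repeat apply Rmin_glb_lt; lra.
  - apply Rmult_le_pos; auto.
  - intros h Hh. cbv beta.
    pose proof (Rmin_l (Rmin 1 (/L)) (Rmin d d1)). pose proof (Rmin_r (Rmin 1 (/L)) (Rmin d d1)).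
    pose proof (Rmin_l d d1). pose proof (Rmin_r d d1).
    pose proof (Rmin_l 1 (/L)). pose proof (Rmin_r 1 (/L)).
    specialize (H h ltac:(lra)). specialize (Hlip h ltac:(lra)). fold f in Hlip.
    fold f.
    set (r := Cmod h) in *. assert (Hr : 0 <= r) by apply Cmod_ge_0.
    set (w := (F (z + h) - f)%C) in *.
    assert (Hw1 : Cmod w <= 1).
    { eapply Rle_trans; [exact Hlip|]. replace 1 with (L * / L) by (field; lra).
      apply Rmult_le_compat_l; lra. }
    pose proof (cexp_quad_0 w Hw1) as Hq.
    replace (F (z + h)%C) with (f + w)%C by (unfold w; ring).
    rewrite cexp_plus.
    set (p := (a * h + b * h ^ 2)%C).
    assert (Hwp : Cmod (w - p)%C <= K * r ^ 3).
    { replace (w - p)%C with (F (z + h) - (f + a * h + b * h ^ 2))%C by (unfold w, p; ring). exact H. }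
    replace (cexp f * cexp w - (cexp f + cexp f * a * h + cexp f * (b + a ^ 2 / 2) * h ^ 2))%C
      with (cexp f * ((cexp w - (1 + w + w ^ 2 / 2)) + (w - p)
         + ((w - p) * (w + p) + (2 * a * b + b * b * h) * h ^ 3) / 2))%C.
    2:{ unfold p. field. }
    rewrite Rmult_assoc.
    assert (Hr3 : 0 <= r ^ 3) by (apply pow_le; auto).
    apply Cmod_mult_le; [lra|].
    apply Rle_trans with (30 * L ^ 3 * r ^ 3 + K * r ^ 3 +
      ((K * r ^ 3) * (L + A) + (2 * Cmod a * Cmod b + Cmod b * Cmod b) * r ^ 3) * / 2).
    2:{ assert (0 <= K * (L + A) * r ^ 3) by (repeat apply Rmult_le_pos; unfold A; lra).
        assert (0 <= Cmod b * Cmod b * r ^ 3) by (repeat apply Rmult_le_pos; lra).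
        unfold K0. nra. }
    assert (Hhalf : Cmod (/ 2)%C = / 2) by (rewrite <- RtoC_inv by lra; apply Cmod_RtoC_pos; lra).
    apply Cmod_plus_le; [apply Cmod_plus_le; auto|].
    + eapply Rle_trans; [exact Hq|]. rewrite Rmult_assoc. apply Rmult_le_compat_l; [lra|].
      rewrite <- Rpow_mult_distr. apply pow_incr. split; [apply Cmod_ge_0|auto].
    + unfold Cdiv. rewrite Cmod_mult, Hhalf.
      assert (Hsum : Cmod ((w - p) * (w + p) + (2 * a * b + b * b * h) * h ^ 3)%C
         <= (K * r ^ 3) * (L + A) + (2 * Cmod a * Cmod b + Cmod b * Cmod b) * r ^ 3).
      { apply Cmod_plus_le; apply Cmod_mult_le; auto.
        - apply Cmod_plus_le.
          + eapply Rle_trans; [exact Hlip|]. nra.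
          + unfold p, A. apply Cmod_plus_le; rewrite Cmod_mult; [fold r; nra|].
            rewrite Cmod_pow. fold r. assert (r ^ 2 <= 1) by nra. nra.
        - apply Cmod_plus_le.
          + rewrite !Cmod_mult, Cmod_RtoC_pos by lra. lra.
          + rewrite !Cmod_mult. fold r. assert (0 <= Cmod b * Cmod b) by (apply Rmult_le_pos; auto). nra.
        - rewrite Cmod_pow. fold r. lra. }
      lra.
Qed.

Lemma quad_ex_derive F z : quad F z -> @ex_derive C_AbsRing C_NormedModule F z.
Proof.
  intros (a & b & d & K & Hd & HK & H). exists a. split.
  - apply is_linear_scal_l.
  - intros x Hx. apply (@is_filter_lim_locally_unique C_AbsRing (AbsRing_NormedModule C_AbsRing)) in Hx. subst x.
    intros eps.
    pose proof (Cmod_ge_0 b). destruct eps as [eps He]. simpl.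
    set (d' := Rmin (Rmin 1 d) (eps / (2 * (Cmod b + K + 1)))).
    assert (Hd' : 0 < d').
    { repeat apply Rmin_glb_lt; try lra. apply Rdiv_lt_0_compat; lra. }
    assert (Hloc : @locally_norm C_AbsRing (AbsRing_NormedModule C_AbsRing) z (fun y : C => norm (minus (minus (F y) (F z)) (scal (minus y z) a)) <= eps * norm (minus y z))).
    { exists (mkposreal d' Hd'). intros y Hy. unfold ball_norm in Hy. simpl in Hy.
      change (Cmod (y - z)%C < d') in Hy.
      change (Cmod (F y - F z - (y - z) * a)%C <= eps * Cmod (y - z)%C).
      set (h := (y - z)%C) in *. replace y with (z + h)%C by (unfold h; ring).
      pose proof (Rmin_l (Rmin 1 d) (eps / (2 * (Cmod b + K + 1)))).
      pose proof (Rmin_r (Rmin 1 d) (eps / (2 * (Cmod b + K + 1)))).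
      pose proof (Rmin_l 1 d). pose proof (Rmin_r 1 d).
      fold d' in H1, H2. specialize (H h ltac:(lra)).
      set (r := Cmod h) in *. assert (Hr : 0 <= r) by apply Cmod_ge_0.
      replace (F (z + h) - F z - h * a)%C with ((F (z + h) - (F z + a * h + b * h ^ 2)) + b * h ^ 2)%C by ring.
      eapply Rle_trans; [apply Cmod_plus_le; [exact H|rewrite Cmod_mult, Cmod_pow; right; reflexivity]|].
      fold r.
      assert (Hre : r * (Cmod b + K) <= eps).
      { apply Rle_trans with (eps / (2 * (Cmod b + K + 1)) * (Cmod b + K)).
        - apply Rmult_le_compat_r; lra.
        - unfold Rdiv. rewrite Rmult_assoc. rewrite <- (Rmult_1_r eps) at 2.
          apply Rmult_le_compat_l; [lra|]. rewrite Rmult_comm.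
          apply Rmult_le_reg_r with (2 * (Cmod b + K + 1)); [lra|].
          rewrite Rmult_assoc, Rinv_l by lra. lra. }
      assert (r ^ 3 <= r ^ 2) by (simpl; nra).
      assert (0 <= r ^ 2) by (apply pow_le; auto).
      apply Rle_trans with (r * (r * (Cmod b + K))); [nra|].
      rewrite (Rmult_comm eps). apply Rmult_le_compat_l; auto. }
    apply (@locally_le_locally_norm C_AbsRing (AbsRing_NormedModule C_AbsRing) z). exact Hloc.
Qed.

(** * Maximum principle *)

(** A Lebesgue number for the closed unit disc, from compactness of a square with a gauge. [Q p d]
    is meant as a statement about the disc of radius [2 * d] about [p]; the factor 2 comes from
    bounding the modulus by the sum of the two coordinates. *)
Lemma square_cover (Q : C -> R -> Prop) :
  (forall p, exists d, 0 < d /\ Q p d) ->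
  exists d0, 0 < d0 /\ forall x : C, Cmod x <= 1 ->
    exists p d, Q p d /\ d0 <= d /\ Cmod (x - p)%C < 2 * d.
Proof.
  intros H.
  assert (H' : forall p : C, exists d : posreal, Q p d).
  { intros p. destruct (H p) as (d & Hd & HQ). exists (mkposreal d Hd). exact HQ. }
  set (delta := fun u v : R => proj1_sig (constructive_indefinite_description _ (H' (u, v)))).
  assert (Hdelta : forall u v, Q (u, v) (delta u v)).
  { intros u v. exact (proj2_sig (constructive_indefinite_description _ (H' (u, v)))). }
  destruct (compactness_value_2d (-1) 1 (-1) 1 delta) as (d0 & Hd0).
  exists d0. split; [apply cond_pos|].
  intros x Hx.
  assert (Hre : -1 <= fst x <= 1).
  { pose proof (re_le_Cmod x) as Hr. apply Rabs_le_between. unfold Re in Hr. lra. }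
  assert (Him : -1 <= snd x <= 1).
  { pose proof (Im_le_Cmod x) as Hr. apply Rabs_le_between. unfold Im in Hr. lra. }
  destruct (NNPP _ (Hd0 (fst x) (snd x) Hre Him)) as (u & v & _ & _ & Hu & Hv & Hd).
  exists (u, v), (delta u v). repeat split; auto.
  eapply Rle_lt_trans; [apply Cmod_le_ReIm|].
  unfold Re, Im; simpl. change (Rabs (fst x - u) + Rabs (snd x - v) < 2 * delta u v). lra.
Qed.

(** An upper semicontinuous function on a compact set attains its supremum. The covering lemma is
    applied twice, each time with the quantity to be made uniform expressed through the gauge [d]
    itself. *)
Lemma max_attained (K : C -> Prop) (Psi : C -> R) :
  (forall z, K z -> Cmod z <= 1) ->
  (forall z, ~ K z -> exists d, 0 < d /\ forall x, Cmod (x - z)%C < d -> ~ K x) ->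
  (forall z, K z -> forall eps, 0 < eps -> exists d, 0 < d /\
     forall x, K x -> Cmod (x - z)%C < d -> Psi x < Psi z + eps) ->
  (exists z, K z) ->
  exists z, K z /\ forall x, K x -> Psi x <= Psi z.
Proof.
  intros Hb Hcl Hc (z0 & Hz0).
  assert (Hbound : exists B, forall x, K x -> Psi x <= B).
  (* The local bound is recorded as [/ d + 1]: a small [d] leaves room for any value [Psi p], and
     the common lower bound [d0] becomes a global upper bound. *)
  { destruct (square_cover (fun p d => forall x, K x -> Cmod (x - p)%C < 2 * d ->
        Psi x < / d + 1)) as (d0 & Hd0 & HQ).
    - intros p. destruct (classic (K p)) as [Hp|Hp].
      + destruct (Hc p Hp 1 ltac:(lra)) as (d & Hd & H).
        set (e := Rmin (d / 2) (/ (Rabs (Psi p) + 1))).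
        assert (Hpp : 0 < Rabs (Psi p) + 1) by (pose proof (Rabs_pos (Psi p)); lra).
        assert (Hpi : 0 < / (Rabs (Psi p) + 1)) by (apply Rinv_0_lt_compat; auto).
        assert (He : 0 < e) by (apply Rmin_glb_lt; lra).
        exists e. split; auto. intros x Hx Hxp.
        pose proof (Rmin_l (d / 2) (/ (Rabs (Psi p) + 1))).
        pose proof (Rmin_r (d / 2) (/ (Rabs (Psi p) + 1))). fold e in H0, H1.
        specialize (H x Hx ltac:(lra)).
        assert (Rabs (Psi p) + 1 <= / e).
        { rewrite <- (Rinv_inv (Rabs (Psi p) + 1)). apply Rinv_le_contravar; auto. }
        pose proof (Rle_abs (Psi p)). lra.
      + destruct (Hcl p Hp) as (d & Hd & H). exists (d / 2). split; [lra|].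
        intros x Hx Hxp. exfalso. apply (H x); auto; lra.
    - exists (/ d0 + 1). intros x Hx. destruct (HQ x (Hb x Hx)) as (p & d & Hpd & Hdd & Hxp).
      specialize (Hpd x Hx Hxp). assert (/ d <= / d0) by (apply Rinv_le_contravar; auto). lra. }
  destruct Hbound as (B & HB).
  destruct (completeness (fun y => exists x, K x /\ y = Psi x)) as (S & HS1 & HS2).
  { exists B. intros y (x & Hx & ->). auto. }
  { exists (Psi z0), z0. auto. }
  apply NNPP. intros Hno.
  assert (Hlt : forall p, K p -> Psi p < S).
  { intros p Hp. destruct (Rlt_le_dec (Psi p) S) as [|HSp]; auto. exfalso. apply Hno.
    exists p. split; auto. intros x Hx. apply Rle_trans with S; auto. apply HS1. exists x; auto. }
  (* If the supremum [S] is nowhere attained, [Psi] stays below it by the gauge near each point; a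
     uniform gap [d0] then contradicts the choice of [S]. *)
  destruct (square_cover (fun p d => forall x, K x -> Cmod (x - p)%C < 2 * d ->
        Psi x <= S - d)) as (d0 & Hd0 & HQ).
  - intros p. destruct (classic (K p)) as [Hp|Hp].
    + pose proof (Hlt p Hp).
      destruct (Hc p Hp ((S - Psi p) / 2) ltac:(lra)) as (d & Hd & H0).
      exists (Rmin (d / 2) ((S - Psi p) / 2)). split; [apply Rmin_glb_lt; lra|].
      intros x Hx Hxp.
      pose proof (Rmin_l (d / 2) ((S - Psi p) / 2)). pose proof (Rmin_r (d / 2) ((S - Psi p) / 2)).
      specialize (H0 x Hx ltac:(lra)). lra.
    + destruct (Hcl p Hp) as (d & Hd & H). exists (d / 2). split; [lra|].
      intros x Hx Hxp. exfalso. apply (H x); auto; lra.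
  - assert (S <= S - d0); [|lra].
    apply HS2. intros y (x & Hx & ->). destruct (HQ x (Hb x Hx)) as (p & d & Hpd & Hdd & Hxp).
    specialize (Hpd x Hx Hxp). lra.
Qed.

(** Over the four increments [h], [ih], [-h], [-ih] all cross terms of the quadratic part cancel, so
    its squared moduli add up to at least [4 |F z|^2]. The remainder costs a multiple of [h^3]. *)
Lemma quad_four_points F z : quad F z -> exists d L, 0 < d /\ 0 <= L /\
  forall h, 0 < h < d ->
   4 * Cmod (F z) ^ 2 - L * h ^ 3 <=
   Cmod (F (z + RtoC h)%C) ^ 2 + Cmod (F (z + Ci * RtoC h)%C) ^ 2 +
   Cmod (F (z + - RtoC h)%C) ^ 2 + Cmod (F (z + - (Ci * RtoC h))%C) ^ 2.
Proof.
  intros (a & b & d & K & Hd & HK & H).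
  set (f := F z) in *. set (A := Cmod f + Cmod a + Cmod b).
  pose proof (Cmod_ge_0 f). pose proof (Cmod_ge_0 a). pose proof (Cmod_ge_0 b).
  exists (Rmin 1 d), (4 * (2 * A * K)). repeat split.
  - apply Rmin_glb_lt; lra.
  - unfold A. repeat apply Rmult_le_pos; lra.
  - intros h Hh. pose proof (Rmin_l 1 d). pose proof (Rmin_r 1 d).
    assert (Hone : forall w : C, Cmod w = h ->
       Cmod (f + a * w + b * w ^ 2)%C ^ 2 - 2 * A * K * h ^ 3 <= Cmod (F (z + w)%C) ^ 2).
    { intros w Hw. specialize (H w ltac:(lra)). rewrite Hw in H.
      set (p := (f + a * w + b * w ^ 2)%C) in *.
      assert (Hp : Cmod p <= A).
      { unfold p, A. repeat apply Cmod_plus_le; try lra; rewrite Cmod_mult, ?Cmod_pow, Hw; [nra|].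
        assert (h ^ 2 <= 1) by nra. nra. }
      pose proof (Cmod_triangle_inv p (p - F (z + w))%C) as Ht.
      replace (p - (p - F (z + w)))%C with (F (z + w)%C) in Ht by ring.
      rewrite Cmod_minus_sym in Ht.
      pose proof (Cmod_ge_0 p). pose proof (Cmod_ge_0 (F (z + w)%C)).
      assert (0 <= h ^ 3) by (apply pow_le; lra).
      assert (0 <= K * h ^ 3) by (apply Rmult_le_pos; auto).
      destruct (Rle_lt_dec (Cmod p) (K * h ^ 3)).
      - assert (Cmod p ^ 2 <= A * (K * h ^ 3)).
        { replace (Cmod p ^ 2) with (Cmod p * Cmod p) by ring. apply Rmult_le_compat; auto. }
        assert (0 <= A * (K * h ^ 3)) by (apply Rmult_le_pos; lra).
        assert (0 <= Cmod (F (z + w)%C) ^ 2) by (apply pow_le; auto). lra.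
      - assert ((Cmod p - K * h ^ 3) ^ 2 <= Cmod (F (z + w)%C) ^ 2) by (apply pow_incr; lra).
        assert (Cmod p * (K * h ^ 3) <= A * (K * h ^ 3)) by (apply Rmult_le_compat_r; auto).
        assert (0 <= (K * h ^ 3) ^ 2) by (apply pow_le; auto).
        nra. }
    assert (Hi : (Ci ^ 2)%C = (- (1))%C) by (apply C_eq; unfold Re, Im; simpl; lra).
    assert (Hmi : Cmod (Ci * RtoC h)%C = h) by (rewrite Cmod_mult, Cmod_Ci, Cmod_RtoC_pos; lra).
    assert (Hmh : Cmod (RtoC h)%C = h) by (rewrite Cmod_RtoC_pos; lra).
    pose proof (Hone (RtoC h) Hmh) as H1'.
    pose proof (Hone (Ci * RtoC h)%C Hmi) as H2'.
    pose proof (Hone (- RtoC h)%C ltac:(rewrite Cmod_opp; auto)) as H3'.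
    pose proof (Hone (- (Ci * RtoC h))%C ltac:(rewrite Cmod_opp; auto)) as H4'.
    assert (E : Cmod (f + a * RtoC h + b * RtoC h ^ 2)%C ^ 2
       + Cmod (f + a * (Ci * RtoC h) + b * (Ci * RtoC h) ^ 2)%C ^ 2
       + Cmod (f + a * (- RtoC h) + b * (- RtoC h) ^ 2)%C ^ 2
       + Cmod (f + a * (- (Ci * RtoC h)) + b * (- (Ci * RtoC h)) ^ 2)%C ^ 2
       = 4 * Cmod f ^ 2 + 4 * h ^ 2 * Cmod a ^ 2 + 4 * h ^ 4 * Cmod b ^ 2).
    { rewrite !Cmod_sqr. destruct f, a, b. unfold Re, Im; simpl. ring. }
    assert (0 <= h ^ 2 * Cmod a ^ 2) by (apply Rmult_le_pos; apply pow_le; lra).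
    assert (0 <= h ^ 4 * Cmod b ^ 2) by (apply Rmult_le_pos; apply pow_le; lra).
    lra.
Qed.

Lemma Cmod_sqr_four (z : C) h :
  Cmod (z + RtoC h)%C ^ 2 + Cmod (z + Ci * RtoC h)%C ^ 2 +
  Cmod (z + - RtoC h)%C ^ 2 + Cmod (z + - (Ci * RtoC h))%C ^ 2 = 4 * Cmod z ^ 2 + 4 * h ^ 2.
Proof. rewrite !Cmod_sqr. destruct z. unfold Re, Im; simpl. ring. Qed.

(** If [|F(0)| > B], the function [|F|^2 + eps |z|^2] has a maximum on the region, and the boundary
    bounds push it into the interior. There the sum over four neighbours exceeds four times the
    value by at least [4 eps h^2 - L h^3], which is positive for small [h]. *)
Lemma max_principle (F G : C -> C) (r kappa B : R) :
  0 < r < 1 -> 0 <= B ->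
  (forall z, Cmod z <= r -> quad F z) ->
  (forall z, Cmod z < 1 -> quad G z) ->
  kappa < Re (G (RtoC 0)) ->
  (forall z, Cmod z <= r -> Re (G z) = kappa -> Cmod (F z) <= B) ->
  (forall z, Cmod z = r -> kappa <= Re (G z) -> Cmod (F z) <= B) ->
  Cmod (F (RtoC 0)) <= B.
Proof.
  intros Hr HB HF HG H0 Hb1 Hb2.
  apply Rnot_lt_le. intros Hlt.
  (* Half of the excess: since [|z| <= 1], a maximum of [Psi] still has [|F z| > B]. *)
  set (eps := (Cmod (F (RtoC 0)) ^ 2 - B ^ 2) / 2).
  assert (Heps : 0 < eps) by (unfold eps; nra).
  set (K := fun z : C => Cmod z <= r /\ kappa <= Re (G z)).
  set (Psi := fun z : C => Cmod (F z) ^ 2 + eps * Cmod z ^ 2).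
  assert (HGc : forall z, Cmod z < 1 -> forall e, 0 < e -> exists d, 0 < d /\
     forall x, Cmod (x - z)%C < d -> Rabs (Re (G x) - Re (G z)) < e).
  { intros z Hz e He. destruct (quad_ccont G z (HG z Hz) e He) as (d & Hd & Hc).
    exists d; split; auto. intros x Hx. specialize (Hc x Hx).
    eapply Rle_lt_trans; [|exact Hc]. rewrite <- Re_minus. apply re_le_Cmod. }
  destruct (max_attained K Psi) as (z & (Hz1 & Hz2) & Hmax).
  - intros z (Hz & _). lra.
  - intros z Hz. destruct (Rle_lt_dec (Cmod z) r) as [Hzr|Hzr].
    + assert (HU : Re (G z) < kappa) by (apply Rnot_le_lt; intros HU; apply Hz; split; auto).
      destruct (HGc z ltac:(lra) (kappa - Re (G z)) ltac:(lra)) as (d & Hd & Hc).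
      exists d; split; auto. intros x Hx (_ & Hx2). specialize (Hc x Hx).
      apply Rabs_lt_between in Hc. lra.
    + exists (Cmod z - r). split; [lra|]. intros x Hx (Hx1 & _).
      rewrite Cmod_minus_sym in Hx. pose proof (Cmod_triangle_inv z x). lra.
  - intros z (Hz & _) e He.
    set (S := Cmod (F z) + 1). assert (HS : 0 < S) by (pose proof (Cmod_ge_0 (F z)); unfold S; lra).
    destruct (quad_ccont F z (HF z Hz) (Rmin 1 (e / (4 * S)))) as (d & Hd & Hc).
    { apply Rmin_glb_lt; [lra|]. apply Rdiv_lt_0_compat; lra. }
    exists (Rmin d (e / (8 * (eps + 1)))). split.
    { apply Rmin_glb_lt; auto. apply Rdiv_lt_0_compat; lra. }
    intros x (Hx1 & _) Hx.
    pose proof (Rmin_l d (e / (8 * (eps + 1)))). pose proof (Rmin_r d (e / (8 * (eps + 1)))).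
    specialize (Hc x ltac:(lra)).
    pose proof (Rmin_l 1 (e / (4 * S))). pose proof (Rmin_r 1 (e / (4 * S))).
    pose proof (Cmod_triangle_inv (F x) (F z)). pose proof (Cmod_triangle_inv x z).
    pose proof (Cmod_ge_0 (F x)). pose proof (Cmod_ge_0 (F z)).
    pose proof (Cmod_ge_0 x). pose proof (Cmod_ge_0 z).
    assert (HF1 : Cmod (F x) ^ 2 - Cmod (F z) ^ 2 <= e / 2).
    { set (t := Cmod (F x - F z)%C) in *. assert (Ht : 0 <= t) by apply Cmod_ge_0.
      apply Rle_trans with (t * (2 * S)); [unfold S; nra|].
      apply Rle_trans with (e / (4 * S) * (2 * S)); [apply Rmult_le_compat_r; lra|].
      right; field; lra. }
    assert (HF2 : eps * Cmod x ^ 2 - eps * Cmod z ^ 2 <= e / 4).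
    { set (t := Cmod (x - z)%C) in *. assert (Ht : 0 <= t) by apply Cmod_ge_0.
      assert (Cmod x ^ 2 - Cmod z ^ 2 <= 2 * t) by nra.
      apply Rle_trans with (eps * (2 * t)); [nra|].
      apply Rle_trans with (eps * (2 * (e / (8 * (eps + 1))))); [apply Rmult_le_compat_l; lra|].
      apply Rmult_le_reg_r with (4 * (eps + 1)); [lra|].
      replace (eps * (2 * (e / (8 * (eps + 1)))) * (4 * (eps + 1))) with (eps * e) by (field; lra).
      replace (e / 4 * (4 * (eps + 1))) with (e * (eps + 1)) by field. nra. }
    unfold Psi. lra.
  - exists (RtoC 0). split; [rewrite Cmod_0|]; lra.
  - assert (HPsi0 : Psi (RtoC 0) <= Psi z).
    { apply Hmax. split; [rewrite Cmod_0|]; lra. }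
    unfold Psi in HPsi0. rewrite Cmod_0 in HPsi0.
    assert (HFz : B < Cmod (F z)).
    { assert (Cmod z ^ 2 <= 1) by (pose proof (Cmod_ge_0 z); nra).
      pose proof (Cmod_ge_0 (F z)). unfold eps in *. apply Rnot_le_lt. intros Hle.
      assert (Cmod (F z) ^ 2 <= B ^ 2) by (apply pow_incr; lra). nra. }
    assert (Hz1' : Cmod z < r).
    { destruct Hz1 as [|E]; auto. specialize (Hb2 z E Hz2). lra. }
    assert (Hz2' : kappa < Re (G z)).
    { destruct Hz2 as [|E]; auto. specialize (Hb1 z Hz1 (eq_sym E)). lra. }
    destruct (HGc z ltac:(lra) (Re (G z) - kappa) ltac:(lra)) as (d1 & Hd1 & Hc1).
    destruct (quad_four_points F z (HF z Hz1)) as (d2 & L & Hd2 & HL & Hfour).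
    set (h := Rmin (Rmin (d1 / 2) (d2 / 2)) (Rmin ((r - Cmod z) / 2) (eps / (L + 1)))).
    assert (Hh : 0 < h).
    { repeat apply Rmin_glb_lt; try lra. apply Rdiv_lt_0_compat; lra. }
    assert (Hh1 : h <= d1 / 2 /\ h <= d2 / 2 /\ h <= (r - Cmod z) / 2 /\ h <= eps / (L + 1)).
    { unfold h. pose proof (Rmin_l (Rmin (d1 / 2) (d2 / 2)) (Rmin ((r - Cmod z) / 2) (eps / (L + 1)))).
      pose proof (Rmin_r (Rmin (d1 / 2) (d2 / 2)) (Rmin ((r - Cmod z) / 2) (eps / (L + 1)))).
      pose proof (Rmin_l (d1 / 2) (d2 / 2)). pose proof (Rmin_r (d1 / 2) (d2 / 2)).
      pose proof (Rmin_l ((r - Cmod z) / 2) (eps / (L + 1))).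
      pose proof (Rmin_r ((r - Cmod z) / 2) (eps / (L + 1))). lra. }
    destruct Hh1 as (Ha & Hb & Hc & He).
    assert (HKw : forall w : C, Cmod w = h -> Psi (z + w)%C <= Psi z).
    { intros w Hw. apply Hmax. split.
      - eapply Rle_trans; [apply Cmod_triangle|]. lra.
      - specialize (Hc1 (z + w)%C). replace (z + w - z)%C with w in Hc1 by ring.
        specialize (Hc1 ltac:(lra)). apply Rabs_lt_between in Hc1. lra. }
    assert (Hmi : Cmod (Ci * RtoC h)%C = h) by (rewrite Cmod_mult, Cmod_Ci, Cmod_RtoC_pos; lra).
    assert (Hmh : Cmod (RtoC h)%C = h) by (rewrite Cmod_RtoC_pos; lra).
    pose proof (HKw (RtoC h) Hmh) as H1'.
    pose proof (HKw (Ci * RtoC h)%C Hmi) as H2'.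
    pose proof (HKw (- RtoC h)%C ltac:(rewrite Cmod_opp; auto)) as H3'.
    pose proof (HKw (- (Ci * RtoC h))%C ltac:(rewrite Cmod_opp; auto)) as H4'.
    specialize (Hfour h ltac:(lra)). pose proof (Cmod_sqr_four z h) as E.
    unfold Psi in *.
    assert (4 * eps * h ^ 2 <= L * h ^ 3).
    { apply (f_equal (Rmult eps)) in E. lra. }
    assert (h * (L + 1) <= eps).
    { apply Rle_trans with (eps / (L + 1) * (L + 1)); [apply Rmult_le_compat_r; lra|].
      right; field; lra. }
    assert (0 < h ^ 2) by (apply pow_lt; auto).
    assert (L * h ^ 3 <= eps * h ^ 2).
    { replace (L * h ^ 3) with (L * h * h ^ 2) by ring. apply Rmult_le_compat_r; lra. }
    nra.
Qed.

(** * Complex power series *)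

Lemma pow_n_Cpow (z : C) k : @pow_n C_Ring z k = (z ^ k)%C.
Proof. induction k; [reflexivity|]. rewrite Cpow_S, <- IHk. reflexivity. Qed.

Lemma sum_n_zsum (s : nat -> C) n : @sum_n C_AbelianMonoid s n = zsum s (S n).
Proof.
  induction n.
  - rewrite sum_O. simpl. ring.
  - rewrite sum_Sn, IHn. reflexivity.
Qed.

Lemma sum_n_rsum (s : nat -> R) n : sum_n s n = rsum s (S n).
Proof.
  induction n.
  - rewrite sum_O. simpl. ring.
  - rewrite sum_Sn, IHn. reflexivity.
Qed.

Lemma is_series_C_eps (s : nat -> C) (l : C) :
  @is_series C_AbsRing C_NormedModule s l <->
  forall eps, 0 < eps -> exists N, forall n, (N <= n)%nat -> Cmod (zsum s (S n) - l)%C < eps.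
Proof.
  unfold is_series.
  rewrite (@filterlim_locally_ball_norm C_AbsRing nat C_NormedModule eventually _ (sum_n s) l). split.
  - intros H eps He. destruct (H (mkposreal eps He)) as (N & HN). exists N. intros n Hn.
    specialize (HN n Hn). unfold ball_norm in HN. rewrite <- sum_n_zsum. exact HN.
  - intros H [eps He]. destruct (H eps He) as (N & HN). exists N. intros n Hn.
    specialize (HN n Hn). unfold ball_norm. rewrite <- sum_n_zsum in HN. exact HN.
Qed.

Lemma is_series_R_eps (s : nat -> R) (l : R) :
  is_series s l <->
  forall eps, 0 < eps -> exists N, forall n, (N <= n)%nat -> Rabs (rsum s (S n) - l) < eps.
Proof.
  unfold is_series.
  rewrite (@filterlim_locally_ball_norm R_AbsRing nat R_NormedModule eventually _ (sum_n s) l). split.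
  - intros H eps He. destruct (H (mkposreal eps He)) as (N & HN). exists N. intros n Hn.
    specialize (HN n Hn). unfold ball_norm in HN. rewrite <- sum_n_rsum. exact HN.
  - intros H [eps He]. destruct (H eps He) as (N & HN). exists N. intros n Hn.
    specialize (HN n Hn). unfold ball_norm. rewrite <- sum_n_rsum in HN. exact HN.
Qed.

Lemma is_series_C_components (s : nat -> C) (l : C) :
  @is_series C_AbsRing C_NormedModule s l <->
  is_series (fun k => Re (s k)) (Re l) /\ is_series (fun k => Im (s k)) (Im l).
Proof.
  rewrite is_series_C_eps, !is_series_R_eps. split.
  - intros H. split; intros eps He; destruct (H eps He) as (N & HN); exists N; intros n Hn;
      specialize (HN n Hn); eapply Rle_lt_trans; try exact HN.
    + rewrite <- Re_zsum, <- Re_minus. apply re_le_Cmod.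
    + rewrite <- Im_zsum, <- Im_minus. apply Im_le_Cmod.
  - intros (H1 & H2) eps He.
    destruct (H1 (eps / 2) ltac:(lra)) as (N1 & HN1).
    destruct (H2 (eps / 2) ltac:(lra)) as (N2 & HN2).
    exists (Nat.max N1 N2). intros n Hn.
    specialize (HN1 n ltac:(lia)). specialize (HN2 n ltac:(lia)).
    eapply Rle_lt_trans; [apply Cmod_le_ReIm|].
    rewrite Re_minus, Im_minus, Re_zsum, Im_zsum. lra.
Qed.

Lemma polar (z : C) : exists u, Cmod u = 1 /\ z = (RtoC (Cmod z) * u)%C.
Proof.
  destruct (Req_dec (Cmod z) 0) as [H|H].
  - exists (RtoC 1). split; [apply Cmod_1|]. rewrite H. apply Cmod_eq_0 in H. rewrite H. ring.
  - assert (Hz : RtoC (Cmod z) <> RtoC 0) by (apply RtoC_nz; auto).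
    exists (z / RtoC (Cmod z))%C. split.
    + rewrite Cmod_div by auto. rewrite (Cmod_RtoC_pos (Cmod z)) by apply Cmod_ge_0. field; auto.
    + field; auto.
Qed.

(* The coefficients of a complex power series along the ray through u, split into real
   and imaginary parts, so that Coquelicot's real power series apply. *)
Definition re_ray (a : nat -> C) (u : C) (k : nat) : R := Re (a k * u ^ k)%C.
Definition im_ray (a : nat -> C) (u : C) (k : nat) : R := Im (a k * u ^ k)%C.

Lemma ray_series (a : nat -> C) (u l : C) (x : R) :
  @is_series C_AbsRing C_NormedModule
     (fun j => Cmult (a j) (@pow_n C_Ring (RtoC x * u)%C j)) l <->
  is_pseries (re_ray a u) x (Re l) /\ is_pseries (im_ray a u) x (Im l).
Proof.
  rewrite is_series_C_components, !is_pseries_R.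
  assert (E : forall k, (a k * @pow_n C_Ring (RtoC x * u)%C k)%C = (RtoC (x ^ k) * (a k * u ^ k))%C).
  { intros k. rewrite pow_n_Cpow, Cpow_mult_l, RtoC_pow. ring. }
  assert (E1 : forall k, Re (a k * @pow_n C_Ring (RtoC x * u)%C k)%C = re_ray a u k * x ^ k).
  { intros k. rewrite E, Re_scal. unfold re_ray. ring. }
  assert (E2 : forall k, Im (a k * @pow_n C_Ring (RtoC x * u)%C k)%C = im_ray a u k * x ^ k).
  { intros k. rewrite E, Im_scal. unfold im_ray. ring. }
  split; intros (H1 & H2); split.
  - eapply is_series_ext; [exact E1|exact H1].
  - eapply is_series_ext; [exact E2|exact H2].
  - eapply is_series_ext; [intros k; symmetry; apply E1|exact H1].
  - eapply is_series_ext; [intros k; symmetry; apply E2|exact H2].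
Qed.

Lemma taylor_ray f a u x : taylor_coeffs f a -> Cmod u = 1 -> Rabs x < 1 ->
  is_pseries (re_ray a u) x (Re (f (RtoC x * u)%C)) /\
  is_pseries (im_ray a u) x (Im (f (RtoC x * u)%C)).
Proof.
  intros H Hu Hx. apply ray_series. apply H. unfold inD. rewrite Cmod_mult, Cmod_R, Hu. lra.
Qed.

Lemma taylor_of_rays f a :
  (forall u x, Cmod u = 1 -> 0 <= x < 1 ->
     is_pseries (re_ray a u) x (Re (f (RtoC x * u)%C)) /\
     is_pseries (im_ray a u) x (Im (f (RtoC x * u)%C))) -> taylor_coeffs f a.
Proof.
  intros H z Hz. destruct (polar z) as (u & Hu & E). rewrite E. apply ray_series.
  apply H; auto. split; [apply Cmod_ge_0|exact Hz].
Qed.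

Definition unit_radius (a : nat -> C) : Prop :=
  forall rho, 0 <= rho < 1 -> exists X, forall k, Cmod (a k) * rho ^ k <= X.

Lemma eventually_bounded (t : nat -> R) N B : (forall n, (N <= n)%nat -> t n <= B) ->
  exists X, forall n, t n <= X.
Proof.
  intros H. exists (Rabs B + rsum (fun k => Rabs (t k)) N). intros n.
  pose proof (Rabs_pos B). pose proof (Rle_abs B). pose proof (Rle_abs (t n)).
  destruct (Nat.le_gt_cases N n) as [Hn|Hn].
  - specialize (H n Hn). assert (0 <= rsum (fun k => Rabs (t k)) N) by (apply rsum_ge_0; intros; apply Rabs_pos). lra.
  - pose proof (rsum_term_le (fun k => Rabs (t k)) N n (fun i _ => Rabs_pos _) Hn). simpl in *. lra.
Qed.

Lemma taylor_unit_radius f a : taylor_coeffs f a -> unit_radius a.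
Proof.
  intros H rho Hr. specialize (H (RtoC rho)).
  assert (Hin : inD (RtoC rho)) by (unfold inD; rewrite Cmod_RtoC_pos; lra).
  specialize (H Hin). rewrite is_series_C_eps in H.
  destruct (H 1 ltac:(lra)) as (N & HN).
  apply (eventually_bounded _ (S N) 2). intros n Hn. destruct n as [|n]; [lia|].
  pose proof (HN (S n) ltac:(lia)) as H1. pose proof (HN n ltac:(lia)) as H2.
  rewrite (zsum_ext _ (fun j => a j * RtoC rho ^ j)%C) in H1 by (intros; rewrite pow_n_Cpow; ring).
  rewrite (zsum_ext _ (fun j => a j * RtoC rho ^ j)%C) in H2 by (intros; rewrite pow_n_Cpow; ring).
  replace (Cmod (a (S n)) * rho ^ S n) with (Cmod (a (S n) * RtoC rho ^ S n)%C)
    by (rewrite Cmod_mult, Cmod_pow, Cmod_RtoC_pos; [reflexivity|lra]).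
  set (s := zsum (fun j => a j * RtoC rho ^ j)%C (S n)) in *.
  replace (a (S n) * RtoC rho ^ S n)%C with
    ((s + a (S n) * RtoC rho ^ S n - f (RtoC rho)) - (s - f (RtoC rho)))%C by ring.
  change (zsum (fun j => a j * RtoC rho ^ j)%C (S (S n))) with (s + a (S n) * RtoC rho ^ S n)%C in H1.
  eapply Rle_trans; [apply Cmod_triangle_minus|]. lra.
Qed.

Lemma bounded_unit_radius q Cq : (forall k, Cmod (q k) <= Cq) -> unit_radius q.
Proof.
  intros H rho Hr. exists Cq. intros k. specialize (H k).
  assert (0 <= rho ^ k) by (apply pow_le; lra).
  assert (rho ^ k <= 1) by (rewrite <- (pow1 k); apply pow_incr; lra).
  pose proof (Cmod_ge_0 (q k)). nra.
Qed.

Lemma ray_radius a u x (c : nat -> R) : unit_radius a -> Cmod u = 1 -> Rabs x < 1 ->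
  (forall k, Rabs (c k) <= Cmod (a k * u ^ k)%C) ->
  Rbar_lt (Rabs x) (CV_radius c).
Proof.
  intros H Hu Hx Hc. set (rho := (1 + Rabs x) / 2). pose proof (Rabs_pos x).
  destruct (H rho) as (X & HX); [unfold rho; lra|].
  destruct (CV_radius_bounded c) as (Hub & _).
  apply Rbar_lt_le_trans with (Finite rho); [simpl; unfold rho; lra|].
  apply Hub. exists X. intros k. eapply Rle_trans; [|apply (HX k)].
  assert (0 <= rho ^ k) by (apply pow_le; unfold rho; lra).
  rewrite Rabs_mult, (Rabs_pos_eq (rho ^ k)) by auto.
  apply Rmult_le_compat_r; auto. eapply Rle_trans; [apply Hc|].
  rewrite Cmod_mult, Cmod_pow, Hu, pow1. lra.
Qed.

Lemma re_ray_radius a u x : unit_radius a -> Cmod u = 1 -> Rabs x < 1 ->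
  Rbar_lt (Rabs x) (CV_radius (re_ray a u)).
Proof. intros H Hu Hx. apply (ray_radius a u); auto. intros; apply re_le_Cmod. Qed.

Lemma im_ray_radius a u x : unit_radius a -> Cmod u = 1 -> Rabs x < 1 ->
  Rbar_lt (Rabs x) (CV_radius (im_ray a u)).
Proof. intros H Hu Hx. apply (ray_radius a u); auto. intros; apply Im_le_Cmod. Qed.

(** * Cauchy products and uniqueness of coefficients *)

Definition conv (a b : nat -> C) (k : nat) : C := zsum (fun j => a j * b (k - j)%nat)%C (S k).

Lemma PS_mult_rsum a b n : PS_mult a b n = rsum (fun k => a k * b (n - k)%nat) (S n).
Proof. unfold PS_mult. rewrite <- sum_n_rsum, sum_n_Reals. reflexivity. Qed.

Lemma conv_ray a b u k : (conv a b k * u ^ k)%C =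
  zsum (fun j => (a j * u ^ j) * (b (k - j)%nat * u ^ (k - j)))%C (S k).
Proof.
  unfold conv. rewrite Cmult_comm, <- zsum_mult_l. apply zsum_ext. intros j Hj.
  replace k with (j + (k - j))%nat at 1 by lia. rewrite Cpow_add_r. ring.
Qed.

Lemma re_ray_conv a b u k : re_ray (conv a b) u k =
  PS_mult (re_ray a u) (re_ray b u) k - PS_mult (im_ray a u) (im_ray b u) k.
Proof.
  unfold re_ray at 1. rewrite conv_ray, Re_zsum, !PS_mult_rsum.
  rewrite <- (Rplus_0_r (rsum _ _ - _)).
  replace (rsum (fun j => re_ray a u j * re_ray b u (k - j)%nat) (S k) -
    rsum (fun j => im_ray a u j * im_ray b u (k - j)%nat) (S k) + 0) with
    (rsum (fun j => re_ray a u j * re_ray b u (k - j)%nat) (S k) +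
     (-1) * rsum (fun j => im_ray a u j * im_ray b u (k - j)%nat) (S k)) by ring.
  rewrite <- rsum_scal, <- rsum_plus. apply rsum_ext. intros j Hj.
  rewrite Re_mult. unfold re_ray, im_ray. ring.
Qed.

Lemma im_ray_conv a b u k : im_ray (conv a b) u k =
  PS_mult (re_ray a u) (im_ray b u) k + PS_mult (im_ray a u) (re_ray b u) k.
Proof.
  unfold im_ray at 1. rewrite conv_ray, Im_zsum, !PS_mult_rsum, <- rsum_plus.
  apply rsum_ext. intros j Hj. rewrite Im_mult. unfold re_ray, im_ray. ring.
Qed.

Lemma taylor_mult f g a b : taylor_coeffs f a -> taylor_coeffs g b ->
  taylor_coeffs (fun z => f z * g z)%C (conv a b).
Proof.
  intros Hf Hg. pose proof (taylor_unit_radius _ _ Hf) as Ra. pose proof (taylor_unit_radius _ _ Hg) as Rb.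
  apply taylor_of_rays. intros u x Hu Hx.
  assert (Hx' : Rabs x < 1) by (rewrite Rabs_pos_eq; lra).
  destruct (taylor_ray _ _ u x Hf Hu Hx') as (F1 & F2).
  destruct (taylor_ray _ _ u x Hg Hu Hx') as (G1 & G2).
  pose proof (re_ray_radius a u x Ra Hu Hx'). pose proof (im_ray_radius a u x Ra Hu Hx').
  pose proof (re_ray_radius b u x Rb Hu Hx'). pose proof (im_ray_radius b u x Rb Hu Hx').
  split.
  - eapply is_pseries_ext; [intros k; symmetry; apply re_ray_conv|].
    rewrite Re_mult. apply (@is_pseries_minus R_AbsRing R_NormedModule); apply is_pseries_mult; auto.
  - eapply is_pseries_ext; [intros k; symmetry; apply im_ray_conv|].
    rewrite Im_mult. apply (@is_pseries_plus R_AbsRing R_NormedModule); apply is_pseries_mult; auto.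
Qed.

Lemma taylor_unique f a b : taylor_coeffs f a -> taylor_coeffs f b -> forall k, a k = b k.
Proof.
  intros Ha Hb k.
  pose proof (taylor_unit_radius _ _ Ha) as Ra. pose proof (taylor_unit_radius _ _ Hb) as Rb.
  assert (H0 : Rabs 0 < 1) by (rewrite Rabs_R0; lra).
  assert (H1 : Cmod (RtoC 1) = 1) by apply Cmod_1.
  assert (Hlt : forall c, Rbar_lt (Rabs 0) c -> Rbar_lt 0 c) by (rewrite Rabs_R0; auto).
  assert (E : forall c : nat -> C, (c k * RtoC 1 ^ k)%C = c k) by (intros; rewrite Cpow_1_l; ring).
  assert (Hloc : forall P : R -> Prop, (forall x, Rabs x < 1 -> P x) -> locally (T:=R_UniformSpace) 0 P).
  { intros P HP. exists (mkposreal 1 Rlt_0_1). intros y Hy. apply HP.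
    unfold ball in Hy; simpl in Hy. unfold AbsRing_ball, abs, minus, plus, opp in Hy; simpl in Hy.
    rewrite Ropp_0, Rplus_0_r in Hy. exact Hy. }
  apply C_eq.
  - rewrite <- (E a), <- (E b). change (re_ray a 1 k = re_ray b 1 k).
    apply PSeries_ext_recip.
    + apply Hlt, re_ray_radius; auto.
    + apply Hlt, re_ray_radius; auto.
    + apply Hloc. intros x Hx.
      rewrite (is_pseries_unique _ _ _ (proj1 (taylor_ray _ _ 1 x Ha H1 Hx))).
      rewrite (is_pseries_unique _ _ _ (proj1 (taylor_ray _ _ 1 x Hb H1 Hx))). reflexivity.
  - rewrite <- (E a), <- (E b). change (im_ray a 1 k = im_ray b 1 k).
    apply PSeries_ext_recip.
    + apply Hlt, im_ray_radius; auto.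
    + apply Hlt, im_ray_radius; auto.
    + apply Hloc. intros x Hx.
      rewrite (is_pseries_unique _ _ _ (proj2 (taylor_ray _ _ 1 x Ha H1 Hx))).
      rewrite (is_pseries_unique _ _ _ (proj2 (taylor_ray _ _ 1 x Hb H1 Hx))). reflexivity.
Qed.

Lemma taylor_ext f g a : (forall z, inD z -> f z = g z) -> taylor_coeffs f a -> taylor_coeffs g a.
Proof. intros E H z Hz. rewrite <- E by auto. apply H; auto. Qed.

Lemma taylor_scal c f a : taylor_coeffs f a -> taylor_coeffs (fun z => c * f z)%C (fun k => c * a k)%C.
Proof.
  intros H. apply (taylor_ext (fun z => (fun _ => c) z * f z)%C); [reflexivity|].
  intros z Hz. specialize (H z Hz). rewrite is_series_C_eps in *. intros eps He.
  pose proof (Cmod_ge_0 c).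
  destruct (H (eps / (Cmod c + 1))) as (N & HN); [apply Rdiv_lt_0_compat; lra|].
  exists N. intros n Hn. specialize (HN n Hn).
  rewrite (zsum_ext _ (fun j => c * (a j * @pow_n C_Ring z j))%C) by (intros; ring).
  rewrite zsum_mult_l.
  match goal with |- Cmod (c * ?s - c * ?l)%C < _ => replace (c * s - c * l)%C with (c * (s - l))%C by ring;
    set (t := Cmod (s - l)%C) in *; assert (0 <= t) by apply Cmod_ge_0; rewrite Cmod_mult; fold t end.
  apply Rle_lt_trans with (Cmod c * (eps / (Cmod c + 1))).
  - apply Rmult_le_compat_l; lra.
  - apply Rmult_lt_reg_r with (Cmod c + 1); [lra|].
    replace (Cmod c * (eps / (Cmod c + 1)) * (Cmod c + 1)) with (Cmod c * eps) by (field; lra). lra.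
Qed.

Lemma taylor_plus f g a b : taylor_coeffs f a -> taylor_coeffs g b ->
  taylor_coeffs (fun z => f z + g z)%C (fun k => a k + b k)%C.
Proof.
  intros Hf Hg z Hz. specialize (Hf z Hz). specialize (Hg z Hz).
  rewrite is_series_C_eps in *. intros eps He.
  destruct (Hf (eps / 2) ltac:(lra)) as (N1 & H1). destruct (Hg (eps / 2) ltac:(lra)) as (N2 & H2).
  exists (Nat.max N1 N2). intros n Hn. specialize (H1 n ltac:(lia)). specialize (H2 n ltac:(lia)).
  rewrite (zsum_ext _ (fun j => a j * @pow_n C_Ring z j + b j * @pow_n C_Ring z j)%C) by (intros; ring).
  rewrite zsum_plus.
  match goal with |- Cmod (?s + ?t - (?l + ?m))%C < _ => replace (s + t - (l + m))%C with ((s - l) + (t - m))%C by ring end.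
  eapply Rle_lt_trans; [apply Cmod_triangle|]. lra.
Qed.

Lemma taylor_zsum (f : nat -> C -> C) (a : nat -> nat -> C) N :
  (forall i, (i < N)%nat -> taylor_coeffs (f i) (a i)) ->
  taylor_coeffs (fun z => zsum (fun i => f i z) N) (fun k => zsum (fun i => a i k) N).
Proof.
  induction N; intros H.
  - intros z Hz. rewrite is_series_C_eps. intros eps He. exists O. intros n _.
    cbn [zsum] in *. rewrite zsum_0 by (intros; ring). rewrite !Cmult_0_l.
    replace (0 + 0 - 0)%C with (RtoC 0) by ring. rewrite Cmod_0; lra.
  - cbn [zsum]. apply taylor_plus; [apply IHN; intros; apply H; lia|apply H; lia].
Qed.

(** * Herglotz kernels and their coefficients *)

Lemma geometric_sum (x : C) n : ((1 - x) * zsum (fun k => x ^ k)%C n)%C = (1 - x ^ n)%C.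
Proof.
  induction n; simpl; [ring|].
  rewrite Cmult_plus_distr_l, IHn. ring.
Qed.

Definition hcoef (al : C) (k : nat) : C := match k with O => RtoC 1 | _ => (2 * al ^ k)%C end.
Definition herg (al z : C) : C := ((1 + al * z) / (1 - al * z))%C.

Lemma one_minus_nz (x : C) : Cmod x < 1 -> (1 - x)%C <> RtoC 0.
Proof.
  intros H E. assert (x = RtoC 1) by (replace x with (1 - (1 - x))%C by ring; rewrite E; ring).
  subst. rewrite Cmod_1 in H. lra.
Qed.

Lemma hcoef_sum al z n : Cmod (al * z)%C < 1 ->
  (zsum (fun k => hcoef al k * z ^ k) (S n) = herg al z - 2 * (al * z) ^ S n / (1 - al * z))%C.
Proof.
  intros H. pose proof (one_minus_nz _ H) as Hnz.
  assert (E : (zsum (fun k => hcoef al k * z ^ k) (S n) = 2 * zsum (fun k => (al * z) ^ k) (S n) - 1)%C).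
  { rewrite <- zsum_mult_l, !zsum_head. unfold hcoef at 1. simpl Cpow.
    rewrite (zsum_ext (fun k => hcoef al (S k) * z ^ S k)%C (fun k => 2 * (al * z) ^ S k)%C).
    - simpl Cpow. ring.
    - intros k _. unfold hcoef. rewrite Cpow_mult_l. ring. }
  rewrite E. pose proof (geometric_sum (al * z)%C (S n)) as G.
  assert (G' : (zsum (fun k => (al * z) ^ k) (S n) = (1 - (al * z) ^ S n) / (1 - al * z))%C).
  { rewrite <- G. field. auto. }
  rewrite G'. unfold herg. field. auto.
Qed.

Lemma taylor_herg al : Cmod al = 1 -> taylor_coeffs (herg al) (hcoef al).
Proof.
  intros Hal z Hz. rewrite is_series_C_eps. intros eps He. unfold inD in Hz.
  assert (Hm : Cmod (al * z)%C < 1) by (rewrite Cmod_mult, Hal; lra).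
  pose proof (one_minus_nz _ Hm) as Hnz.
  assert (Hd : 0 < Cmod (1 - al * z)%C) by (apply Cmod_gt_0; auto).
  set (r := Cmod (al * z)%C) in *. assert (Hr : 0 <= r) by apply Cmod_ge_0.
  destruct (pow_lt_1_zero r ltac:(rewrite Rabs_pos_eq; auto) (eps * Cmod (1 - al * z)%C / 2)) as (N & HN).
  { apply Rdiv_lt_0_compat; [apply Rmult_lt_0_compat|]; lra. }
  exists N. intros n Hn.
  rewrite (zsum_ext _ (fun k => hcoef al k * z ^ k)%C) by (intros; rewrite pow_n_Cpow; ring).
  rewrite hcoef_sum by exact Hm.
  replace (herg al z - 2 * (al * z) ^ S n / (1 - al * z) - herg al z)%C with
    (- (2 * (al * z) ^ S n / (1 - al * z)))%C by ring.
  rewrite Cmod_opp, Cmod_div by auto. rewrite (Cmod_mult 2). rewrite Cmod_pow. fold r.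
  rewrite (Cmod_RtoC_pos 2) by lra.
  specialize (HN (S n) ltac:(lia)). rewrite Rabs_pos_eq in HN by (apply pow_le; auto).
  apply Rmult_lt_reg_r with (Cmod (1 - al * z)%C); auto.
  unfold Rdiv. rewrite Rmult_assoc, Rinv_l by lra. lra.
Qed.

Lemma hcoef_bound al k : Cmod al = 1 -> Cmod (hcoef al k) <= 2.
Proof.
  intros H. destruct k; cbn [hcoef]; [rewrite Cmod_1; lra|].
  rewrite Cmod_mult, Cmod_pow, H, pow1, Cmod_RtoC_pos; lra.
Qed.

(** * Exponentials of power series *)

(** [E' = Q' E] gives [k e_k = sum_j j q_j e_(k-j)], a recursion on all earlier values. Hence a
    table: [exp_table q k] is meaningful at indices up to [k] only, and [exp_coef] reads the
    diagonal. *)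
Fixpoint exp_table (q : nat -> C) (k : nat) : nat -> C :=
  match k with
  | O => fun _ => cexp (q O)
  | S m => fun i => if Nat.leb i m then exp_table q m i else
      (RtoC (/ INR (S m)) *
        zsum (fun j => RtoC (INR (S j)) * q (S j) * exp_table q m (m - j)%nat) (S m))%C
  end.

Definition exp_coef (q : nat -> C) (k : nat) : C := exp_table q k k.

Lemma exp_table_stable q k i : (i <= k)%nat -> exp_table q k i = exp_coef q i.
Proof.
  induction k; intros H.
  - replace i with O by lia. reflexivity.
  - destruct (Nat.eq_dec i (S k)) as [->|]; [reflexivity|].
    cbn [exp_table]. destruct (Nat.leb_spec i k); [apply IHk; auto|lia].
Qed.

Lemma exp_coef_0 q : exp_coef q 0 = cexp (q O).
Proof. reflexivity. Qed.

Lemma INR_S_pos k : 0 < INR (S k).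
Proof. apply lt_0_INR; lia. Qed.

Lemma exp_coef_S q k : (RtoC (INR (S k)) * exp_coef q (S k) =
  zsum (fun j => RtoC (INR (S j)) * q (S j) * exp_coef q (k - j)%nat) (S k))%C.
Proof.
  unfold exp_coef at 1. cbn [exp_table]. destruct (Nat.leb_spec (S k) k); [lia|].
  pose proof (INR_S_pos k).
  rewrite Cmult_assoc, <- RtoC_mult, Rinv_r, Cmult_1_l by lra.
  apply zsum_ext. intros j Hj. rewrite exp_table_stable by lia. reflexivity.
Qed.

Lemma arith_geom_sum rho m : 0 <= rho < 1 ->
  rsum (fun j => INR (S j) * rho ^ j) m <= / (1 - rho) ^ 2.
Proof.
  intros H.
  assert (E : rsum (fun j => INR (S j) * rho ^ j) m * (1 - rho) ^ 2 =
     1 - (INR m + 1) * rho ^ m + INR m * rho ^ S m).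
  { induction m; [simpl; ring|]. cbn [rsum]. rewrite Rmult_plus_distr_r, IHm, S_INR. simpl. ring. }
  assert (Hp : 0 < (1 - rho) ^ 2) by (apply pow_lt; lra).
  apply Rmult_le_reg_r with ((1 - rho) ^ 2); auto. rewrite E, Rinv_l by lra.
  pose proof (pos_INR m). assert (0 <= rho ^ m) by (apply pow_le; lra). simpl.
  assert (0 <= INR m * rho ^ m) by (apply Rmult_le_pos; auto). nra.
Qed.

(** With [x k = |e_k| rho^k], the recursion gives [k x_k <= W X] as long as all earlier terms are at
    most [X]. For [k >= W] this bound reproduces itself, so the sum of the first [K0 + 1] terms
    bounds the whole sequence. *)
Lemma exp_coef_unit_radius q Cq : (forall k, Cmod (q k) <= Cq) -> unit_radius (exp_coef q).
Proof.
  intros Hq rho Hr.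
  assert (HCq : 0 <= Cq) by (pose proof (Hq O); pose proof (Cmod_ge_0 (q O)); lra).
  set (W := Cq * / (1 - rho) ^ 2).
  assert (HW : 0 <= W).
  { apply Rmult_le_pos; auto. apply Rlt_le, Rinv_0_lt_compat, pow_lt; lra. }
  set (x := fun k => Cmod (exp_coef q k) * rho ^ k).
  assert (Hx : forall k, 0 <= x k).
  { intros; apply Rmult_le_pos; [apply Cmod_ge_0|apply pow_le; lra]. }
  destruct (INR_unbounded W) as (K0 & HK0).
  set (X := rsum x (S K0)). exists X.
  intros k. fold (x k). induction k as [k IH] using (well_founded_induction Nat.lt_wf_0).
  destruct (Nat.le_gt_cases k K0) as [Hk|Hk].
  { apply rsum_term_le; [auto|lia]. }
  destruct k as [|k]; [lia|].
  assert (HX : 0 <= X) by (apply rsum_ge_0; auto).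
  pose proof (INR_S_pos k).
  assert (H1 : INR (S k) * x (S k) <= W * X).
  { unfold x. rewrite <- Rmult_assoc.
    rewrite <- (Cmod_RtoC_pos (INR (S k))) by lra.
    rewrite <- Cmod_mult, exp_coef_S, Rmult_comm.
    apply Rle_trans with (rho ^ S k * rsum (fun j => INR (S j) * Cq * Cmod (exp_coef q (k - j)%nat)) (S k)).
    { apply Rmult_le_compat_l; [apply pow_le; lra|].
      eapply Rle_trans; [apply Cmod_zsum_le|]. apply rsum_le. intros j Hj.
      pose proof (INR_S_pos j).
      rewrite !Cmod_mult, Cmod_RtoC_pos by lra. apply Rmult_le_compat_r; [apply Cmod_ge_0|].
      apply Rmult_le_compat_l; [lra|auto]. }
    rewrite <- rsum_scal.
    apply Rle_trans with (rsum (fun j => (Cq * X) * (INR (S j) * rho ^ j)) (S k)).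
    - apply rsum_le. intros j Hj. pose proof (INR_S_pos j).
      specialize (IH (k - j)%nat ltac:(lia)). unfold x in IH.
      assert (E : rho ^ S k = rho * rho ^ j * rho ^ (k - j)).
      { replace (S k) with (S (j + (k - j))) by lia. simpl. rewrite pow_add. ring. }
      rewrite E.
      assert (0 <= rho ^ j) by (apply pow_le; lra).
      replace (rho * rho ^ j * rho ^ (k - j) * (INR (S j) * Cq * Cmod (exp_coef q (k - j)%nat)))
        with ((Cq * (INR (S j) * rho ^ j)) * (rho * (Cmod (exp_coef q (k - j)%nat) * rho ^ (k - j)))) by ring.
      replace (Cq * X * (INR (S j) * rho ^ j)) with (Cq * (INR (S j) * rho ^ j) * X) by ring.
      apply Rmult_le_compat_l.
      + repeat apply Rmult_le_pos; lra.
      + assert (0 <= Cmod (exp_coef q (k - j)%nat) * rho ^ (k - j)) by apply Hx. nra.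
    - rewrite rsum_scal. unfold W.
      replace (Cq * / (1 - rho) ^ 2 * X) with (Cq * X * / (1 - rho) ^ 2) by ring.
      apply Rmult_le_compat_l; [apply Rmult_le_pos; auto|]. apply arith_geom_sum; auto. }
  assert (HWk : W <= INR (S k)).
  { apply Rle_trans with (INR K0); [lra|]. apply le_INR; lia. }
  assert (W * X <= INR (S k) * X) by (apply Rmult_le_compat_r; auto).
  apply Rmult_le_reg_l with (INR (S k)); lra.
Qed.

(** The recursion is the equation [E' = Q' E] along a ray, split into real and imaginary parts. *)
Lemma exp_coef_ray q u k :
  PS_derive (re_ray (exp_coef q) u) k =
    PS_mult (PS_derive (re_ray q u)) (re_ray (exp_coef q) u) k -
    PS_mult (PS_derive (im_ray q u)) (im_ray (exp_coef q) u) k /\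
  PS_derive (im_ray (exp_coef q) u) k =
    PS_mult (PS_derive (re_ray q u)) (im_ray (exp_coef q) u) k +
    PS_mult (PS_derive (im_ray q u)) (re_ray (exp_coef q) u) k.
Proof.
  assert (E : (RtoC (INR (S k)) * (exp_coef q (S k) * u ^ S k) =
    zsum (fun j => (RtoC (INR (S j)) * (q (S j) * u ^ S j)) * (exp_coef q (k - j)%nat * u ^ (k - j))) (S k))%C).
  { rewrite Cmult_assoc, exp_coef_S, Cmult_comm, <- zsum_mult_l. apply zsum_ext. intros j Hj.
    replace (S k) with (S j + (k - j))%nat by lia. rewrite Cpow_add_r. ring. }
  split.
  - apply (f_equal Re) in E. rewrite Re_scal, Re_zsum in E.
    unfold PS_derive at 1. unfold re_ray at 1. rewrite E, !PS_mult_rsum.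
    match goal with |- _ = rsum ?f _ - rsum ?g _ =>
      transitivity (rsum f (S k) + (-1) * rsum g (S k)); [|ring] end.
    rewrite <- rsum_scal, <- rsum_plus. apply rsum_ext. intros j Hj.
    rewrite Re_mult, Re_scal, Im_scal. unfold PS_derive, re_ray, im_ray. ring.
  - apply (f_equal Im) in E. rewrite Im_scal, Im_zsum in E.
    unfold PS_derive at 1. unfold im_ray at 1. rewrite E, !PS_mult_rsum, <- rsum_plus.
    apply rsum_ext. intros j Hj.
    rewrite Im_mult, Re_scal, Im_scal. unfold PS_derive, re_ray, im_ray. ring.
Qed.

Lemma zero_derivative_const (W : R -> R) x : 0 <= x < 1 ->
  (forall t, Rabs t < 1 -> is_derive W t 0) -> W x = W 0.
Proof.
  intros Hx H.
  destruct (MVT_gen W 0 x (fun _ => 0)) as (c & _ & E).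
  - intros t Ht. apply H. rewrite Rmin_left, Rmax_right in Ht by lra. rewrite Rabs_pos_eq; lra.
  - intros t Ht. rewrite Rmin_left, Rmax_right in Ht by lra.
    apply continuity_pt_filterlim. apply (@ex_derive_continuous R_AbsRing R_NormedModule).
    exists 0. apply H. rewrite Rabs_pos_eq; lra.
  - lra.
Qed.

(** For [y = y1 + i y2] with [y' = (p + i r)' y], the two functions are the real and imaginary parts
    of [y exp(-(p + i r))]. *)
Lemma exp_ode_integral (y1 y2 p r : R -> R) t dp dr :
  is_derive y1 t (dp * y1 t - dr * y2 t) -> is_derive y2 t (dp * y2 t + dr * y1 t) ->
  is_derive p t dp -> is_derive r t dr ->
  is_derive (fun t => exp (- p t) * (y1 t * cos (r t) + y2 t * sin (r t))) t 0 /\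
  is_derive (fun t => exp (- p t) * (y2 t * cos (r t) - y1 t * sin (r t))) t 0.
Proof.
  intros H1 H2 Hp Hr.
  assert (E1 : Derive (fun x => y1 x) t = dp * y1 t - dr * y2 t) by (apply is_derive_unique; exact H1).
  assert (E2 : Derive (fun x => y2 x) t = dp * y2 t + dr * y1 t) by (apply is_derive_unique; exact H2).
  assert (E3 : Derive (fun x => p x) t = dp) by (apply is_derive_unique; exact Hp).
  assert (E4 : Derive (fun x => r x) t = dr) by (apply is_derive_unique; exact Hr).
  split.
  - auto_derive; [repeat split; eexists; eassumption|]. rewrite E1, E2, E3, E4. ring.
  - auto_derive; [repeat split; eexists; eassumption|]. rewrite E1, E2, E3, E4. ring.
Qed.

(** On each ray the series with coefficients [exp_coef q] and the function [cexp (Q z)] solve the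
    same linear differential equation with the same value at 0. This identifies them without any
    composition of power series. *)
Lemma taylor_cexp Q q Cq : (forall k, Cmod (q k) <= Cq) -> taylor_coeffs Q q ->
  taylor_coeffs (fun z => cexp (Q z)) (exp_coef q).
Proof.
  intros Hq HQ.
  pose proof (bounded_unit_radius q Cq Hq) as Rq.
  pose proof (exp_coef_unit_radius q Cq Hq) as Re'.
  apply taylor_of_rays. intros u x Hu Hx.
  set (A := re_ray (exp_coef q) u). set (B := im_ray (exp_coef q) u).
  set (P := re_ray q u). set (S0 := im_ray q u).
  assert (RA : forall t, Rabs t < 1 -> Rbar_lt (Rabs t) (CV_radius A)) by (intros; apply re_ray_radius; auto).
  assert (RB : forall t, Rabs t < 1 -> Rbar_lt (Rabs t) (CV_radius B)) by (intros; apply im_ray_radius; auto).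
  assert (RP : forall t, Rabs t < 1 -> Rbar_lt (Rabs t) (CV_radius P)) by (intros; apply re_ray_radius; auto).
  assert (RR : forall t, Rabs t < 1 -> Rbar_lt (Rabs t) (CV_radius S0)) by (intros; apply im_ray_radius; auto).
  assert (DA : forall t, Rabs t < 1 -> is_derive (PSeries A) t
     (PSeries (PS_derive P) t * PSeries A t - PSeries (PS_derive S0) t * PSeries B t)).
  { intros t Ht. assert (RP' := RP t Ht). assert (RR' := RR t Ht).
    rewrite <- CV_radius_derive in RP'. rewrite <- CV_radius_derive in RR'.
    rewrite <- !PSeries_mult by auto. 
    rewrite <- PSeries_minus by (apply ex_pseries_mult; auto).
    rewrite <- (PSeries_ext (PS_derive A)).
    - apply is_derive_PSeries; auto.
    - intros k. destruct (exp_coef_ray q u k) as (E1 & _). exact E1. }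
  assert (DB : forall t, Rabs t < 1 -> is_derive (PSeries B) t
     (PSeries (PS_derive P) t * PSeries B t + PSeries (PS_derive S0) t * PSeries A t)).
  { intros t Ht. assert (RP' := RP t Ht). assert (RR' := RR t Ht).
    rewrite <- CV_radius_derive in RP'. rewrite <- CV_radius_derive in RR'.
    rewrite <- !PSeries_mult by auto.
    rewrite <- PSeries_plus by (apply ex_pseries_mult; auto).
    rewrite <- (PSeries_ext (PS_derive B)).
    - apply is_derive_PSeries; auto.
    - intros k. destruct (exp_coef_ray q u k) as (_ & E2). exact E2. }
  assert (DP : forall t, Rabs t < 1 -> is_derive (PSeries P) t (PSeries (PS_derive P) t))
    by (intros; apply is_derive_PSeries; auto).
  assert (DR : forall t, Rabs t < 1 -> is_derive (PSeries S0) t (PSeries (PS_derive S0) t))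
    by (intros; apply is_derive_PSeries; auto).
  set (W1 := fun t => exp (- PSeries P t) * (PSeries A t * cos (PSeries S0 t) + PSeries B t * sin (PSeries S0 t))).
  set (W2 := fun t => exp (- PSeries P t) * (PSeries B t * cos (PSeries S0 t) - PSeries A t * sin (PSeries S0 t))).
  assert (HW : forall t, Rabs t < 1 -> is_derive W1 t 0 /\ is_derive W2 t 0).
  { intros t Ht. apply (exp_ode_integral _ _ _ _ t (PSeries (PS_derive P) t) (PSeries (PS_derive S0) t)); auto. }
  pose proof (zero_derivative_const W1 x Hx (fun t Ht => proj1 (HW t Ht))) as C1.
  pose proof (zero_derivative_const W2 x Hx (fun t Ht => proj2 (HW t Ht))) as C2.
  unfold W1, W2 in C1, C2. rewrite !PSeries_0 in C1, C2.
  assert (A0 : A O = exp (P O) * cos (S0 O)).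
  { unfold A, P, S0, re_ray, im_ray. rewrite exp_coef_0. simpl Cpow. rewrite !Cmult_1_r. reflexivity. }
  assert (B0 : B O = exp (P O) * sin (S0 O)).
  { unfold B, P, S0, re_ray, im_ray. rewrite exp_coef_0. simpl Cpow. rewrite !Cmult_1_r. reflexivity. }
  assert (He : forall p, exp (- p) * exp p = 1).
  { intros p. rewrite <- exp_plus, Rplus_opp_l. apply exp_0. }
  pose proof (sin2_cos2 (S0 O)) as T0. unfold Rsqr in T0.
  pose proof (sin2_cos2 (PSeries S0 x)) as Tx. unfold Rsqr in Tx.
  rewrite A0, B0 in C1, C2.
  replace (exp (- P O) * (exp (P O) * cos (S0 O) * cos (S0 O) + exp (P O) * sin (S0 O) * sin (S0 O))) with 1 in C1.
  2:{ replace (exp (- P O) * (exp (P O) * cos (S0 O) * cos (S0 O) + exp (P O) * sin (S0 O) * sin (S0 O)))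
       with ((exp (- P O) * exp (P O)) * (sin (S0 O) * sin (S0 O) + cos (S0 O) * cos (S0 O))) by ring.
      rewrite He, T0. ring. }
  replace (exp (- P O) * (exp (P O) * sin (S0 O) * cos (S0 O) - exp (P O) * cos (S0 O) * sin (S0 O))) with 0 in C2 by ring.
  assert (Hxx : Rabs x < 1) by (rewrite Rabs_pos_eq; lra).
  assert (FA : PSeries A x = exp (PSeries P x) * cos (PSeries S0 x)).
  { set (p := PSeries P x) in *. set (r := PSeries S0 x) in *. set (a := PSeries A x) in *. set (b := PSeries B x) in *.
    transitivity ((exp (- p) * exp p) * (sin r * sin r + cos r * cos r) * a); [rewrite He, Tx; ring|].
    transitivity (exp p * (cos r * (exp (- p) * (a * cos r + b * sin r)) - sin r * (exp (- p) * (b * cos r - a * sin r)))); [ring|].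
    rewrite C1, C2. ring. }
  assert (FB : PSeries B x = exp (PSeries P x) * sin (PSeries S0 x)).
  { set (p := PSeries P x) in *. set (r := PSeries S0 x) in *. set (a := PSeries A x) in *. set (b := PSeries B x) in *.
    transitivity ((exp (- p) * exp p) * (sin r * sin r + cos r * cos r) * b); [rewrite He, Tx; ring|].
    transitivity (exp p * (sin r * (exp (- p) * (a * cos r + b * sin r)) + cos r * (exp (- p) * (b * cos r - a * sin r)))); [ring|].
    rewrite C1, C2. ring. }
  destruct (taylor_ray Q q u x HQ Hu Hxx) as (HP & HR).
  apply is_pseries_unique in HP. apply is_pseries_unique in HR.
  fold P in HP. fold S0 in HR.
  split.
  - replace (Re (cexp (Q (RtoC x * u)%C))) with (PSeries A x).
    + apply PSeries_correct. apply CV_radius_inside. apply RA; auto.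
    + rewrite FA, HP, HR. reflexivity.
  - replace (Im (cexp (Q (RtoC x * u)%C))) with (PSeries B x).
    + apply PSeries_correct. apply CV_radius_inside. apply RB; auto.
    + rewrite FB, HP, HR. reflexivity.
Qed.

(** * First variation *)

Lemma cexp_lin w : Cmod w <= 1 -> Cmod (cexp w - (1 + w))%C <= 31 * Cmod w ^ 2.
Proof.
  intros H. pose proof (cexp_quad_0 w H) as H1. pose proof (Cmod_ge_0 w).
  replace (cexp w - (1 + w))%C with ((cexp w - (1 + w + w ^ 2 / 2)) + w ^ 2 * RtoC (/ 2))%C.
  2:{ rewrite RtoC_inv by lra. unfold Cdiv. ring. }
  eapply Rle_trans; [apply Cmod_triangle|].
  rewrite Cmod_mult, Cmod_pow, (Cmod_RtoC_pos (/2)) by lra.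
  assert (0 <= Cmod w ^ 2) by (apply pow_le; auto).
  assert (Cmod w ^ 3 <= Cmod w ^ 2) by (replace (Cmod w ^ 3) with (Cmod w * Cmod w ^ 2) by ring; nra).
  lra.
Qed.

Definition kron0 (k : nat) : C := match k with O => RtoC 1 | _ => RtoC 0 end.

(** Induction through the recursion: at index [k + 1] the sequence [kron0] enters only for [j = k],
    which produces the linear term, and every other contribution is a product of two quantities of
    order [t]. The range of [t] ensures [t * Cq <= 1], as [cexp_lin] requires at index 0. *)
Lemma exp_coef_scal_expand q Cq k : (forall k, Cmod (q k) <= Cq) ->
  exists K, 0 <= K /\ forall i t, (i <= k)%nat -> 0 < t <= / (1 + Cq) ->
    Cmod (exp_coef (fun k => RtoC t * q k)%C i - kron0 i - RtoC t * q i)%C <= K * t ^ 2.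
Proof.
  intros Hq. assert (HCq : 0 <= Cq) by (pose proof (Hq O); pose proof (Cmod_ge_0 (q O)); lra).
  assert (Ht1 : forall t, 0 < t <= / (1 + Cq) -> 0 < t <= 1 /\ t * Cq <= 1).
  { intros t Ht. assert (t * (1 + Cq) <= 1).
    { apply Rle_trans with (/ (1 + Cq) * (1 + Cq)); [apply Rmult_le_compat_r; lra|]. rewrite Rinv_l; lra. }
    assert (0 <= t * Cq) by (apply Rmult_le_pos; lra). lra. }
  induction k as [|k (K & HK & IH)].
  - exists (31 * Cq ^ 2). split; [apply Rmult_le_pos; [lra|apply pow_le; auto]|].
    intros i t Hi Ht. replace i with O by lia. rewrite exp_coef_0. cbn [kron0].
    destruct (Ht1 t Ht) as (Ht2 & Ht3).
    assert (Hw : Cmod (RtoC t * q O)%C <= t * Cq).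
    { rewrite Cmod_mult, Cmod_RtoC_pos by lra. apply Rmult_le_compat_l; [lra|auto]. }
    replace (cexp (RtoC t * q O) - 1 - RtoC t * q O)%C with (cexp (RtoC t * q O) - (1 + RtoC t * q O))%C by ring.
    eapply Rle_trans; [apply cexp_lin; lra|].
    replace (31 * Cq ^ 2 * t ^ 2) with (31 * (t * Cq) ^ 2) by ring.
    apply Rmult_le_compat_l; [lra|]. apply pow_incr. split; [apply Cmod_ge_0|auto].
  - set (K' := (INR (S k) * (INR (S k) * Cq * (K + Cq)))).
    assert (HK' : 0 <= K') by (pose proof (pos_INR (S k)); unfold K'; repeat apply Rmult_le_pos; lra).
    exists (Rmax K K'). split; [eapply Rle_trans; [exact HK|apply Rmax_l]|].
    intros i t Hi Ht. assert (0 <= t ^ 2) by (apply pow_le; lra).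
    destruct (Nat.le_gt_cases i k) as [Hik|Hik].
    { eapply Rle_trans; [apply IH; auto|]. apply Rmult_le_compat_r; auto. apply Rmax_l. }
    replace i with (S k) by lia. cbn [kron0].
    apply Rle_trans with (K' * t ^ 2); [|apply Rmult_le_compat_r; auto; apply Rmax_r].
    destruct (Ht1 t Ht) as (Ht2 & Ht3).
    set (e := exp_coef (fun k => RtoC t * q k)%C) in *.
    pose proof (INR_S_pos k) as HSk.
    assert (Hone : 1 <= INR (S k)) by (rewrite S_INR; pose proof (pos_INR k); lra).
    assert (E : (RtoC (INR (S k)) * (e (S k) - 0 - RtoC t * q (S k)) =
      zsum (fun j => RtoC (INR (S j)) * (RtoC t * q (S j)) * (e (k - j)%nat - kron0 (k - j)%nat)) (S k))%C).
    { transitivity (RtoC (INR (S k)) * e (S k) + - (RtoC (INR (S k)) * (RtoC t * q (S k))))%C; [ring|].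
      unfold e. rewrite exp_coef_S. fold e.
      transitivity (zsum (fun j => RtoC (INR (S j)) * (RtoC t * q (S j)) * e (k - j)%nat) (S k)
        + - zsum (fun j => RtoC (INR (S j)) * (RtoC t * q (S j)) * kron0 (k - j)%nat) (S k))%C.
      - f_equal. f_equal. cbn [zsum]. rewrite Nat.sub_diag. cbn [kron0].
        rewrite zsum_0; [ring|]. intros j Hj. destruct (k - j)%nat eqn:Ej; [lia|]. cbn [kron0]. ring.
      - rewrite <- zsum_opp, <- zsum_plus. apply zsum_ext. intros; ring. }
    assert (Hb : Cmod (RtoC (INR (S k)) * (e (S k) - 0 - RtoC t * q (S k)))%C <= K' * t ^ 2).
    { rewrite E. eapply Rle_trans; [apply Cmod_zsum_le|].
      unfold K'. rewrite Rmult_assoc, <- rsum_const. apply rsum_le. intros j Hj.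
      specialize (IH (k - j)%nat t ltac:(lia) Ht). fold e in IH.
      assert (Hd : Cmod (e (k - j)%nat - kron0 (k - j)%nat)%C <= (K + Cq) * t).
      { replace (e (k - j)%nat - kron0 (k - j)%nat)%C with
          ((e (k - j)%nat - kron0 (k - j)%nat - RtoC t * q (k - j)%nat) + RtoC t * q (k - j)%nat)%C by ring.
        eapply Rle_trans; [apply Cmod_plus_le; [exact IH|rewrite Cmod_mult, Cmod_RtoC_pos by lra; apply Rmult_le_compat_l; [lra|apply Hq]]|].
        assert (K * t ^ 2 <= K * t) by (apply Rmult_le_compat_l; [auto|simpl; nra]). lra. }
      assert (INR (S j) <= INR (S k)) by (apply le_INR; lia). pose proof (INR_S_pos j).
      rewrite !Cmod_mult, !Cmod_RtoC_pos by lra.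
      replace (INR (S k) * Cq * (K + Cq) * t ^ 2) with (INR (S k) * (t * Cq) * ((K + Cq) * t)) by ring.
      apply Rmult_le_compat; auto; [|apply Cmod_ge_0|].
      - repeat apply Rmult_le_pos; try lra. apply Cmod_ge_0.
      - apply Rmult_le_compat; [lra| |lra|apply Rmult_le_compat_l; [lra|apply Hq]].
        apply Rmult_le_pos; [lra|apply Cmod_ge_0]. }
    rewrite Cmod_mult, Cmod_RtoC_pos in Hb by lra.
    pose proof (Cmod_ge_0 (e (S k) - 0 - RtoC t * q (S k))%C). nra.
Qed.

(** The [n]-th coefficient of [f h], where [f] has coefficients [a], as a linear functional of [h]:
    the derivative at [t = 0] of the [n]-th coefficient of [f exp(t h)]. *)
Definition pairing (a : nat -> C) (n : nat) (h : nat -> C) : C :=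
  zsum (fun k => a (n - k)%nat * h k)%C (S n).

Lemma pairing_conv a n h : conv a h n = pairing a n h.
Proof.
  unfold conv, pairing. rewrite zsum_rev. apply zsum_ext. intros k Hk.
  replace (S n - 1 - k)%nat with (n - k)%nat by lia.
  replace (n - (n - k))%nat with k by lia. reflexivity.
Qed.

Lemma pairing_plus a n g h : pairing a n (fun k => g k + h k)%C = (pairing a n g + pairing a n h)%C.
Proof. unfold pairing. rewrite <- zsum_plus. apply zsum_ext. intros; ring. Qed.

Lemma pairing_scal a n c h : pairing a n (fun k => c * h k)%C = (c * pairing a n h)%C.
Proof. unfold pairing. rewrite <- zsum_mult_l. apply zsum_ext. intros; ring. Qed.

Lemma pairing_ext a n g h : (forall k, (k <= n)%nat -> g k = h k) -> pairing a n g = pairing a n h.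
Proof. intros H. unfold pairing. apply zsum_ext. intros. rewrite H by lia. reflexivity. Qed.

Lemma pairing_zsum a n (g : nat -> nat -> C) N :
  pairing a n (fun k => zsum (fun i => g i k) N) = zsum (fun i => pairing a n (g i)) N.
Proof.
  unfold pairing. rewrite (zsum_swap (fun i k => a (n - k)%nat * g i k)%C).
  apply zsum_ext. intros k Hk. rewrite zsum_mult_l. reflexivity.
Qed.

Lemma pairing_kron0 a n : pairing a n kron0 = a n.
Proof.
  unfold pairing. rewrite zsum_head. cbn [kron0]. rewrite Nat.sub_0_r, zsum_0; [ring|].
  intros; ring.
Qed.

Definition maximal_coef (n : nat) (a : nat -> C) : Prop :=
  forall F b, B0 F -> taylor_coeffs F b -> Re (b n) <= Re (a n).

(** The [n]-th coefficient of [f exp(tQ)] is [a_n] plus [t] times the pairing plus [O(t^2)].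
    Competitors are available for [t > 0] alone, so only an inequality results. *)
Lemma first_variation n f a Q q Cq :
  taylor_coeffs f a -> maximal_coef n a ->
  (forall k, Cmod (q k) <= Cq) -> taylor_coeffs Q q ->
  (forall t, 0 < t <= 1 -> B0 (fun z => f z * cexp (RtoC t * Q z))%C) ->
  Re (pairing a n q) <= 0.
Proof.
  intros Hf Hmax Hq HQ HB.
  assert (HCq : 0 <= Cq) by (pose proof (Hq O); pose proof (Cmod_ge_0 (q O)); lra).
  destruct (exp_coef_scal_expand q Cq n Hq) as (K & HK & Hexp).
  set (A := rsum (fun k => Cmod (a (n - k)%nat)) (S n)).
  assert (HA : 0 <= A) by (apply rsum_ge_0; intros; apply Cmod_ge_0).
  assert (Hi : 0 < / (1 + Cq)) by (apply Rinv_0_lt_compat; lra).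
  assert (Hi1 : / (1 + Cq) <= 1) by (rewrite <- Rinv_1; apply Rinv_le_contravar; lra).
  assert (Hall : forall t, 0 < t <= / (1 + Cq) -> Re (pairing a n q) <= A * K * t).
  { intros t Ht. set (e := exp_coef (fun k => RtoC t * q k)%C).
    assert (Htay : taylor_coeffs (fun z => f z * cexp (RtoC t * Q z))%C (conv a e)).
    { apply taylor_mult; auto. apply (taylor_cexp (fun z => RtoC t * Q z)%C _ (t * Cq)).
      - intros k. rewrite Cmod_mult, Cmod_RtoC_pos by lra. apply Rmult_le_compat_l; [lra|auto].
      - apply taylor_scal; auto. }
    specialize (Hmax _ _ (HB t ltac:(lra)) Htay). rewrite pairing_conv in Hmax.
    assert (E : pairing a n e = (a n + (RtoC t * pairing a n q + pairing a n (fun k => e k - kron0 k - RtoC t * q k)))%C).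
    { rewrite <- (pairing_kron0 a n) at 1. rewrite <- pairing_scal, <- !pairing_plus. apply pairing_ext.
      intros; ring. }
    rewrite E, !Re_plus, Re_scal in Hmax.
    assert (Hr : Cmod (pairing a n (fun k => e k - kron0 k - RtoC t * q k)%C) <= A * (K * t ^ 2)).
    { unfold pairing. eapply Rle_trans; [apply Cmod_zsum_le|]. unfold A. rewrite Rmult_comm, <- rsum_scal.
      apply rsum_le. intros k Hk. rewrite Cmod_mult, Rmult_comm. apply Rmult_le_compat_r; [apply Cmod_ge_0|].
      apply Hexp; [lia|auto]. }
    pose proof (re_le_Cmod (pairing a n (fun k => e k - kron0 k - RtoC t * q k)%C)) as Hr2.
    apply Rabs_le_between in Hr2.
    apply Rmult_le_reg_l with t; [lra|].
    replace (t * (A * K * t)) with (A * (K * t ^ 2)) by ring. lra. }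
  apply Rnot_lt_le. intros Hpos.
  assert (HAK : 0 <= A * K) by (apply Rmult_le_pos; auto).
  set (p := Re (pairing a n q)) in *.
  set (t := Rmin (/ (1 + Cq)) (p / (2 * (A * K + 1)))).
  assert (Ht : 0 < t) by (apply Rmin_glb_lt; [lra|apply Rdiv_lt_0_compat; lra]).
  pose proof (Rmin_l (/ (1 + Cq)) (p / (2 * (A * K + 1)))) as H1. fold t in H1.
  pose proof (Rmin_r (/ (1 + Cq)) (p / (2 * (A * K + 1)))) as H2. fold t in H2.
  specialize (Hall t ltac:(lra)).
  assert (t * (2 * (A * K + 1)) <= p).
  { apply Rle_trans with (p / (2 * (A * K + 1)) * (2 * (A * K + 1))); [apply Rmult_le_compat_r; lra|].
    right; field; lra. }
  nra.
Qed.

(** * Conditions satisfied by an extremal function *)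

Lemma B0_quad F : (forall z, inD z -> quad F z) ->
  (forall z, inD z -> 0 < Cmod (F z) <= 1) -> B0 F.
Proof.
  intros H1 H2. split.
  - intros z Hz. apply quad_ex_derive; auto.
  - intros z Hz. specialize (H2 z Hz). lra.
Qed.

Lemma quad_on_disc F G z : inD z -> (forall x, inD x -> F x = G x) -> quad F z -> quad G z.
Proof.
  intros Hz E H. unfold inD in *. apply (quad_ext_loc F G z (1 - Cmod z)); auto; [lra|].
  intros x Hx. apply E. pose proof (Cmod_triangle_inv x z). lra.
Qed.

Lemma Cmod_mul_unit al z : Cmod al = 1 -> Cmod (al * z)%C = Cmod z.
Proof. intros H. rewrite Cmod_mult, H. ring. Qed.

Lemma unit_one_minus_nz al z : Cmod al = 1 -> Cmod z < 1 -> (1 - al * z)%C <> RtoC 0.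
Proof. intros. apply one_minus_nz. rewrite Cmod_mul_unit; auto. Qed.

Lemma Re_herg al z : Cmod al = 1 -> Cmod z < 1 ->
  Re (herg al z) = (1 - Cmod z ^ 2) / Cmod (1 - al * z)%C ^ 2.
Proof.
  intros Hal Hz. pose proof (unit_one_minus_nz al z Hal Hz) as Hnz.
  rewrite <- (Cmod_mul_unit al z) by auto.
  unfold herg. set (w := (al * z)%C) in *.
  assert (Hd : 0 < Cmod (1 - w)%C ^ 2) by (apply pow_lt, Cmod_gt_0; auto).
  rewrite !Cmod_sqr in *. destruct w as [x y]. unfold Cdiv, Cinv, Re, Im in *; simpl in *.
  field. lra.
Qed.

Lemma Re_herg_pos al z : Cmod al = 1 -> Cmod z < 1 -> 0 < Re (herg al z).
Proof.
  intros Hal Hz. rewrite Re_herg by auto. pose proof (Cmod_ge_0 z).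
  apply Rdiv_lt_0_compat; [nra|]. apply pow_lt, Cmod_gt_0, unit_one_minus_nz; auto.
Qed.

Lemma quad_herg al z : Cmod al = 1 -> Cmod z < 1 -> quad (herg al) z.
Proof.
  intros Hal Hz. unfold herg. apply quad_div.
  - apply quad_plus; [apply quad_const|]. apply quad_scal, quad_id.
  - apply quad_minus; [apply quad_const|]. apply quad_scal, quad_id.
  - apply unit_one_minus_nz; auto.
Qed.

Lemma taylor_monomial c m : taylor_coeffs (fun z => c * z ^ m)%C (fun k => if Nat.eqb k m then c else RtoC 0).
Proof.
  intros z Hz. rewrite is_series_C_eps. intros eps He. exists m. intros n Hn.
  assert (E : forall n, zsum (fun j => ((if Nat.eqb j m then c else 0) * @pow_n C_Ring z j)%C) n =
    if Nat.leb n m then RtoC 0 else (c * z ^ m)%C).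
  { clear. induction n; [reflexivity|]. cbn [zsum]. rewrite IHn.
    destruct (Nat.leb_spec n m), (Nat.leb_spec (S n) m), (Nat.eqb_spec n m); try lia.
    - ring.
    - subst. rewrite pow_n_Cpow. ring.
    - ring. }
  rewrite E. destruct (Nat.leb_spec (S n) m); [lia|].
  replace (c * z ^ m - c * z ^ m)%C with (RtoC 0) by ring. rewrite Cmod_0; lra.
Qed.

(** The competitor [-(1 - z^n) / 2] is zero-free and bounded by 1, and its [n]-th coefficient is
    [1/2]. *)
Lemma maximal_coef_ge_half n a : (1 <= n)%nat -> maximal_coef n a -> 1 / 2 <= Re (a n).
Proof.
  intros Hn H.
  set (F := fun z : C => (RtoC (- / 2) * z ^ 0 + RtoC (/ 2) * z ^ n)%C).
  specialize (H F _ (B0_quad F ltac:(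
    intros z _; apply quad_plus; apply quad_scal, quad_pow, quad_id) ltac:(
    intros z Hz; unfold inD in Hz;
    assert (E : F z = (RtoC (- / 2) * (1 - z ^ n))%C)
      by (unfold F; rewrite RtoC_opp; simpl Cpow; ring);
    assert (Hp : Cmod (z ^ n)%C < 1) by
      (rewrite Cmod_pow; destruct n; [lia|]; pose proof (Cmod_ge_0 z);
       apply Rle_lt_trans with (Cmod z); [|auto];
       assert (Cmod z ^ n <= 1) by (rewrite <- (pow1 n); apply pow_incr; lra);
       assert (0 <= Cmod z ^ n) by (apply pow_le; auto); simpl; nra);
    rewrite E, Cmod_mult, Cmod_R, Rabs_Ropp, Rabs_pos_eq by lra;
    pose proof (proj1 (Cmod_gt_0 _) (one_minus_nz _ Hp));
    pose proof (Cmod_triangle_minus 1 (z ^ n)%C); rewrite Cmod_1 in *; lra))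
    (taylor_plus _ _ _ _ (taylor_monomial (RtoC (- / 2)) 0) (taylor_monomial (RtoC (/ 2)) n))).
  cbv beta in H. rewrite Nat.eqb_refl in H. destruct n; [lia|]. simpl in H. lra.
Qed.

Definition atom_sum (N : nat) (lam : nat -> R) (alpha : nat -> C) (z : C) : C :=
  zsum (fun i => RtoC (lam i) * herg (alpha i) z)%C N.

Definition atom_coef (N : nat) (lam : nat -> R) (alpha : nat -> C) (k : nat) : C :=
  zsum (fun i => RtoC (lam i) * hcoef (alpha i) k)%C N.

(** With [be] the conjugate of a boundary point, [ed_pos] says that [T] is nonnegative and [ed_zero]
    that it vanishes at the atoms. [ed_rec] is [f' = - P' f] coefficientwise, [P] being the weighted
    sum of Herglotz kernels in the exponent. *)
Record extremal_data (n : nat) (f : C -> C) (N : nat) (lam : nat -> R) (alpha : nat -> C)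
    (a : nat -> C) : Prop := {
  ed_taylor : taylor_coeffs f a;
  ed_bound : forall z, inD z -> Cmod (f z) <= 1;
  ed_lam : forall j, (j < N)%nat -> 0 < lam j;
  ed_alpha : forall j, (j < N)%nat -> Cmod (alpha j) = 1;
  ed_half : 1 / 2 <= Re (a n);
  ed_real : Im (a n) = 0;
  ed_pos : forall be, Cmod be = 1 -> 0 <= Re (pairing a n (hcoef be));
  ed_zero : forall i, (i < N)%nat -> Re (pairing a n (hcoef (alpha i))) = 0;
  ed_rec : forall k, (RtoC (INR (S k)) * a (S k) =
    zsum (fun j => RtoC (INR (S j)) * - atom_coef N lam alpha (S j) * a (k - j)%nat) (S k))%C
}.
Arguments ed_taylor {n f N lam alpha a} _.
Arguments ed_bound {n f N lam alpha a} _.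
Arguments ed_lam {n f N lam alpha a} _.
Arguments ed_alpha {n f N lam alpha a} _.
Arguments ed_half {n f N lam alpha a} _.
Arguments ed_real {n f N lam alpha a} _.
Arguments ed_pos {n f N lam alpha a} _.
Arguments ed_zero {n f N lam alpha a} _.
Arguments ed_rec {n f N lam alpha a} _.

(** [f exp(Q)] stays in the class whenever [Re Q <= Re P]. Adding an atom, rotating by a unimodular
    constant and shrinking all weights satisfy this; they give, respectively, nonnegativity of [T],
    reality of [a_n], and vanishing of [T] at the atoms. *)
Lemma extremal_data_intro n f gamma N lam alpha : (1 <= n)%nat -> extremal n f ->
  atom_rep f gamma N lam alpha -> exists a, extremal_data n f N lam alpha a.
Proof.
  intros Hn ((Hholo & Hf) & a & Hta & Hmax) (Hg & Hlam & Hal & _ & Hrep).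
  exists a.
  change (maximal_coef n a) in Hmax.
  set (P := atom_sum N lam alpha). set (p := atom_coef N lam alpha).
  assert (Hrep' : forall z, inD z -> f z = (gamma * cexp (- P z))%C).
  { intros z Hz. rewrite Hrep by auto. do 3 f_equal. rewrite csum_zsum. reflexivity. }
  assert (HP : taylor_coeffs P p).
  { apply (taylor_zsum (fun i z => RtoC (lam i) * herg (alpha i) z)%C (fun i k => RtoC (lam i) * hcoef (alpha i) k)%C).
    intros i Hi. apply taylor_scal, taylor_herg; auto. }
  assert (HPq : forall z, inD z -> quad P z).
  { intros z Hz. apply quad_zsum. intros k Hk. apply quad_scal, quad_herg; auto. }
  assert (HPpos : forall z, inD z -> 0 <= Re (P z)).
  { intros z Hz. unfold P, atom_sum. rewrite Re_zsum. apply rsum_ge_0. intros k Hk. rewrite Re_scal.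
    apply Rmult_le_pos; [apply Rlt_le; auto|apply Rlt_le, Re_herg_pos; auto]. }
  assert (Hpb : exists Cp, forall k, Cmod (p k) <= Cp).
  { exists (rsum (fun i => lam i * 2) N). intros k. unfold p, atom_coef.
    eapply Rle_trans; [apply Cmod_zsum_le|]. apply rsum_le. intros i Hi.
    specialize (Hlam i Hi). rewrite Cmod_mult, Cmod_RtoC_pos by lra.
    apply Rmult_le_compat_l; [lra|apply hcoef_bound; auto]. }
  destruct Hpb as (Cp & Hpb).
  assert (HB : forall Q : C -> C, (forall z, inD z -> quad Q z) ->
    (forall z, inD z -> Re (Q z) <= Re (P z)) -> B0 (fun z => f z * cexp (Q z))%C).
  { intros Q HQ HR.
    assert (E : forall z, inD z -> (gamma * cexp (- P z + Q z))%C = (f z * cexp (Q z))%C).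
    { intros z Hz. rewrite Hrep' by auto. rewrite cexp_plus. ring. }
    apply B0_quad.
    - intros z Hz. apply (quad_on_disc (fun z => gamma * cexp (- P z + Q z))%C); auto.
      apply quad_scal, quad_cexp, quad_plus; [apply quad_opp|]; auto.
    - intros z Hz. rewrite <- E by auto. rewrite Cmod_mult, Hg, Cmod_cexp, Rmult_1_l. split; [apply exp_pos|].
      specialize (HR z Hz). rewrite Re_plus, Re_opp.
      rewrite <- exp_0. destruct (Req_dec (- Re (P z) + Re (Q z)) 0) as [->|]; [lra|].
      apply Rlt_le, exp_increasing. lra. }
  (* Direction [- herg be]: an additional atom at [be] of weight [t]. *)
  assert (Hpos : forall be, Cmod be = 1 -> 0 <= Re (pairing a n (hcoef be))).
  { intros be Hbe.
    assert (H : Re (pairing a n (fun k => RtoC (-1) * hcoef be k)%C) <= 0).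
    { apply (first_variation n f a (fun z => RtoC (-1) * herg be z)%C _ 2 Hta Hmax).
      - intros k. rewrite Cmod_mult, Cmod_R, Rabs_left by lra. pose proof (hcoef_bound be k Hbe). lra.
      - apply taylor_scal, taylor_herg; auto.
      - intros t Ht. apply HB.
        + intros z Hz. apply quad_scal, quad_scal, quad_herg; auto.
        + intros z Hz. rewrite !Re_scal. specialize (HPpos z Hz).
          pose proof (Re_herg_pos be z Hbe Hz). nra. }
    rewrite pairing_scal, Re_scal in H. lra. }
  constructor; auto.
  - intros z Hz. apply Hf; auto.
  - apply maximal_coef_ge_half; auto.
  (* Directions [i] and [-i]: rotations of [f], of which the pairing sees only [a_n]. *)
  - assert (H : forall e : R, Rabs e = 1 -> - (e * Im (a n)) <= 0).
    { intros e He.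
      assert (H : Re (pairing a n (fun k => (Ci * RtoC e) * (if Nat.eqb k 0 then RtoC 1 else RtoC 0))%C) <= 0).
      { apply (first_variation n f a (fun z => (Ci * RtoC e) * (RtoC 1 * z ^ 0))%C _ 1 Hta Hmax).
        - intros k. rewrite !Cmod_mult, Cmod_Ci, Cmod_R, He.
          destruct (Nat.eqb k 0); rewrite ?Cmod_1, ?Cmod_0; lra.
        - apply taylor_scal, taylor_monomial.
        - intros t Ht. apply HB.
          + intros z Hz. apply quad_scal, quad_scal, quad_scal, quad_pow, quad_id.
          + intros z Hz. specialize (HPpos z Hz).
            replace (Re (RtoC t * (Ci * RtoC e * (1 * z ^ 0)))%C) with 0; [lra|].
            rewrite Re_scal. unfold Re, Im; simpl. ring. }
      rewrite pairing_scal in H.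
      rewrite (pairing_ext a n _ kron0) in H by (intros [|k] _; reflexivity).
      rewrite pairing_kron0 in H. rewrite !Re_mult, Im_mult in H. unfold Ci, RtoC, Re, Im in *. simpl in H. lra. }
    pose proof (H 1 ltac:(apply Rabs_R1)). pose proof (H (-1) ltac:(rewrite Rabs_left; lra)). lra.
  (* Direction [P]: all weights are multiplied by [1 - t]. The weighted sum of the values of [T] at
     the atoms is thus at most 0, while each of its terms is nonnegative. *)
  - assert (H : Re (pairing a n p) <= 0).
    { apply (first_variation n f a P p Cp Hta Hmax Hpb HP).
      intros t Ht. apply HB.
      - intros z Hz. apply quad_scal; auto.
      - intros z Hz. rewrite Re_scal. specialize (HPpos z Hz). nra. }
    unfold p, atom_coef in H. rewrite pairing_zsum, Re_zsum in H.
    rewrite (rsum_ext _ (fun i => lam i * Re (pairing a n (hcoef (alpha i))))) in H.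
    2:{ intros i Hi. rewrite pairing_scal, Re_scal. reflexivity. }
    intros i Hi.
    assert (H0 : lam i * Re (pairing a n (hcoef (alpha i))) = 0).
    { apply (rsum_0_inv (fun i => lam i * Re (pairing a n (hcoef (alpha i)))) N); auto.
      intros j Hj. apply Rmult_le_pos; [apply Rlt_le|]; auto. }
    specialize (Hlam i Hi). apply Rmult_integral in H0. destruct H0; lra.
  - set (q := fun k => (- p k)%C).
    assert (Hta' : taylor_coeffs f (fun k => gamma * exp_coef q k)%C).
    { apply (taylor_ext (fun z => gamma * cexp (RtoC (-1) * P z))%C).
      - intros z Hz. rewrite Hrep' by auto. f_equal. f_equal.
        rewrite RtoC_m1. ring.
      - apply taylor_scal. apply (taylor_cexp _ _ Cp).
        + intros k. unfold q. rewrite Cmod_opp. auto.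
        + intros z Hz. pose proof (taylor_scal (RtoC (-1)) _ _ HP z Hz) as H.
          rewrite is_series_C_eps in *. intros eps He. destruct (H eps He) as (M & HM). exists M.
          intros m Hm. specialize (HM m Hm).
          rewrite (zsum_ext _ (fun j => RtoC (-1) * p j * @pow_n C_Ring z j)%C); auto.
          intros j Hj. unfold q.
          rewrite RtoC_m1. ring. }
    intros k. rewrite !(taylor_unique _ _ _ Hta Hta' (S k)).
    transitivity (gamma * (RtoC (INR (S k)) * exp_coef q (S k)))%C; [ring|].
    rewrite exp_coef_S, <- zsum_mult_l. apply zsum_ext. intros j Hj.
    rewrite (taylor_unique _ _ _ Hta Hta' (k - j)%nat). unfold q. fold p. ring.
Qed.

(** Without atoms [f] is constant and [ed_rec] gives [a_n = 0], against [a_n >= 1/2]. *)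
Lemma extremal_data_atoms n f N lam alpha a : (1 <= n)%nat -> extremal_data n f N lam alpha a -> (1 <= N)%nat.
Proof.
  intros Hn E. destruct N; [|lia]. exfalso. pose proof (ed_half E) as H.
  destruct n as [|n]; [lia|]. pose proof (ed_rec E n) as Hr.
  rewrite zsum_0 in Hr.
  - apply (f_equal Re) in Hr. rewrite Re_scal, Re_RtoC in Hr.
    pose proof (INR_S_pos n). apply Rmult_integral in Hr. lra.
  - intros k _. unfold atom_coef. cbn [zsum]. ring.
Qed.

(** * The identity phi T = n T - |D| T *)

(** Coefficients of [-2 al z / (1 - al z)^2], which is minus [z d/dz] of the Herglotz kernel; the
    weighted sum over the atoms is [Phi = z f'/f]. *)
Definition koebe_coef (al : C) (k : nat) : C := (- (2 * RtoC (INR k) * al ^ k))%C.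

Lemma hcoef_S be k : (1 <= k)%nat -> hcoef be (S k) = (be * hcoef be k)%C.
Proof. intros H. destruct k; [lia|]. cbn [hcoef]. rewrite !Cpow_S. ring. Qed.

Lemma conv_koebe_S al be m :
  conv (koebe_coef al) (hcoef be) (S m) =
  (be * conv (koebe_coef al) (hcoef be) m + be * koebe_coef al m + koebe_coef al (S m))%C.
Proof.
  unfold conv.
  change (zsum (fun j => koebe_coef al j * hcoef be (S m - j)) (S (S m)))%C with
    (zsum (fun j => koebe_coef al j * hcoef be (S m - j)) m +
     koebe_coef al m * hcoef be (S m - m) + koebe_coef al (S m) * hcoef be (S m - S m))%C.
  change (zsum (fun j => koebe_coef al j * hcoef be (m - j)) (S m))%C with
    (zsum (fun j => koebe_coef al j * hcoef be (m - j)) m + koebe_coef al m * hcoef be (m - m))%C.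
  rewrite (zsum_ext _ (fun j => be * (koebe_coef al j * hcoef be (m - j)))%C).
  - rewrite zsum_mult_l. replace (S m - m)%nat with 1%nat by lia. rewrite !Nat.sub_diag. simpl hcoef. ring.
  - intros j Hj. replace (S m - j)%nat with (S (m - j)) by lia. rewrite hcoef_S by lia. ring.
Qed.

(* partial fractions of (z d/dz H_al) * H_be, coefficientwise *)
Lemma conv_koebe al be m : al <> be ->
  conv (koebe_coef al) (hcoef be) m =
  (- (2 * al * be) / (al - be) ^ 2 * (hcoef be m - hcoef al m)
   + (al + be) / (al - be) * koebe_coef al m)%C.
Proof.
  intros H.
  assert (Hd : (al - be)%C <> RtoC 0).
  { intros E. apply H. replace al with (al - be + be)%C by ring. rewrite E. ring. }
  induction m.
  - unfold conv, koebe_coef. simpl. field. auto.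
  - rewrite conv_koebe_S, IHm. unfold koebe_coef. rewrite S_INR, RtoC_plus.
    destruct m.
    + cbn [hcoef INR]. simpl Cpow. field. auto.
    + cbn [hcoef]. rewrite !Cpow_S. field. auto.
Qed.

(* Tb, Sb and lam i * qb are T, S and the i-th summand of S at the point w = conj be. *)
Definition Tb (a : nat -> C) (n : nat) (be : C) : R := Re (pairing a n (hcoef be)).
Definition qb (a : nat -> C) (n : nat) (al be : C) : R :=
  Re (pairing a n (conv (koebe_coef al) (hcoef be))).

Lemma Cmod_1_components e : Cmod e = 1 -> Re e ^ 2 + Im e ^ 2 = 1.
Proof. intros H. rewrite <- Cmod_sqr, H. ring. Qed.

(** [1 - Re e] is half of [|1 - e|^2], so multiplying the partial fractions by it turns the first
    coefficient into 1 and the second into [i Im e]. What remains is [T] at two points and a term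
    odd in the argument of [e]. *)
Lemma qb_formula a n al e : Cmod al = 1 -> Cmod e = 1 -> e <> RtoC 1 ->
  (1 - Re e) * qb a n al (al * e)%C =
  Tb a n (al * e)%C - Tb a n al - Im e * Im (pairing a n (koebe_coef al)).
Proof.
  intros Hal He Hne.
  assert (Hal0 : al <> RtoC 0) by (intros E; rewrite E, Cmod_0 in Hal; lra).
  assert (Hne' : al <> (al * e)%C).
  { intros E. apply Hne. transitivity ((/ al) * (al * e))%C; [field; auto|]. rewrite <- E. field; auto. }
  assert (Hx : 0 < 1 - Re e).
  { apply Cmod_1_components in He. destruct e as [x y]. unfold Re, Im in *; simpl in *.
    destruct (Req_dec x 1) as [->|]; [|nra].
    exfalso. apply Hne. assert (y = 0) by nra. subst. reflexivity. }
  assert (H1e : (1 - e)%C <> RtoC 0).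
  { intros E. apply Hne. replace e with (1 - (1 - e))%C by ring. rewrite E. ring. }
  assert (Hd : (al - al * e)%C <> RtoC 0).
  { replace (al - al * e)%C with (al * (1 - e))%C by ring. apply Cmult_neq_0; auto. }
  assert (E1 : (RtoC (1 - Re e) * (- (2 * al * (al * e)) / (al - al * e) ^ 2))%C = RtoC 1).
  { replace (- (2 * al * (al * e)) / (al - al * e) ^ 2)%C with (- (2 * e) / (1 - e) ^ 2)%C by (field; repeat split; auto).
    assert (E0 : ((1 - e) ^ 2 = - (RtoC (1 - Re e) * (2 * e)))%C).
    { apply Cmod_1_components in He. destruct e as [x y]. unfold Re, Im in *; simpl in *.
      apply C_eq; unfold Re, Im; simpl; nra. }
    apply (f_equal (fun w => - w)%C) in E0.
    transitivity ((- - (RtoC (1 - Re e) * (2 * e))) * - / (1 - e) ^ 2)%C; [unfold Cdiv; ring|].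
    rewrite <- E0. field. auto. }
  assert (E2 : (RtoC (1 - Re e) * ((al + al * e) / (al - al * e)))%C = (Ci * RtoC (Im e))%C).
  { replace ((al + al * e) / (al - al * e))%C with ((1 + e) / (1 - e))%C by (field; repeat split; auto).
    assert (E0 : (RtoC (1 - Re e) * (1 + e) = Ci * RtoC (Im e) * (1 - e))%C).
    { apply Cmod_1_components in He. destruct e as [x y]. unfold Re, Im in *; simpl in *.
      apply C_eq; unfold Re, Im; simpl; nra. }
    transitivity (RtoC (1 - Re e) * (1 + e) * / (1 - e))%C; [unfold Cdiv; ring|].
    rewrite E0. field. auto. }
  unfold qb. rewrite <- Re_scal, <- pairing_scal.
  rewrite (pairing_ext a n _ (fun k => (hcoef (al * e) k + RtoC (-1) * hcoef al k) + (Ci * RtoC (Im e)) * koebe_coef al k)%C).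
  - rewrite !pairing_plus, !pairing_scal, !Re_plus, Re_scal, <- !Cmult_assoc.
    unfold Tb. rewrite (Re_mult Ci), Re_scal, Im_scal.
    unfold Ci, Re at 3, Im at 1. simpl. ring.
  - intros k _. rewrite conv_koebe by auto.
    transitivity ((RtoC (1 - Re e) * (- (2 * al * (al * e)) / (al - al * e) ^ 2)) * (hcoef (al * e) k - hcoef al k)
      + (RtoC (1 - Re e) * ((al + al * e) / (al - al * e))) * koebe_coef al k)%C; [ring|].
    rewrite E1, E2, RtoC_m1. ring.
Qed.

Lemma cis_small d : 0 < d <= 1 / 2 ->
  d / 2 <= sin d /\ 0 < 1 - cos d <= d ^ 2 /\ Cmod (cis d - 1)%C <= 2 * d.
Proof.
  intros Hd. pose proof (sin_quad d ltac:(rewrite Rabs_pos_eq; lra)) as H1.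
  pose proof (cos_quad d ltac:(rewrite Rabs_pos_eq; lra)) as H2.
  rewrite (Rabs_pos_eq d) in H1, H2 by lra.
  apply Rabs_le_between in H1. apply Rabs_le_between in H2.
  assert (d ^ 2 <= d / 2) by nra. assert (0 < d ^ 2) by nra.
  assert (d ^ 3 <= d / 4) by (simpl in *; nra).
  assert (d ^ 4 <= d ^ 2 / 4) by (replace (d ^ 4) with (d ^ 2 * d ^ 2) by ring; nra).
  repeat split; try lra.
  eapply Rle_trans; [apply Cmod_le_ReIm|]. rewrite Re_minus, Im_minus, Re_cis, Im_cis, Re_RtoC, Im_RtoC.
  assert (Rabs (cos d - 1) <= d ^ 2) by (apply Rabs_le; lra).
  assert (Rabs (sin d - 0) <= d + d / 4) by (apply Rabs_le; lra). lra.
Qed.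

Lemma qb_bounded a n al : exists X, 0 <= X /\ forall be, Cmod be = 1 -> Rabs (qb a n al be) <= X.
Proof.
  exists (rsum (fun k => Cmod (a (n - k)%nat) * rsum (fun j => Cmod (koebe_coef al j) * 2) (S k)) (S n)).
  split.
  - apply rsum_ge_0. intros. apply Rmult_le_pos; [apply Cmod_ge_0|]. apply rsum_ge_0. intros.
    apply Rmult_le_pos; [apply Cmod_ge_0|lra].
  - intros be Hbe. unfold qb. eapply Rle_trans; [apply re_le_Cmod|].
    eapply Rle_trans; [apply Cmod_zsum_le|]. apply rsum_le. intros k Hk.
    rewrite Cmod_mult. apply Rmult_le_compat_l; [apply Cmod_ge_0|].
    eapply Rle_trans; [apply Cmod_zsum_le|]. apply rsum_le. intros j Hj.
    rewrite Cmod_mult. apply Rmult_le_compat_l; [apply Cmod_ge_0|]. apply hcoef_bound; auto.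
Qed.

(* At an atom the nonnegative T vanishes, so the odd term of qb_formula must vanish too. *)
Lemma koebe_pairing_real a n al : Cmod al = 1 ->
  (forall be, Cmod be = 1 -> 0 <= Tb a n be) -> Tb a n al = 0 ->
  Im (pairing a n (koebe_coef al)) = 0.
Proof.
  intros Hal Hpos H0. destruct (qb_bounded a n al) as (X & HX & Hb).
  set (J := Im (pairing a n (koebe_coef al))).
  assert (H : forall d, 0 < d <= 1 / 2 -> Rabs J <= 2 * X * d).
  { intros d Hd. destruct (cis_small d Hd) as (H1 & H2 & _).
    assert (Hs : forall s, Rabs s = d -> - (X * d ^ 2) <= sin s * J).
    { intros s Hs.
      assert (Hc : cos s = cos d) by (unfold Rabs in Hs; destruct (Rcase_abs s); subst d; [rewrite cos_neg|]; reflexivity).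
      assert (Hne : cis s <> RtoC 1).
      { intros E. apply (f_equal Re) in E. rewrite Re_cis, Re_RtoC in E. lra. }
      pose proof (qb_formula a n al (cis s) Hal (Cmod_cis s) Hne) as E.
      rewrite H0, Re_cis, Im_cis in E. fold J in E.
      assert (Hu : Cmod (al * cis s)%C = 1) by (rewrite Cmod_mult, Hal, Cmod_cis; ring).
      specialize (Hb _ Hu). specialize (Hpos _ Hu). apply Rabs_le_between in Hb.
      rewrite Hc in E.
      assert ((1 - cos d) * (X - qb a n al (al * cis s)%C) >= 0) by nra.
      assert ((1 - cos d) * X <= d ^ 2 * X) by (apply Rmult_le_compat_r; lra). lra. }
    pose proof (Hs d ltac:(apply Rabs_pos_eq; lra)) as Ha.
    pose proof (Hs (- d) ltac:(rewrite Rabs_Ropp; apply Rabs_pos_eq; lra)) as Hb'.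
    rewrite sin_neg in Hb'.
    assert (Hab : sin d * Rabs J <= X * d ^ 2).
    { unfold Rabs. destruct (Rcase_abs J); lra. }
    pose proof (Rabs_pos J).
    assert (d / 2 * Rabs J <= X * d ^ 2) by nra.
    apply Rmult_le_reg_l with (d / 2); [lra|]. lra. }
  destruct (Req_dec J 0) as [|HJ]; auto. exfalso.
  apply Rabs_pos_lt in HJ.
  set (d := Rmin (1 / 2) (Rabs J / (4 * (X + 1)))).
  assert (Hd : 0 < d) by (apply Rmin_glb_lt; [lra|apply Rdiv_lt_0_compat; lra]).
  pose proof (Rmin_l (1 / 2) (Rabs J / (4 * (X + 1)))) as Hl. fold d in Hl.
  pose proof (Rmin_r (1 / 2) (Rabs J / (4 * (X + 1)))) as Hr. fold d in Hr.
  specialize (H d ltac:(lra)).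
  assert (d * (4 * (X + 1)) <= Rabs J).
  { apply Rle_trans with (Rabs J / (4 * (X + 1)) * (4 * (X + 1))); [apply Rmult_le_compat_r; lra|right; field; lra]. }
  nra.
Qed.

(** Since [|be - al|^2 = 2 (1 - Re e)], the formula without its odd term says that [qb] is the part
    of [phi T] due to an atom of unit weight. The multiplied form remains valid at the atom
    itself. *)
Lemma qb_eq a n al be : Cmod al = 1 -> Cmod be = 1 ->
  (forall be, Cmod be = 1 -> 0 <= Tb a n be) -> Tb a n al = 0 ->
  Cmod (be - al)%C ^ 2 * qb a n al be = 2 * Tb a n be.
Proof.
  intros Hal Hbe Hpos H0.
  assert (Hal0 : al <> RtoC 0) by (intros E; rewrite E, Cmod_0 in Hal; lra).
  set (e := (be / al)%C).
  assert (Ee : be = (al * e)%C) by (unfold e; field; auto).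
  assert (He : Cmod e = 1) by (unfold e; rewrite Cmod_div, Hal, Hbe by auto; field).
  destruct (classic (e = RtoC 1)) as [E|E].
  - rewrite E, Cmult_1_r in Ee. rewrite Ee, H0.
    replace (al - al)%C with (RtoC 0) by ring. rewrite Cmod_0. ring.
  - pose proof (qb_formula a n al e Hal He E) as F. rewrite <- Ee, H0, koebe_pairing_real in F by auto.
    assert (Em : Cmod (be - al)%C ^ 2 = 2 * (1 - Re e)).
    { replace (be - al)%C with (al * (e - 1))%C by (rewrite Ee; ring).
      rewrite Cmod_mult, Hal, Rmult_1_l, Cmod_sqr, Re_minus, Im_minus, Re_RtoC, Im_RtoC.
      apply Cmod_1_components in He. nra. }
    rewrite Em. lra.
Qed.

Lemma quad_hcoef k z : quad (fun be => hcoef be k) z.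
Proof.
  destruct k; cbn [hcoef]; [apply quad_const|]. apply quad_scal, quad_pow, quad_id.
Qed.

(** Off the atom the sign follows from [qb_eq]; at the atom that identity reads [0 = 0], and
    continuity along the circle is used instead. *)
Lemma qb_nonneg a n al be : Cmod al = 1 -> Cmod be = 1 ->
  (forall be, Cmod be = 1 -> 0 <= Tb a n be) -> Tb a n al = 0 ->
  0 <= qb a n al be.
Proof.
  intros Hal Hbe Hpos H0.
  assert (Hne : forall be, Cmod be = 1 -> be <> al -> 0 <= qb a n al be).
  { clear be Hbe. intros be Hbe Hne. pose proof (qb_eq a n al be Hal Hbe Hpos H0) as E.
    specialize (Hpos be Hbe).
    assert (0 < Cmod (be - al)%C ^ 2).
    { apply pow_lt, Cmod_gt_0. intros E0. apply Hne. replace be with (be - al + al)%C by ring. rewrite E0; ring. }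
    apply Rnot_lt_le. intros Hlt. nra. }
  destruct (classic (be = al)) as [->|]; [|auto].
  apply Rnot_lt_le. intros Hlt.
  assert (Hq : quad (fun be => pairing a n (conv (koebe_coef al) (hcoef be))) al).
  { apply quad_zsum. intros k _. apply quad_scal. apply quad_zsum. intros j _. apply quad_scal, quad_hcoef. }
  destruct (quad_ccont _ _ Hq (- qb a n al al) ltac:(lra)) as (d & Hd & Hc).
  set (t := Rmin (1 / 2) (d / 4)).
  assert (Ht : 0 < t) by (apply Rmin_glb_lt; lra).
  pose proof (Rmin_l (1 / 2) (d / 4)). pose proof (Rmin_r (1 / 2) (d / 4)). fold t in H, H1.
  destruct (cis_small t ltac:(lra)) as (_ & H2 & H3).
  specialize (Hc (al * cis t)%C).
  assert (Hdist : Cmod (al * cis t - al)%C = Cmod (cis t - 1)%C).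
  { replace (al * cis t - al)%C with (al * (cis t - 1))%C by ring. rewrite Cmod_mult, Hal. ring. }
  specialize (Hc ltac:(rewrite Hdist; lra)).
  assert (Hu : Cmod (al * cis t)%C = 1) by (rewrite Cmod_mult, Hal, Cmod_cis; ring).
  assert (Hn : (al * cis t)%C <> al).
  { intros E. rewrite E in Hdist. replace (al - al)%C with (RtoC 0) in Hdist by ring.
    rewrite Cmod_0 in Hdist. symmetry in Hdist. apply Cmod_eq_0 in Hdist.
    apply (f_equal Re) in Hdist. rewrite Re_minus, Re_cis, !Re_RtoC in Hdist. lra. }
  specialize (Hne _ Hu Hn).
  pose proof (re_le_Cmod (pairing a n (conv (koebe_coef al) (hcoef (al * cis t))) -
     pairing a n (conv (koebe_coef al) (hcoef al)))%C) as Hr.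
  rewrite Re_minus in Hr. fold (qb a n al (al * cis t)) (qb a n al al) in Hr.
  apply Rabs_le_between in Hr. lra.
Qed.

(** Weighting [a_k] by [k] puts the factor [n - k] on the frequency [k] of [T], so this is
    [n T - |D| T]. *)
Definition Sb (a : nat -> C) (n : nat) (be : C) : R :=
  Re (pairing (fun k => RtoC (INR k) * a k)%C n (hcoef be)).

(** By [ed_rec] the numbers [k a_k] are the coefficients of [Phi f]. Associativity of convolution,
    in the form of a reordered triangular double sum, moves [Phi] from [a] onto [hcoef be], where it
    splits into atoms. *)
Lemma Sb_decomposition n f N lam alpha a be : extremal_data n f N lam alpha a ->
  Sb a n be = rsum (fun i => lam i * qb a n (alpha i) be) N.
Proof.
  intros E. pose proof (ed_rec E) as Hrec.
  set (Phi := fun j => zsum (fun i => RtoC (lam i) * koebe_coef (alpha i) j)%C N).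
  assert (Hconv : forall m, (RtoC (INR m) * a m)%C = zsum (fun j => Phi j * a (m - j)%nat)%C (S m)).
  { intros m. rewrite zsum_head.
    assert (H0 : Phi O = RtoC 0).
    { unfold Phi, koebe_coef. apply zsum_0. intros i _. simpl. ring. }
    rewrite H0. destruct m as [|m].
    - simpl. ring.
    - rewrite Hrec. rewrite Cmult_0_l, Cplus_0_l. apply zsum_ext. intros j Hj.
      replace (S m - S j)%nat with (m - j)%nat by lia. f_equal.
      unfold Phi, atom_coef. rewrite <- zsum_opp, <- zsum_mult_l. apply zsum_ext. intros i _.
      unfold koebe_coef. cbn [hcoef]. ring. }
  assert (Hp : pairing (fun k => RtoC (INR k) * a k)%C n (hcoef be) = pairing a n (conv Phi (hcoef be))).
  { transitivity (zsum (fun k => zsum (fun j => a (n - (k + j))%nat * (hcoef be k * Phi j)) (S n - k)) (S n))%C.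
    - unfold pairing. apply zsum_ext. intros k Hk. rewrite Hconv, Cmult_comm, <- zsum_mult_l.
      replace (S (n - k)) with (S n - k)%nat by lia. apply zsum_ext. intros j Hj.
      replace (n - k - j)%nat with (n - (k + j))%nat by lia. ring.
    - rewrite (zsum_ext _ (fun k => zsum (fun i => (fun m j => a (n - m)%nat * (hcoef be j * Phi (m - j)%nat))%C (k + i)%nat k) (S n - k))).
      + rewrite <- (zsum_triangle (fun m j => a (n - m)%nat * (hcoef be j * Phi (m - j)%nat))%C).
        unfold pairing. apply zsum_ext. intros m Hm. rewrite zsum_mult_l. f_equal.
        unfold conv. rewrite zsum_rev. apply zsum_ext. intros j Hj.
        replace (S m - 1 - j)%nat with (m - j)%nat by lia. replace (m - (m - j))%nat with j by lia. ring.
      + intros k Hk. apply zsum_ext. intros i Hi. cbv beta. replace (k + i - k)%nat with i by lia. reflexivity. }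
  unfold Sb. rewrite Hp.
  rewrite (pairing_ext a n _ (fun k => zsum (fun i => RtoC (lam i) * conv (koebe_coef (alpha i)) (hcoef be) k)%C N)).
  - rewrite pairing_zsum, Re_zsum. apply rsum_ext. intros i _. rewrite pairing_scal, Re_scal. reflexivity.
  - intros k _. unfold conv. 
    rewrite (zsum_ext (fun i => RtoC (lam i) * zsum (fun j => koebe_coef (alpha i) j * hcoef be (k - j)%nat) (S k))%C
       (fun i => zsum (fun j => RtoC (lam i) * (koebe_coef (alpha i) j * hcoef be (k - j)%nat)) (S k))%C)
      by (intros; symmetry; apply zsum_mult_l).
    rewrite (zsum_swap (fun i j => RtoC (lam i) * (koebe_coef (alpha i) j * hcoef be (k - j)%nat))%C).
    apply zsum_ext. intros j _. unfold Phi. rewrite Cmult_comm, <- zsum_mult_l. apply zsum_ext. intros; ring.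
Qed.

(** * Means over the circle and harmonic extensions *)

Definition cts (u : R -> R) : Prop := forall t : R, continuous u t.

Definition mean (u : R -> R) : R := RInt u 0 (2 * PI) / (2 * PI).

Lemma two_PI_pos : 0 < 2 * PI.
Proof. pose proof PI_RGT_0. lra. Qed.

Lemma cts_ex_RInt u a b : cts u -> ex_RInt u a b.
Proof. intros H. apply (@ex_RInt_continuous R_CompleteNormedModule). intros; apply H. Qed.

Lemma cts_plus u v : cts u -> cts v -> cts (fun t => u t + v t).
Proof. intros Hu Hv t. apply (@continuous_plus R_UniformSpace R_AbsRing R_NormedModule); auto. Qed.

Lemma cts_mult u v : cts u -> cts v -> cts (fun t => u t * v t).
Proof. intros Hu Hv t. apply (@continuous_mult R_UniformSpace R_AbsRing); auto. Qed.

Lemma cts_const c : cts (fun _ => c).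
Proof. intros t. apply continuous_const. Qed.

Lemma cts_minus u v : cts u -> cts v -> cts (fun t => u t - v t).
Proof. intros Hu Hv t. apply (@continuous_minus R_UniformSpace R_AbsRing R_NormedModule); auto. Qed.

Lemma cts_inv u : cts u -> (forall t, u t <> 0) -> cts (fun t => / u t).
Proof. intros Hu Hn t. apply continuous_comp; auto. apply continuous_Rinv; auto. Qed.

Lemma cts_div u v : cts u -> cts v -> (forall t, v t <> 0) -> cts (fun t => u t / v t).
Proof. intros. apply cts_mult; auto. apply cts_inv; auto. Qed.

Lemma cts_rsum (u : nat -> R -> R) n : (forall k, (k < n)%nat -> cts (u k)) ->
  cts (fun t => rsum (fun k => u k t) n).
Proof.
  induction n; intros H; cbn [rsum]; [apply cts_const|].
  apply cts_plus; [apply IHn; intros; apply H; lia|apply H; lia].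
Qed.

Lemma cts_ext u v : (forall t, u t = v t) -> cts u -> cts v.
Proof. intros E H t. apply (continuous_ext u); auto. Qed.

Lemma cts_derive u : (forall t, ex_derive u t) -> cts u.
Proof. intros H t. apply (@ex_derive_continuous R_AbsRing R_NormedModule). apply H. Qed.

Lemma cts_Re_cis (e : C) l : cts (fun t => Re (e * cis (l * t))%C).
Proof.
  apply (cts_ext (fun t => Re e * cos (l * t) - Im e * sin (l * t))).
  - intros t. rewrite Re_mult, Re_cis, Im_cis. reflexivity.
  - apply cts_derive. intros t. auto_derive. auto.
Qed.

Lemma cts_dist2 z : cts (fun t => Cmod (cis t - z)%C ^ 2).
Proof.
  apply (cts_ext (fun t => (cos t - Re z) ^ 2 + (sin t - Im z) ^ 2)).
  - intros t. rewrite Cmod_sqr, Re_minus, Im_minus, Re_cis, Im_cis. reflexivity.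
  - apply cts_derive. intros t. auto_derive. auto.
Qed.

Lemma mean_ext u v : (forall t, u t = v t) -> mean u = mean v.
Proof. intros E. unfold mean. f_equal. apply RInt_ext. intros; apply E. Qed.

Lemma mean_plus u v : cts u -> cts v -> mean (fun t => u t + v t) = mean u + mean v.
Proof.
  intros Hu Hv. unfold mean.
  rewrite (@RInt_plus R_CompleteNormedModule u v) by (apply cts_ex_RInt; auto).
  unfold plus; simpl. field. pose proof PI_RGT_0; lra.
Qed.

Lemma mean_scal c u : cts u -> mean (fun t => c * u t) = c * mean u.
Proof.
  intros Hu. unfold mean.
  rewrite (@RInt_scal R_CompleteNormedModule u) by (apply cts_ex_RInt; auto).
  unfold scal; simpl. unfold mult; simpl. field. pose proof PI_RGT_0; lra.
Qed.

Lemma mean_minus u v : cts u -> cts v -> mean (fun t => u t - v t) = mean u - mean v.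
Proof.
  intros Hu Hv. rewrite (mean_ext _ (fun t => u t + (-1) * v t)) by (intros; ring).
  rewrite mean_plus, mean_scal; auto; [ring|]. apply cts_mult; auto. apply cts_const.
Qed.

Lemma mean_const c : mean (fun _ => c) = c.
Proof.
  unfold mean. rewrite RInt_const. unfold scal; simpl. unfold mult; simpl. field.
  pose proof PI_RGT_0; lra.
Qed.

Lemma mean_le u v : cts u -> cts v -> (forall t, u t <= v t) -> mean u <= mean v.
Proof.
  intros Hu Hv H. unfold mean. apply Rmult_le_compat_r.
  - apply Rlt_le, Rinv_0_lt_compat, two_PI_pos.
  - apply RInt_le; try (apply cts_ex_RInt; auto); auto. pose proof two_PI_pos; lra.
Qed.

Lemma mean_ge_0 u : cts u -> (forall t, 0 <= u t) -> 0 <= mean u.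
Proof. intros Hu H. rewrite <- (mean_const 0). apply mean_le; auto. apply cts_const. Qed.

Lemma mean_abs_le u v : cts u -> cts v -> (forall t, Rabs (u t) <= v t) -> Rabs (mean u) <= mean v.
Proof.
  intros Hu Hv H. apply Rabs_le. split.
  - replace (- mean v) with (mean (fun t => (-1) * v t)) by (rewrite mean_scal; auto; ring).
    apply mean_le; auto; [apply cts_mult; auto; apply cts_const|].
    intros t. specialize (H t). apply Rabs_le_between in H. lra.
  - apply mean_le; auto. intros t. specialize (H t). apply Rabs_le_between in H. lra.
Qed.

Lemma mean_rsum (u : nat -> R -> R) n : (forall k, (k < n)%nat -> cts (u k)) ->
  mean (fun t => rsum (fun k => u k t) n) = rsum (fun k => mean (u k)) n.
Proof.
  induction n; intros H; cbn [rsum]; [apply mean_const|].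
  rewrite mean_plus; [|apply cts_rsum; intros; apply H; lia|apply H; lia].
  rewrite IHn by (intros; apply H; lia). reflexivity.
Qed.

Lemma cis_2PI_pow k : cis (INR k * (2 * PI)) = RtoC 1.
Proof.
  rewrite <- cis_pow. replace (cis (2 * PI)) with (RtoC 1); [apply Cpow_1_l|].
  unfold cis. rewrite cos_2PI, sin_2PI. reflexivity.
Qed.

Lemma mean_cis (e : C) k j :
  mean (fun t => Re (e * cis ((INR k - INR j) * t))%C) = if Nat.eqb k j then Re e else 0.
Proof.
  destruct (Nat.eqb_spec k j) as [->|Hkj].
  - rewrite <- (mean_const (Re e)). apply mean_ext. intros t. rewrite Rminus_diag, Rmult_0_l, cis_0.
    f_equal; ring.
  - set (l := INR k - INR j).
    assert (Hl : l <> 0).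
    { unfold l. intros E. apply Hkj. apply INR_eq. lra. }
    assert (Hper : cis (l * (2 * PI)) = RtoC 1).
    { unfold l. replace ((INR k - INR j) * (2 * PI)) with (INR k * (2 * PI) + - (INR j * (2 * PI))) by ring.
      rewrite cis_plus, <- cis_conj, !cis_2PI_pow. apply C_eq; unfold Re, Im; simpl; ring. }
    pose proof (f_equal Re Hper) as Hc. pose proof (f_equal Im Hper) as Hs.
    rewrite Re_cis, Re_RtoC in Hc. rewrite Im_cis, Im_RtoC in Hs.
    unfold mean. apply Rmult_eq_0_compat_r.
    apply is_RInt_unique.
    set (g := fun t => (Re e * sin (l * t) + Im e * cos (l * t)) / l).
    replace 0 with (g (2 * PI) - g 0) at 2.
    + apply (@is_RInt_derive R_CompleteNormedModule g).
      * intros t _. unfold g. auto_derive; auto. rewrite Re_mult, Re_cis, Im_cis. field. auto.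
      * intros t _. apply cts_Re_cis.
    + unfold g. rewrite Rmult_0_r, sin_0, cos_0, Hc, Hs. field. auto.
Qed.

Lemma Re_mult_Re (A B : C) : Re A * Re B = / 2 * Re (A * B)%C + / 2 * Re (A * Cconj B)%C.
Proof. rewrite !Re_mult, re_conj, im_conj. field. Qed.

Lemma cts_Re_pow (c : C) k : cts (fun t => Re (c * cis t ^ k)%C).
Proof.
  apply (cts_ext (fun t => Re (c * cis (INR k * t))%C)).
  - intros t. rewrite cis_pow. reflexivity.
  - apply cts_Re_cis.
Qed.

(** Product to sum: the frequencies are [k - j] and [k + j]. The first survives for [j = k]; the
    second only for [k = j = 0], where it makes up for the factor 2 that [hcoef] lacks at index
    0. *)
Lemma mean_poisson_term (c z : C) k j :
  mean (fun t => Re (c * cis t ^ k)%C * Re (hcoef (Cconj (cis t)) j * z ^ j)%C) =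
  if Nat.eqb j k then Re (c * z ^ k)%C else 0.
Proof.
  set (d := match j with O => RtoC 1 | _ => RtoC 2 end).
  assert (Eh : forall t, (hcoef (Cconj (cis t)) j * z ^ j)%C = (d * z ^ j * cis (- INR j * t))%C).
  { intros t. rewrite cis_conj. unfold d. destruct j.
    - simpl. rewrite Ropp_0, Rmult_0_l, cis_0. ring.
    - cbn [hcoef]. rewrite cis_pow. replace (INR (S j) * - t) with (- INR (S j) * t) by ring. ring. }
  assert (Ei : forall t, Re (c * cis t ^ k)%C * Re (hcoef (Cconj (cis t)) j * z ^ j)%C =
    / 2 * Re (c * (d * z ^ j) * cis ((INR k - INR j) * t))%C +
    / 2 * Re (c * Cconj (d * z ^ j) * cis ((INR (k + j) - INR 0) * t))%C).
  { intros t. rewrite Eh, Re_mult_Re. rewrite !cis_pow. f_equal; f_equal; f_equal.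
    - replace ((INR k - INR j) * t) with (INR k * t + - INR j * t) by ring. rewrite cis_plus. ring.
    - rewrite Cmult_conj, cis_conj. rewrite plus_INR. simpl (INR 0).
      replace ((INR k + INR j - 0) * t) with (INR k * t + - (- INR j * t)) by ring. rewrite cis_plus. ring. }
  rewrite (mean_ext _ _ Ei).
  rewrite mean_plus by (apply cts_mult; [apply cts_const|apply cts_Re_cis]).
  rewrite !mean_scal by apply cts_Re_cis. rewrite !mean_cis.
  rewrite (Nat.eqb_sym j k).
  destruct (Nat.eqb_spec k j) as [->|Hkj].
  - destruct (Nat.eqb_spec (j + j) 0) as [H0|H0].
    + assert (j = 0)%nat by lia. subst j. unfold d. simpl Cpow.
      rewrite !Re_mult, ?re_conj, ?im_conj, ?Im_mult. simpl. field.
    + destruct j; [lia|]. unfold d.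
      replace (c * (2 * z ^ S j))%C with (RtoC 2 * (c * z ^ S j))%C by ring. rewrite Re_scal. field.
  - destruct (Nat.eqb_spec (k + j) 0) as [H0|H0]; [lia|]. ring.
Qed.

(** * Poisson integrals of trigonometric polynomials *)

Definition poisson (z : C) (t : R) : R := (1 - Cmod z ^ 2) / Cmod (cis t - z)%C ^ 2.

Lemma Cmod_1_sub_conj z t : Cmod (1 - Cconj (cis t) * z)%C = Cmod (cis t - z)%C.
Proof.
  rewrite <- (Cmod_mul_unit (cis t) (1 - Cconj (cis t) * z)%C) by apply Cmod_cis. f_equal.
  replace (cis t * (1 - Cconj (cis t) * z))%C with (cis t - cis t * Cconj (cis t) * z)%C by ring.
  rewrite <- Cmod2_conj, Cmod_cis. simpl. rewrite !Rmult_1_l. ring.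
Qed.

Lemma dist_circle_pos z t : Cmod z < 1 -> 0 < 1 - Cmod z <= Cmod (cis t - z)%C.
Proof.
  intros Hz. pose proof (Cmod_triangle_inv (cis t) z). rewrite Cmod_cis in H. lra.
Qed.

Lemma poisson_herg z t : Cmod z < 1 -> poisson z t = Re (herg (Cconj (cis t)) z).
Proof.
  intros Hz. rewrite Re_herg; auto; [|rewrite Cmod_conj; apply Cmod_cis].
  rewrite Cmod_1_sub_conj. reflexivity.
Qed.

Lemma cts_poisson z : Cmod z < 1 -> cts (poisson z).
Proof.
  intros Hz. unfold poisson. apply cts_div; [apply cts_const|apply cts_dist2|].
  intros t. pose proof (dist_circle_pos z t Hz). apply pow_nonzero. lra.
Qed.

Lemma poisson_pos z t : Cmod z < 1 -> 0 < poisson z t.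
Proof.
  intros Hz. pose proof (dist_circle_pos z t Hz). pose proof (Cmod_ge_0 z).
  apply Rdiv_lt_0_compat; [nra|]. apply pow_lt; lra.
Qed.

Lemma rsum_single (f : nat -> R) (x : R) k n : (k < n)%nat ->
  (forall j, (j < n)%nat -> f j = if Nat.eqb j k then x else 0) -> rsum f n = x.
Proof.
  intros Hk Hf.
  assert (H : forall m, (m <= n)%nat -> rsum f m = if Nat.leb m k then 0 else x).
  { induction m; intros Hm; [reflexivity|]. cbn [rsum]. rewrite IHm, Hf by lia.
    destruct (Nat.leb_spec m k), (Nat.leb_spec (S m) k), (Nat.eqb_spec m k); try lia; ring. }
  rewrite H by lia. destruct (Nat.leb_spec n k); [lia|reflexivity].
Qed.

(** The Herglotz series of the Poisson kernel, cut after index [J], is integrated term by term; the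
    tail is at most [2 r^(J+1) / (1 - r)] uniformly on the circle. A nonzero discrepancy [x] would
    exceed this for large [J]. *)
Lemma mean_poisson_monomial (c z : C) k : Cmod z < 1 ->
  mean (fun t => Re (c * cis t ^ k)%C * poisson z t) = Re (c * z ^ k)%C.
Proof.
  intros Hz. set (r := Cmod z) in *. assert (Hr : 0 <= r) by apply Cmod_ge_0.
  pose proof (Cmod_ge_0 c) as Hc.
  apply Rminus_diag_uniq. apply NNPP. intros Hne. apply Rabs_pos_lt in Hne.
  set (x := mean (fun t => Re (c * cis t ^ k)%C * poisson z t) - Re (c * z ^ k)%C) in *.
  assert (HJ : forall J, (k < S J)%nat -> Rabs x <= Cmod c * (2 / (1 - r)) * r ^ S J).
  { intros J HkJ.
    set (KJ := fun t => rsum (fun j => Re (hcoef (Cconj (cis t)) j * z ^ j)%C) (S J)).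
    assert (Hcts : forall j, cts (fun t => Re (hcoef (Cconj (cis t)) j * z ^ j)%C)).
    { intros j. destruct j.
      - cbn [hcoef]. apply cts_const.
      - apply (cts_ext (fun t => Re ((2 * z ^ S j) * cis (- INR (S j) * t))%C)); [|apply cts_Re_cis].
        intros t. cbn [hcoef]. rewrite cis_conj, cis_pow.
        replace (INR (S j) * - t) with (- INR (S j) * t) by ring. f_equal; ring. }
    assert (E1 : mean (fun t => Re (c * cis t ^ k)%C * KJ t) = Re (c * z ^ k)%C).
    { rewrite (mean_ext _ (fun t => rsum (fun j => Re (c * cis t ^ k)%C * Re (hcoef (Cconj (cis t)) j * z ^ j)%C) (S J))).
      - rewrite (mean_rsum (fun j t => Re (c * cis t ^ k)%C * Re (hcoef (Cconj (cis t)) j * z ^ j)%C)).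
        + apply (rsum_single _ _ k); auto. intros j _. apply mean_poisson_term.
        + intros j _. apply cts_mult; auto. apply cts_Re_pow.
      - intros t. unfold KJ. rewrite rsum_scal. reflexivity. }
    assert (HKJ : cts KJ) by (apply cts_rsum; auto).
    unfold x. rewrite <- E1, <- mean_minus.
    2:{ apply cts_mult; [apply cts_Re_pow|apply cts_poisson; auto]. }
    2:{ apply cts_mult; [apply cts_Re_pow|auto]. }
    rewrite <- (mean_const (Cmod c * (2 / (1 - r)) * r ^ S J)). apply mean_abs_le.
    - apply cts_minus; apply cts_mult; auto; try apply cts_Re_pow. apply cts_poisson; auto.
    - apply cts_const.
    - intros t. rewrite <- Rmult_minus_distr_l, Rabs_mult, Rmult_assoc.
      apply Rmult_le_compat; try apply Rabs_pos.
      + eapply Rle_trans; [apply re_le_Cmod|]. rewrite Cmod_mult, Cmod_pow, Cmod_cis, pow1. lra.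
      + unfold KJ. rewrite <- Re_zsum.
        assert (Hm : Cmod (Cconj (cis t)) = 1) by (rewrite Cmod_conj; apply Cmod_cis).
        rewrite hcoef_sum by (rewrite Cmod_mul_unit; auto).
        rewrite poisson_herg by auto. rewrite <- Re_minus.
        eapply Rle_trans; [apply re_le_Cmod|].
        match goal with |- Cmod ?A <= _ => replace A with (2 * (Cconj (cis t) * z) ^ S J / (1 - Cconj (cis t) * z))%C by ring end.
        rewrite Cmod_div by (apply unit_one_minus_nz; auto).
        rewrite Cmod_1_sub_conj, (Cmod_mult 2), Cmod_pow, Cmod_mul_unit, Cmod_RtoC_pos by (auto; lra).
        fold r. pose proof (dist_circle_pos z t Hz) as Hd. fold r in Hd.
        unfold Rdiv. rewrite Rmult_assoc, (Rmult_comm (r ^ S J)), <- Rmult_assoc.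
        apply Rmult_le_compat_r; [apply pow_le; auto|]. apply Rmult_le_compat_l; [lra|].
        apply Rinv_le_contravar; lra. }
  set (A := Cmod c * (2 / (1 - r))) in *.
  assert (HA : 0 <= A).
  { apply Rmult_le_pos; auto. apply Rlt_le, Rdiv_lt_0_compat; lra. }
  destruct (pow_lt_1_zero r ltac:(rewrite Rabs_pos_eq; auto) (Rabs x / (A + 1))) as (N0 & HN0).
  { apply Rdiv_lt_0_compat; lra. }
  specialize (HJ (Nat.max k N0) ltac:(lia)).
  specialize (HN0 (S (Nat.max k N0)) ltac:(lia)).
  rewrite Rabs_pos_eq in HN0 by (apply pow_le; auto).
  assert (Hp : 0 <= r ^ S (Nat.max k N0)) by (apply pow_le; auto).
  set (p := r ^ S (Nat.max k N0)) in *.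
  assert (p * (A + 1) < Rabs x).
  { apply Rlt_le_trans with (Rabs x / (A + 1) * (A + 1)); [apply Rmult_lt_compat_r; lra|right; field; lra]. }
  nra.
Qed.

(** [g] is analytic with the harmonic extension of [u] as its real part; the imaginary part is left
    free. [quad] can be asked on the whole plane because it is applied to trigonometric polynomials
    [u], for which [g] is a polynomial. *)
Definition completion (u : R -> R) (g : C -> C) : Prop :=
  cts u /\ (forall z, quad g z) /\
  forall z, Cmod z < 1 -> mean (fun t => u t * poisson z t) = Re (g z).

Lemma completion_monomial c k : completion (fun t => Re (c * cis t ^ k)%C) (fun z => c * z ^ k)%C.
Proof.
  repeat split.
  - apply cts_Re_pow.
  - intros z. apply quad_scal, quad_pow, quad_id.
  - intros z Hz. apply mean_poisson_monomial; auto.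
Qed.

Lemma completion_plus u v g h : completion u g -> completion v h ->
  completion (fun t => u t + v t) (fun z => g z + h z)%C.
Proof.
  intros (Cu & Qg & Mg) (Cv & Qh & Mh). repeat split.
  - apply cts_plus; auto.
  - intros z. apply quad_plus; auto.
  - intros z Hz. rewrite Re_plus, <- Mg, <- Mh by auto.
    rewrite <- mean_plus by (apply cts_mult; auto; apply cts_poisson; auto).
    apply mean_ext. intros; ring.
Qed.

Lemma completion_scal x u g : completion u g -> completion (fun t => x * u t) (fun z => RtoC x * g z)%C.
Proof.
  intros (Cu & Qg & Mg). repeat split.
  - apply cts_mult; auto. apply cts_const.
  - intros z. apply quad_scal; auto.
  - intros z Hz. rewrite Re_scal, <- Mg by auto.
    rewrite <- mean_scal by (apply cts_mult; auto; apply cts_poisson; auto).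
    apply mean_ext. intros; ring.
Qed.

Lemma completion_ext u v g h : (forall t, u t = v t) -> (forall z, g z = h z) ->
  completion u g -> completion v h.
Proof.
  intros E E' (Cu & Qg & Mg). repeat split.
  - apply (cts_ext u); auto.
  - intros z. apply (quad_ext g); auto.
  - intros z Hz. rewrite <- E', <- Mg by auto. apply mean_ext. intros; rewrite E; ring.
Qed.

Lemma completion_sum (u : nat -> R -> R) (g : nat -> C -> C) n :
  (forall k, (k < n)%nat -> completion (u k) (g k)) ->
  completion (fun t => rsum (fun k => u k t) n) (fun z => zsum (fun k => g k z) n).
Proof.
  induction n; intros H; cbn [rsum zsum].
  - apply (completion_ext (fun t => Re (RtoC 0 * cis t ^ 0)%C) _ (fun z => RtoC 0 * z ^ 0)%C).
    + intros t. rewrite Re_scal. ring.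
    + intros z. ring.
    + apply completion_monomial.
  - apply completion_plus; [apply IHn; intros; apply H; lia|apply H; lia].
Qed.

Lemma completion_poly (c : nat -> C) n :
  completion (fun t => Re (zsum (fun k => c k * cis t ^ k) n)%C) (fun z => zsum (fun k => c k * z ^ k) n)%C.
Proof.
  apply (completion_ext (fun t => rsum (fun k => Re (c k * cis t ^ k)%C) n) _ (fun z => zsum (fun k => c k * z ^ k) n)%C).
  - intros t. rewrite Re_zsum. reflexivity.
  - reflexivity.
  - apply (completion_sum (fun k t => Re (c k * cis t ^ k)%C) (fun k z => c k * z ^ k)%C).
    intros k _. apply completion_monomial.
Qed.

(** The product has frequencies [k + j] and [k - j]. When [k - j] is negative the term is replaced
    by its conjugate, so that [g] contains nonnegative powers only. *)
Lemma completion_product_terms (c d : C) k j : exists g,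
  completion (fun t => Re (c * cis t ^ k)%C * Re (d * cis t ^ j)%C) g.
Proof.
  assert (E : forall t, Re (c * cis t ^ k)%C * Re (d * cis t ^ j)%C =
    / 2 * Re ((c * d) * cis t ^ (k + j))%C + / 2 * Re ((c * Cconj d) * cis ((INR k - INR j) * t))%C).
  { intros t. rewrite Re_mult_Re. f_equal; f_equal; f_equal.
    - rewrite Cpow_add_r. ring.
    - rewrite Cmult_conj, Cpow_conj, cis_conj, !cis_pow.
      replace ((INR k - INR j) * t) with (INR k * t + INR j * - t) by ring. rewrite cis_plus. ring. }
  destruct (Nat.le_gt_cases j k) as [H|H].
  - eexists. eapply completion_ext; [intros t; symmetry; apply E|intros; reflexivity|].
    apply completion_plus; apply completion_scal; [apply completion_monomial|].
    eapply completion_ext; [|intros; reflexivity|apply (completion_monomial (c * Cconj d)%C (k - j))].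
    intros t. cbv beta. rewrite cis_pow, minus_INR by lia. reflexivity.
  - eexists. eapply completion_ext; [intros t; symmetry; apply E|intros; reflexivity|].
    apply completion_plus; apply completion_scal; [apply completion_monomial|].
    eapply completion_ext; [|intros; reflexivity|apply (completion_monomial (Cconj (c * Cconj d))%C (j - k))].
    intros t. cbv beta. rewrite <- (re_conj (c * Cconj d * cis ((INR k - INR j) * t))%C), (Cmult_conj (c * Cconj d)%C), cis_conj.
    rewrite cis_pow, minus_INR by lia. do 3 f_equal. ring.
Qed.

Lemma completion_square (c : nat -> C) n : exists g,
  completion (fun t => Re (zsum (fun k => c k * cis t ^ k) n)%C ^ 2) g.
Proof.
  set (g := fun k j => proj1_sig (constructive_indefinite_description _ (completion_product_terms (c k) (c j) k j))).
  assert (Hg : forall k j, completion (fun t => Re (c k * cis t ^ k)%C * Re (c j * cis t ^ j)%C) (g k j)).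
  { intros k j. exact (proj2_sig (constructive_indefinite_description _ (completion_product_terms (c k) (c j) k j))). }
  exists (fun z => zsum (fun k => zsum (fun j => g k j z) n) n).
  eapply completion_ext; [|intros; reflexivity|].
  2:{ apply (completion_sum (fun k t => rsum (fun j => Re (c k * cis t ^ k)%C * Re (c j * cis t ^ j)%C) n)).
      intros k _. apply (completion_sum (fun j t => Re (c k * cis t ^ k)%C * Re (c j * cis t ^ j)%C) (fun j => g k j)).
      intros j _. apply Hg. }
  intros t. cbv beta. rewrite Re_zsum.
  set (s := rsum (fun k => Re (c k * cis t ^ k)%C) n).
  rewrite (rsum_ext _ (fun k => s * Re (c k * cis t ^ k)%C)).
  - rewrite rsum_scal. fold s. ring.
  - intros k _. rewrite rsum_scal. fold s. ring.
Qed.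

(** * Parseval's identity and Bessel's inequality *)

Lemma parseval (c : nat -> C) n :
  mean (fun t => Cmod (zsum (fun k => c k * cis t ^ k) n)%C ^ 2) = rsum (fun k => Cmod (c k) ^ 2) n.
Proof.
  rewrite (mean_ext _ (fun t => rsum (fun k => rsum (fun j => Re ((c k * Cconj (c j)) * cis ((INR k - INR j) * t))%C) n) n)).
  - rewrite (mean_rsum (fun k t => rsum (fun j => Re ((c k * Cconj (c j)) * cis ((INR k - INR j) * t))%C) n)).
    + apply rsum_ext. intros k Hk.
      rewrite (mean_rsum (fun j t => Re ((c k * Cconj (c j)) * cis ((INR k - INR j) * t))%C)) by (intros; apply cts_Re_cis).
      apply (rsum_single _ _ k); auto. intros j Hj. rewrite mean_cis, Nat.eqb_sym.
      destruct (Nat.eqb_spec j k) as [->|]; auto. rewrite <- Cmod2_conj, Re_RtoC. reflexivity.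
    + intros k _. apply cts_rsum. intros j _. apply cts_Re_cis.
  - intros t. set (s := zsum (fun k => c k * cis t ^ k)%C n).
    transitivity (Re (s * Cconj s)%C); [rewrite <- Cmod2_conj; reflexivity|].
    unfold s at 1. rewrite Cmult_comm, <- zsum_mult_l, Re_zsum. apply rsum_ext. intros k _.
    replace (Cconj s) with (zsum (fun j => Cconj (c j) * cis (- INR j * t))%C n).
    + rewrite Cmult_comm, <- zsum_mult_l, Re_zsum. apply rsum_ext. intros j _. f_equal.
      rewrite cis_pow. replace ((INR k - INR j) * t) with (INR k * t + - INR j * t) by ring.
      rewrite cis_plus. ring.
    + unfold s. clear. induction n; cbn [zsum].
      * apply C_eq; unfold Re, Im; simpl; ring.
      * rewrite Cplus_conj, IHn, Cmult_conj, Cpow_conj, cis_conj, cis_pow.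
        replace (INR n * - t) with (- INR n * t) by ring. reflexivity.
Qed.

Lemma cts_Cmod_poly_sqr (c : nat -> C) n : cts (fun t => Cmod (zsum (fun k => c k * cis t ^ k) n)%C ^ 2).
Proof.
  assert (Hc : forall c, cts (fun t => Re (zsum (fun k => c k * cis t ^ k) n)%C)) by (intros; apply completion_poly).
  apply (cts_ext (fun t => Re (zsum (fun k => c k * cis t ^ k) n)%C * Re (zsum (fun k => c k * cis t ^ k) n)%C +
     Re (zsum (fun k => (- Ci) * c k * cis t ^ k) n)%C * Re (zsum (fun k => (- Ci) * c k * cis t ^ k) n)%C)).
  - intros t. rewrite Cmod_sqr.
    rewrite (zsum_ext (fun k => (- Ci) * c k * cis t ^ k)%C (fun k => (- Ci) * (c k * cis t ^ k))%C) by (intros; ring).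
    rewrite zsum_mult_l, Re_mult. unfold Ci, Re, Im; simpl. ring.
  - apply cts_plus; apply cts_mult; apply Hc.
Qed.

(** Uniform convergence on a circle, by comparison with a geometric series of ratio [rho / r1] for
    an intermediate radius [r1]. *)
Lemma taylor_partial_sum f a rho delta : taylor_coeffs f a -> 0 <= rho < 1 -> 0 < delta ->
  exists J, forall m z, (J <= m)%nat -> Cmod z = rho ->
    Cmod (zsum (fun k => a k * z ^ k) m - f z)%C <= delta.
Proof.
  intros Hf Hr Hdel.
  set (r1 := (1 + rho) / 2).
  destruct (taylor_unit_radius _ _ Hf r1 ltac:(unfold r1; lra)) as (X & HX).
  set (q := rho / r1). 
  assert (Hq : 0 <= q < 1).
  { unfold q, r1. split; [apply Rmult_le_pos; [lra|apply Rlt_le, Rinv_0_lt_compat; lra]|].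
    apply Rmult_lt_reg_r with ((1 + rho) / 2); [lra|]. unfold Rdiv at 1. rewrite Rmult_assoc, Rinv_l by lra. lra. }
  assert (HX0 : 0 <= X) by (specialize (HX O); pose proof (Cmod_ge_0 (a O)); simpl in HX; lra).
  assert (Hterm : forall k z, Cmod z = rho -> Cmod (a k * z ^ k)%C <= X * q ^ k).
  { intros k z Hz. rewrite Cmod_mult, Cmod_pow, Hz.
    replace rho with (r1 * q) by (unfold q, r1; field; lra). rewrite Rpow_mult_distr, <- Rmult_assoc.
    apply Rmult_le_compat_r; [apply pow_le; lra|apply HX]. }
  assert (Htail : forall m i z, Cmod z = rho ->
    Cmod (zsum (fun k => a k * z ^ k) m - zsum (fun k => a k * z ^ k) (m + i))%C <= X * (q ^ m - q ^ (m + i)) / (1 - q)).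
  { intros m i z Hz. induction i.
    - rewrite Nat.add_0_r, !Rminus_diag. match goal with |- Cmod (?A - ?A)%C <= _ => replace (A - A)%C with (RtoC 0) by ring end.
      rewrite Cmod_0. unfold Rdiv. rewrite Rmult_0_r, Rmult_0_l. lra.
    - rewrite Nat.add_succ_r. cbn [zsum].
      match goal with |- Cmod (?A - (?B + ?D))%C <= _ => replace (A - (B + D))%C with ((A - B) + - D)%C by ring end.
      eapply Rle_trans; [apply Cmod_plus_le; [exact IHi|rewrite Cmod_opp; apply Hterm; auto]|].
      right. simpl. field. lra. }
  destruct (pow_lt_1_zero q ltac:(rewrite Rabs_pos_eq; lra) (delta * (1 - q) / (2 * (X + 1)))) as (J & HJ).
  { apply Rdiv_lt_0_compat; [apply Rmult_lt_0_compat|]; lra. }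
  exists J. intros m z Hm Hz.
  assert (Hin : inD z) by (unfold inD; lra).
  specialize (Hf z Hin). rewrite is_series_C_eps in Hf.
  destruct (Hf (delta / 2) ltac:(lra)) as (N & HN). specialize (HN (m + N)%nat ltac:(lia)).
  rewrite (zsum_ext _ (fun k => a k * z ^ k)%C) in HN by (intros; rewrite pow_n_Cpow; ring).
  specialize (Htail m (S N) z Hz). rewrite Nat.add_succ_r in Htail.
  specialize (HJ m ltac:(lia)). rewrite Rabs_pos_eq in HJ by (apply pow_le; lra).
  match goal with H : Cmod (?A - ?B)%C <= _, H' : Cmod (?B - ?D)%C < _ |- _ => replace (A - D)%C with ((A - B) + (B - D))%C by ring end.
  eapply Rle_trans; [apply Cmod_triangle|].
  assert (X * (q ^ m - q ^ S (m + N)) / (1 - q) <= delta / 2); [|lra].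
  assert (0 <= q ^ S (m + N)) by (apply pow_le; lra).
  apply Rmult_le_reg_r with (1 - q); [lra|]. unfold Rdiv at 1. rewrite Rmult_assoc, Rinv_l, Rmult_1_r by lra.
  apply Rle_trans with (X * q ^ m); [apply Rmult_le_compat_l; lra|].
  apply Rle_trans with (X * (delta * (1 - q) / (2 * (X + 1)))); [apply Rmult_le_compat_l; lra|].
  apply Rmult_le_reg_r with (2 * (X + 1)); [lra|].
  replace (X * (delta * (1 - q) / (2 * (X + 1))) * (2 * (X + 1))) with (X * (delta * (1 - q))) by (field; lra).
  assert (0 <= delta * (1 - q)) by (apply Rmult_le_pos; lra). nra.
Qed.

(** The constant 4 leaves room for two crude steps: on the circle of radius [rho] the partial sums
    are at most [7/5], so their squares are at most 2, and [rho^(2k) >= 1/2] for [k <= m] by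
    Bernoulli's inequality. *)
Lemma bessel f a m : taylor_coeffs f a -> (forall z, inD z -> Cmod (f z) <= 1) ->
  rsum (fun k => Cmod (a k) ^ 2) m <= 4.
Proof.
  intros Hf Hb.
  set (e := / (4 * (INR m + 1))). pose proof (pos_INR m).
  assert (He : 0 < e <= 1 / 4).
  { unfold e. split; [apply Rinv_0_lt_compat; lra|]. replace (1 / 4) with (/ 4) by field.
    apply Rinv_le_contravar; lra. }
  set (rho := 1 - e).
  assert (Hbern : forall k, 1 - INR k * e <= rho ^ k).
  { induction k; [simpl; lra|]. rewrite S_INR. simpl.
    assert (rho * (1 - INR k * e) <= rho * rho ^ k) by (apply Rmult_le_compat_l; [unfold rho; lra|auto]).
    pose proof (pos_INR k). unfold rho in *. nra. }
  destruct (taylor_partial_sum f a rho (2 / 5) Hf ltac:(unfold rho; lra) ltac:(lra)) as (J & HJ).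
  set (L := Nat.max J m).
  assert (Hpar : rsum (fun k => Cmod (a k * RtoC rho ^ k)%C ^ 2) L <= 2).
  { rewrite <- parseval. rewrite <- (mean_const 2). apply mean_le.
    - apply cts_Cmod_poly_sqr.
    - apply cts_const.
    - intros t. set (z := (RtoC rho * cis t)%C).
      assert (Hz : Cmod z = rho) by (unfold z; rewrite Cmod_mult, Cmod_cis, Cmod_RtoC_pos; unfold rho; lra).
      specialize (HJ L z ltac:(unfold L; lia) Hz).
      rewrite (zsum_ext _ (fun k => a k * z ^ k)%C) by (intros; unfold z; rewrite Cpow_mult_l; ring).
      specialize (Hb z ltac:(unfold inD; unfold rho in *; lra)).
      set (s := zsum (fun k => a k * z ^ k)%C L) in *.
      assert (Cmod s <= 7 / 5).
      { replace s with ((s - f z) + f z)%C by ring. eapply Rle_trans; [apply Cmod_triangle|]. lra. }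
      pose proof (Cmod_ge_0 s). nra. }
  assert (Hm : rsum (fun k => / 2 * Cmod (a k) ^ 2) m <= rsum (fun k => Cmod (a k * RtoC rho ^ k)%C ^ 2) m).
  { apply rsum_le. intros k Hk. rewrite Cmod_mult, Cmod_pow, Cmod_RtoC_pos by (unfold rho; lra).
    rewrite Rpow_mult_distr, Rmult_comm. apply Rmult_le_compat_l; [apply pow_le, Cmod_ge_0|].
    rewrite <- pow_mult. eapply Rle_trans; [|apply Hbern].
    rewrite mult_INR. simpl (INR 2). assert (INR k <= INR m) by (apply le_INR; lia).
    assert (e * (4 * (INR m + 1)) = 1) by (unfold e; field; lra). nra. }
  rewrite rsum_scal in Hm.
  assert (Hmono : forall i, rsum (fun k => Cmod (a k * RtoC rho ^ k)%C ^ 2) m <= rsum (fun k => Cmod (a k * RtoC rho ^ k)%C ^ 2) (m + i)).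
  { induction i; [rewrite Nat.add_0_r; lra|]. rewrite Nat.add_succ_r. cbn [rsum].
    pose proof (pow_le (Cmod (a (m + i)%nat * RtoC rho ^ (m + i))%C) 2 (Cmod_ge_0 _)). lra. }
  specialize (Hmono (L - m)%nat). replace (m + (L - m))%nat with L in Hmono by (unfold L; lia). lra.
Qed.

(** * Local mass of T and the size of Phi *)

(* On the circle T = Re G and S = Re GS = (z f'/f) T, where GS = nG - z G';
   lam i * q i is the contribution of the i-th atom to S. *)
Record setting (n N : nat) (lam : nat -> R) (alpha : nat -> C) (g : nat -> C)
    (G GS : C -> C) (T S : R -> R) (q : nat -> R -> R) : Prop := {
  st_lam : forall i, (i < N)%nat -> 0 < lam i;
  st_alpha : forall i, (i < N)%nat -> Cmod (alpha i) = 1;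
  st_G : forall z, G z = zsum (fun k => g k * z ^ k)%C (Datatypes.S n);
  st_GS : forall z, GS z = zsum (fun k => RtoC (INR n - INR k) * (g k * z ^ k))%C (Datatypes.S n);
  st_T : completion T G;
  st_S : completion S GS;
  st_T_pos : forall t, 0 <= T t;
  st_S_sum : forall t, S t = rsum (fun i => lam i * q i t) N;
  st_q_pos : forall i t, (i < N)%nat -> 0 <= q i t;
  st_q : forall i t, (i < N)%nat -> Cmod (1 - alpha i * cis t)%C ^ 2 * q i t = 2 * T t
}.
Arguments st_lam {n N lam alpha g G GS T S q} _.
Arguments st_alpha {n N lam alpha g G GS T S q} _.
Arguments st_G {n N lam alpha g G GS T S q} _.
Arguments st_GS {n N lam alpha g G GS T S q} _.
Arguments st_T {n N lam alpha g G GS T S q} _.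
Arguments st_S {n N lam alpha g G GS T S q} _.
Arguments st_T_pos {n N lam alpha g G GS T S q} _.
Arguments st_S_sum {n N lam alpha g G GS T S q} _.
Arguments st_q_pos {n N lam alpha g G GS T S q} _.
Arguments st_q {n N lam alpha g G GS T S q} _.

(** An upper bound for the increments suffices, since [x] may have either sign. This is what a
    Harnack inequality provides. *)
Lemma derivative_bound (h : R -> R) D K d : 0 < d -> is_derive h 1 D ->
  (forall x, Rabs x < d -> h (1 + x) - h 1 <= K * Rabs x) -> Rabs D <= K.
Proof.
  intros Hd HD Hh. apply is_derive_Reals in HD.
  apply Rnot_lt_le. intros Hlt.
  destruct (HD ((Rabs D - K) / 2) ltac:(lra)) as ([d' Hd'] & Hc). simpl in Hc.
  set (x0 := Rmin (d / 2) (d' / 2)).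
  assert (Hx0 : 0 < x0) by (apply Rmin_glb_lt; lra).
  pose proof (Rmin_l (d / 2) (d' / 2)). pose proof (Rmin_r (d / 2) (d' / 2)). fold x0 in H, H0.
  assert (Hone : forall x, Rabs x = x0 -> D * x <= (K + (Rabs D - K) / 2) * x0).
  { intros x Hx. assert (Hx' : x <> 0) by (intros ->; rewrite Rabs_R0 in Hx; lra).
    specialize (Hc x Hx' ltac:(lra)). specialize (Hh x ltac:(lra)).
    apply Rlt_le in Hc. apply (Rmult_le_compat_r (Rabs x)) in Hc; [|apply Rabs_pos].
    rewrite <- Rabs_mult in Hc.
    replace (((h (1 + x) - h 1) / x - D) * x) with (h (1 + x) - h 1 - D * x) in Hc by (field; auto).
    apply Rabs_le_between in Hc. rewrite Hx in *. lra. }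
  pose proof (Hone x0 (Rabs_pos_eq x0 ltac:(lra))).
  pose proof (Hone (- x0) ltac:(rewrite Rabs_Ropp; apply Rabs_pos_eq; lra)).
  assert (Rabs D * x0 <= (K + (Rabs D - K) / 2) * x0).
  { unfold Rabs at 1. destruct (Rcase_abs D); lra. }
  apply Rmult_le_reg_r in H3; lra.
Qed.

Lemma is_derive_real_poly (c : nat -> R) n :
  is_derive (fun t => rsum (fun k => c k * t ^ k) n) 1 (rsum (fun k => INR k * c k) n).
Proof.
  induction n; cbn [rsum].
  - apply (@is_derive_const R_AbsRing R_NormedModule).
  - apply (@is_derive_plus R_AbsRing R_NormedModule); auto.
    auto_derive; auto. rewrite pow1. ring.
Qed.

(** Harnack's inequality along a radius. With [y = |x| / (1 - |z|) <= 1/2], the numerator grows by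
    at most the factor [1 + 3 y] and the inverse squared distance by [(1 + 2 y)^2]; the product is
    at most [1 + 18 y]. *)
Lemma poisson_dilation z t x : Cmod z < 1 -> Rabs x <= (1 - Cmod z) / 2 ->
  Cmod (RtoC (1 + x) * z)%C < 1 /\
  poisson (RtoC (1 + x) * z)%C t <= (1 + 18 * Rabs x / (1 - Cmod z)) * poisson z t.
Proof.
  intros Hz Hx. set (r := Cmod z) in *. assert (Hr : 0 <= r) by apply Cmod_ge_0.
  set (s := 1 - r) in *. assert (Hs : 0 < s <= 1) by (unfold s; lra).
  pose proof (Rabs_pos x) as Hx0.
  assert (Hxx : - Rabs x <= x <= Rabs x) by (apply Rabs_le_between; lra).
  assert (Hmod : Cmod (RtoC (1 + x) * z)%C = (1 + x) * r).
  { rewrite Cmod_mult, Cmod_RtoC_pos; [reflexivity|]. lra. }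
  assert (Hlt : (1 + x) * r <= 1 - s / 2).
  { apply Rle_trans with ((1 + s / 2) * r); [apply Rmult_le_compat_r; lra|]. unfold s. nra. }
  rewrite Hmod. split; [lra|].
  unfold poisson. rewrite Hmod. fold r.
  pose proof (dist_circle_pos z t Hz) as Hd. fold r in Hd. fold s in Hd.
  set (d := Cmod (cis t - z)%C) in *.
  pose proof (Cmod_triangle_inv (cis t) (RtoC (1 + x) * z)%C) as Hd'. rewrite Cmod_cis, Hmod in Hd'.
  set (d' := Cmod (cis t - RtoC (1 + x) * z)%C) in *.
  assert (Hdd : d <= d' + Rabs x).
  { unfold d. replace (cis t - z)%C with ((cis t - RtoC (1 + x) * z) + RtoC x * z)%C by (rewrite RtoC_plus; ring).
    apply Cmod_plus_le; [unfold d'; lra|]. rewrite Cmod_mult, Cmod_R. fold r. nra. }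
  set (y := Rabs x / s).
  assert (Hy : Rabs x = y * s) by (unfold y; field; lra).
  assert (Hy0 : 0 <= y <= 1 / 2).
  { split; [apply Rmult_le_pos; [auto|apply Rlt_le, Rinv_0_lt_compat; lra]|].
    apply Rmult_le_reg_r with s; lra. }
  assert (Hd2 : d <= d' * (1 + 2 * y)) by nra.
  assert (Hnum : 1 - ((1 + x) * r) ^ 2 <= (1 - r ^ 2) * (1 + 3 * y)).
  { assert (s <= 1 - r ^ 2) by (unfold s; nra).
    assert (y * s <= y * (1 - r ^ 2)) by (apply Rmult_le_compat_l; lra).
    assert (r ^ 2 <= 1) by nra. assert (0 <= r ^ 2) by nra.
    replace (1 - ((1 + x) * r) ^ 2) with ((1 - r ^ 2) + r ^ 2 * (- x * (2 + x))) by ring.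
    assert (- x * (2 + x) <= 3 * Rabs x) by nra.
    assert (r ^ 2 * (- x * (2 + x)) <= 3 * Rabs x).
    { apply Rle_trans with (r ^ 2 * (3 * Rabs x)); [apply Rmult_le_compat_l; auto|]. nra. }
    lra. }
  assert (Hd'0 : 0 < d') by lra.
  assert (Hsq : d ^ 2 <= d' ^ 2 * (1 + 2 * y) ^ 2).
  { rewrite <- Rpow_mult_distr. apply pow_incr. lra. }
  assert (Hd2p : 0 < d ^ 2) by (apply pow_lt; lra).
  assert (Hd'2p : 0 < d' ^ 2) by (apply pow_lt; lra).
  replace (18 * Rabs x / s) with (18 * y) by (unfold y; field; lra).
  apply Rmult_le_reg_r with (d' ^ 2); auto.
  unfold Rdiv at 1. rewrite Rmult_assoc, Rinv_l, Rmult_1_r by lra.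
  apply Rmult_le_reg_r with (d ^ 2); auto.
  replace ((1 + 18 * y) * ((1 - r ^ 2) / d ^ 2) * d' ^ 2 * d ^ 2) with ((1 + 18 * y) * (1 - r ^ 2) * d' ^ 2) by (field; lra).
  assert (H1r : 0 <= 1 - r ^ 2) by (unfold s in *; nra).
  apply Rle_trans with ((1 - r ^ 2) * (1 + 3 * y) * (d' ^ 2 * (1 + 2 * y) ^ 2)).
  - apply Rle_trans with ((1 - r ^ 2) * (1 + 3 * y) * d ^ 2).
    + apply Rmult_le_compat_r; lra.
    + apply Rmult_le_compat_l; [|auto]. apply Rmult_le_pos; lra.
  - assert ((1 + 3 * y) * (1 + 2 * y) ^ 2 <= 1 + 18 * y).
    { assert (y ^ 2 <= y / 2) by nra. assert (y ^ 3 <= y / 4) by (simpl; nra). nra. }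
    replace ((1 - r ^ 2) * (1 + 3 * y) * (d' ^ 2 * (1 + 2 * y) ^ 2)) with
      (((1 - r ^ 2) * d' ^ 2) * ((1 + 3 * y) * (1 + 2 * y) ^ 2)) by ring.
    replace ((1 + 18 * y) * (1 - r ^ 2) * d' ^ 2) with (((1 - r ^ 2) * d' ^ 2) * (1 + 18 * y)) by ring.
    apply Rmult_le_compat_l; auto. apply Rmult_le_pos; lra.
Qed.

Lemma completion_mono u g v h z z' K : completion u g -> completion v h ->
  Cmod z < 1 -> Cmod z' < 1 ->
  (forall t, u t * poisson z t <= K * (v t * poisson z' t)) -> Re (g z) <= K * Re (h z').
Proof.
  intros (Cu & _ & Mu) (Cv & _ & Mv) Hz Hz' H. rewrite <- Mu, <- Mv by auto.
  rewrite <- mean_scal by (apply cts_mult; auto; apply cts_poisson; auto).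
  apply mean_le; auto.
  - apply cts_mult; auto; apply cts_poisson; auto.
  - apply cts_mult; [apply cts_const|]. apply cts_mult; auto; apply cts_poisson; auto.
Qed.

Lemma completion_ge_0 u g z : completion u g -> (forall t, 0 <= u t) -> Cmod z < 1 -> 0 <= Re (g z).
Proof.
  intros (Cu & _ & Mu) H Hz. rewrite <- Mu by auto. apply mean_ge_0.
  - apply cts_mult; auto; apply cts_poisson; auto.
  - intros t. apply Rmult_le_pos; auto. apply Rlt_le, poisson_pos; auto.
Qed.

(** [GS - n G = - z G'], and [Re (z G')] is the derivative of [Re G] under the dilation [z -> x z]
    at [x = 1]. Harnack's inequality for the nonnegative [T] bounds it by [Re G] over the distance
    to the circle. *)
Lemma harnack_derivative n N lam alpha g G GS T S q z :
  setting n N lam alpha g G GS T S q -> Cmod z < 1 ->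
  Rabs (Re (GS z) - INR n * Re (G z)) <= 18 * Re (G z) / (1 - Cmod z).
Proof.
  intros st Hz. set (s := 1 - Cmod z). assert (Hs : 0 < s) by (unfold s; lra).
  set (h := fun x => Re (G (RtoC x * z)%C)).
  assert (Hh : forall x, h x = rsum (fun k => Re (g k * z ^ k)%C * x ^ k) (Datatypes.S n)).
  { intros x. unfold h. rewrite (st_G st), Re_zsum. apply rsum_ext. intros k _.
    rewrite Cpow_mult_l, <- RtoC_pow.
    replace (g k * (RtoC (x ^ k) * z ^ k))%C with (RtoC (x ^ k) * (g k * z ^ k))%C by ring.
    rewrite Re_scal. ring. }
  assert (E : INR n * Re (G z) - Re (GS z) = rsum (fun k => INR k * Re (g k * z ^ k)%C) (Datatypes.S n)).
  { rewrite (st_G st), (st_GS st), !Re_zsum, <- rsum_scal.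
    match goal with |- rsum ?f ?m - rsum ?p ?m = _ =>
      transitivity (rsum f m + (-1) * rsum p m); [ring|] end.
    rewrite <- rsum_scal, <- rsum_plus. apply rsum_ext. intros k _. rewrite Re_scal. ring. }
  rewrite <- Rabs_Ropp. replace (- (Re (GS z) - INR n * Re (G z))) with (INR n * Re (G z) - Re (GS z)) by ring.
  rewrite E.
  apply (derivative_bound h _ _ (s / 2)); [lra| |].
  - eapply is_derive_ext; [intros x; symmetry; apply Hh|]. apply is_derive_real_poly.
  - intros x Hx. unfold h. rewrite Cmult_1_l.
    destruct (poisson_dilation z 0 x Hz) as (Hlt & _); [fold s; lra|].
    assert (Hm : Re (G (RtoC (1 + x) * z)%C) <= (1 + 18 * Rabs x / s) * Re (G z)).
    { apply (completion_mono T G T G); auto; try apply (st_T st).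
      intros t. destruct (poisson_dilation z t x Hz) as (_ & Hp); [fold s; lra|]. fold s in Hp.
      pose proof (st_T_pos st t).
      replace ((1 + 18 * Rabs x / s) * (T t * poisson z t)) with (T t * ((1 + 18 * Rabs x / s) * poisson z t)) by ring.
      apply Rmult_le_compat_l; auto. }
    replace (18 * Re (G z) / s * Rabs x) with (18 * Rabs x / s * Re (G z)) by (field; lra). lra.
Qed.

(** Up to constants, the Poisson kernel times [((1 - |z|) / |w - z|)^2]. The extra decay pays for
    comparing the atoms as seen from [z] and from a distant [w]. *)
Definition local_kernel (z : C) (t : R) : R := (1 - Cmod z) ^ 3 / Cmod (cis t - z)%C ^ 4.

Lemma cts_local_kernel z : Cmod z < 1 -> cts (local_kernel z).
Proof.
  intros Hz. unfold local_kernel. apply cts_div; [apply cts_const| |].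
  - apply (cts_ext (fun t => Cmod (cis t - z)%C ^ 2 * Cmod (cis t - z)%C ^ 2)); [intros; ring|].
    apply cts_mult; apply cts_dist2.
  - intros t. pose proof (dist_circle_pos z t Hz). apply pow_nonzero. lra.
Qed.

Lemma poisson_bounds z t : Cmod z < 1 ->
  (1 - Cmod z) / Cmod (cis t - z)%C ^ 2 <= poisson z t <= 2 * (1 - Cmod z) / Cmod (cis t - z)%C ^ 2.
Proof.
  intros Hz. pose proof (dist_circle_pos z t Hz). pose proof (Cmod_ge_0 z).
  assert (0 < / Cmod (cis t - z)%C ^ 2) by (apply Rinv_0_lt_compat, pow_lt; lra).
  unfold poisson, Rdiv. split; apply Rmult_le_compat_r; nra.
Qed.

Lemma mean_poisson z : Cmod z < 1 -> mean (poisson z) = 1.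
Proof.
  intros Hz. rewrite (mean_ext _ (fun t => Re (RtoC 1 * cis t ^ 0)%C * poisson z t)).
  - rewrite mean_poisson_monomial by auto. simpl. ring.
  - intros t. simpl. ring.
Qed.

(* If the harmonic extension of T - T^2/128 (which is at most 32) is not small at z, then
   T has mass near z: a point 4096 times farther from the circle catches the far part. *)
Lemma near_mass T G0 z : Cmod z < 1 -> cts T -> (forall t, 0 <= T t) ->
  completion (fun t => T t - / 128 * T t ^ 2) G0 -> 1 / 8 <= Re (G0 z) ->
  / 2 ^ 31 <= mean (fun t => T t * local_kernel z t).
Proof.
  intros Hz CT HT (C0 & _ & M0) H0. rewrite <- M0 in H0 by auto.
  set (s := 1 - Cmod z). assert (Hs : 0 < s <= 1) by (pose proof (Cmod_ge_0 z); unfold s; lra).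
  assert (Hk : cts (fun t => T t * local_kernel z t)) by (apply cts_mult; auto; apply cts_local_kernel; auto).
  assert (Hmain : exists P', cts P' /\ mean P' <= 1 /\ forall t,
    (T t - / 128 * T t ^ 2) * poisson z t <=
     8 * 4096 ^ 2 * (T t * local_kernel z t) + 32 * (8 / 4096) * P' t).
  { assert (Hnear : forall t, Cmod (cis t - z)%C <= 2 * 4096 * s ->
      (T t - / 128 * T t ^ 2) * poisson z t <= 8 * 4096 ^ 2 * (T t * local_kernel z t)).
    { intros t Ht. pose proof (poisson_bounds z t Hz) as (_ & Hp). pose proof (poisson_pos z t Hz).
      pose proof (dist_circle_pos z t Hz) as Hdz. unfold local_kernel. fold s in Hp, Hdz. fold s.
      set (d := Cmod (cis t - z)%C) in *. specialize (HT t).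
      assert (0 < d ^ 2) by (apply pow_lt; lra).
      apply Rle_trans with (T t * (2 * s / d ^ 2)).
      - apply Rle_trans with (T t * poisson z t); [|apply Rmult_le_compat_l; auto].
        apply Rmult_le_compat_r; [lra|]. assert (0 <= T t ^ 2) by (apply pow_le; auto). lra.
      - replace (8 * 4096 ^ 2 * (T t * (s ^ 3 / d ^ 4))) with (T t * (8 * 4096 ^ 2 * s ^ 2 / d ^ 2 * (s / d ^ 2))) by (field; lra).
        apply Rmult_le_compat_l; auto.
        replace (2 * s / d ^ 2) with (2 * (s / d ^ 2)) by (field; lra).
        apply Rmult_le_compat_r; [apply Rlt_le, Rdiv_lt_0_compat; lra|].
        assert (d ^ 2 <= (2 * 4096 * s) ^ 2) by (apply pow_incr; lra).
        apply Rmult_le_reg_r with (d ^ 2); auto. unfold Rdiv. rewrite Rmult_assoc, Rinv_l by lra. lra. }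
    destruct (Rle_lt_dec 1 (4096 * s)) as [HA|HA].
    (* Here every point of the circle counts as near, because [|w - z| <= 2]. *)
    - exists (fun _ => 0). split; [apply cts_const|]. split; [rewrite mean_const; lra|].
      intros t. rewrite Rmult_0_r, Rplus_0_r. apply Hnear.
      pose proof (Cmod_triangle_minus (cis t) z). rewrite Cmod_cis in H. lra.
    - destruct (polar z) as (u & Hu & Ez).
      set (z' := (RtoC (1 - 4096 * s) * u)%C).
      assert (Hz' : Cmod z' = 1 - 4096 * s).
      { unfold z'. rewrite Cmod_mult, Hu, Cmod_RtoC_pos; lra. }
      exists (poisson z'). split; [apply cts_poisson; lra|]. split; [rewrite mean_poisson; lra|].
      intros t.
      assert (Hkp : 0 <= T t * local_kernel z t).
      { apply Rmult_le_pos; auto. pose proof (dist_circle_pos z t Hz). unfold local_kernel.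
        apply Rmult_le_pos; [apply pow_le; fold s; lra|]. apply Rlt_le, Rinv_0_lt_compat, pow_lt; lra. }
      destruct (Rle_lt_dec (Cmod (cis t - z)%C) (2 * 4096 * s)) as [Hd|Hd].
      + specialize (Hnear t Hd). pose proof (poisson_pos z' t ltac:(lra)). lra.
      + pose proof (poisson_bounds z t Hz) as (_ & Hp). pose proof (poisson_pos z t Hz).
        pose proof (poisson_bounds z' t ltac:(lra)) as (Hp' & _). rewrite Hz' in Hp'.
        pose proof (dist_circle_pos z' t ltac:(lra)) as Hd'.
        assert (Hdd : Cmod (cis t - z')%C <= 2 * Cmod (cis t - z)%C).
        { replace (cis t - z')%C with ((cis t - z) + (z - z'))%C by ring.
          eapply Rle_trans; [apply Cmod_triangle|].
          assert (Cmod (z - z')%C <= 4096 * s); [|lra].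
          replace (z - z')%C with (RtoC (Cmod z - (1 - 4096 * s)) * u)%C.
          - rewrite Cmod_mult, Hu, Cmod_R, Rmult_1_r. unfold s. apply Rabs_le. unfold s in *. lra.
          - unfold z'. rewrite Ez at 2. rewrite RtoC_minus. ring. }
        fold s in Hp. set (d := Cmod (cis t - z)%C) in *. set (d' := Cmod (cis t - z')%C) in *.
        assert (Hd0 : 0 < d ^ 2) by (apply pow_lt; lra).
        apply Rle_trans with (32 * (2 * s / d ^ 2)).
        * apply Rle_trans with (32 * poisson z t); [apply Rmult_le_compat_r; [lra|]|apply Rmult_le_compat_l; lra].
          assert (0 <= (T t - 64) ^ 2) by apply pow2_ge_0. lra.
        * apply Rle_trans with (32 * (8 / 4096) * ((1 - (1 - 4096 * s)) / d' ^ 2)).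
          -- replace (32 * (8 / 4096) * ((1 - (1 - 4096 * s)) / d' ^ 2)) with (32 * (2 * s) * (4 * / d' ^ 2)) by (field; lra).
             replace (32 * (2 * s / d ^ 2)) with (32 * (2 * s) * / d ^ 2) by (field; lra).
             apply Rmult_le_compat_l; [lra|].
             assert (d' ^ 2 <= (2 * d) ^ 2) by (apply pow_incr; lra).
             assert (0 < d' ^ 2) by (apply pow_lt; lra).
             replace (4 * / d' ^ 2) with (/ (d' ^ 2 / 4)) by (field; lra).
             apply Rinv_le_contravar; lra.
          -- lra. }
  destruct Hmain as (P' & CP & HP & Hpt).
  assert (H1 : mean (fun t => (T t - / 128 * T t ^ 2) * poisson z t) <=
     mean (fun t => 8 * 4096 ^ 2 * (T t * local_kernel z t) + 32 * (8 / 4096) * P' t)).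
  { apply mean_le; auto.
    - apply cts_mult; auto; apply cts_poisson; auto.
    - apply cts_plus; apply cts_mult; auto; apply cts_const. }
  rewrite mean_plus, !mean_scal in H1 by (auto; apply cts_mult; auto; apply cts_const).
  (* [32 * (8 / 4096) = 1/16] is half of the assumed [1/8], and [8 * 4096 ^ 2 = 2 ^ 27]; hence the
     [2 ^ 31] of the conclusion. *)
  assert (8 * 4096 ^ 2 * mean (fun t => T t * local_kernel z t) >= / 16) by lra.
  lra.
Qed.

(** On the circle this is [phi / 2]; inside the disc, twice it majorizes [|Phi|], with cancellation
    between atoms disregarded. *)
Definition atom_density (N : nat) (lam : nat -> R) (alpha : nat -> C) (z : C) : R :=
  rsum (fun i => lam i / Cmod (1 - alpha i * z)%C ^ 2) N.

Lemma atom_dist_pos al z : Cmod al = 1 -> Cmod z < 1 -> 1 - Cmod z <= Cmod (1 - al * z)%C.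
Proof.
  intros Hal Hz. pose proof (Cmod_triangle_inv 1 (al * z)%C). rewrite Cmod_1, Cmod_mul_unit in H by auto. lra.
Qed.

Lemma setting_S_pos n N lam alpha g G GS T S q t : setting n N lam alpha g G GS T S q -> 0 <= S t.
Proof.
  intros st. rewrite (st_S_sum st). apply rsum_ge_0. intros i Hi.
  apply Rmult_le_pos; [apply Rlt_le, (st_lam st i Hi)|].
  apply (st_q_pos st); auto.
Qed.

(** At height at least [18 / n] the Harnack error is at most [n Re G]. For the second bound,
    [S >= (D / 2) T (s / d)^2] pointwise with [d = |w - z|]; integrating against the Poisson kernel
    makes [Re GS] at least [D / 2] times the local mass of [T]. *)
Lemma density_bound n N lam alpha g G GS T S q z :
  setting n N lam alpha g G GS T S q -> Cmod z < 1 -> 18 <= INR n * (1 - Cmod z) ->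
  / 2 ^ 31 <= mean (fun t => T t * local_kernel z t) ->
  Re (GS z) <= 2 * INR n * Re (G z) /\
  atom_density N lam alpha z <= 2 ^ 33 * INR n * Re (G z).
Proof.
  intros st Hz Hn Hmass.
  set (s := 1 - Cmod z) in *. assert (Hs : 0 < s <= 1) by (pose proof (Cmod_ge_0 z); unfold s; lra).
  assert (HG0 : 0 <= Re (G z)).
  { apply (completion_ge_0 T); auto. apply (st_T st). apply (st_T_pos st). }
  assert (H1 : Re (GS z) <= 2 * INR n * Re (G z)).
  { pose proof (harnack_derivative _ _ _ _ _ _ _ _ _ _ z st Hz) as Hh. fold s in Hh.
    apply Rabs_le_between in Hh.
    assert (18 * Re (G z) / s <= INR n * Re (G z)); [|lra].
    apply Rmult_le_reg_r with s; [lra|]. unfold Rdiv. rewrite Rmult_assoc, Rinv_l by lra. nra. }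
  split; auto.
  set (D := atom_density N lam alpha z).
  assert (HD0 : 0 <= D).
  { apply rsum_ge_0. intros i Hi. pose proof (st_lam st i Hi).
    pose proof (atom_dist_pos _ z (st_alpha st i Hi) Hz). fold s in H0.
    apply Rlt_le, Rdiv_lt_0_compat; auto. apply pow_lt; lra. }
  destruct (st_T st) as (CT & _ & MT).
  destruct (st_S st) as (CS & _ & MS).
  assert (H2 : D / 2 * mean (fun t => T t * local_kernel z t) <= Re (GS z)).
  { rewrite <- MS, <- mean_scal by (auto; apply cts_mult; auto; apply cts_local_kernel; auto).
    apply mean_le.
    - apply cts_mult; [apply cts_const|]. apply cts_mult; auto; apply cts_local_kernel; auto.
    - apply cts_mult; auto; apply cts_poisson; auto.
    - intros t. rewrite (st_S_sum st).
      replace (D / 2 * (T t * local_kernel z t)) with ((/ 2 * (T t * local_kernel z t)) * D) by field.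
      unfold D, atom_density. rewrite (Rmult_comm (rsum _ _) (poisson z t)), <- !rsum_scal. apply rsum_le. intros i Hi.
      pose proof (st_lam st i Hi) as Hl.
      pose proof (st_alpha st i Hi) as Hal.
      pose proof (st_q_pos st i t Hi) as Hq.
      pose proof (st_q st i t Hi) as Eq.
      pose proof (st_T_pos st t) as HT.
      pose proof (atom_dist_pos _ z Hal Hz) as Hdi. fold s in Hdi.
      pose proof (dist_circle_pos z t Hz) as Hd. fold s in Hd.
      pose proof (poisson_bounds z t Hz) as (Hp & _). fold s in Hp.
      unfold local_kernel. fold s.
      assert (He : Cmod (1 - alpha i * cis t)%C <= Cmod (1 - alpha i * z)%C + Cmod (cis t - z)%C).
      { replace (1 - alpha i * cis t)%C with ((1 - alpha i * z) + - (alpha i * (cis t - z)))%C by ring.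
        eapply Rle_trans; [apply Cmod_triangle|]. rewrite Cmod_opp, Cmod_mul_unit by auto. lra. }
      pose proof (Cmod_ge_0 (1 - alpha i * cis t)%C) as He0.
      set (e := Cmod (1 - alpha i * cis t)%C) in *. set (di := Cmod (1 - alpha i * z)%C) in *.
      set (d := Cmod (cis t - z)%C) in *.
      (* From [e <= di + d], as [s] is at most both [di] and [d]. *)
      assert (Hes : e * s <= 2 * di * d) by nra.
      assert (Hes2 : (e * s) ^ 2 <= (2 * di * d) ^ 2).
      { apply pow_incr. split; auto. apply Rmult_le_pos; lra. }
      assert (Hdi2 : 0 < di ^ 2) by (apply pow_lt; lra).
      assert (Hd2 : 0 < d ^ 2) by (apply pow_lt; lra).
      assert (Hqq : 2 * T t * s ^ 2 <= 4 * (di ^ 2 * d ^ 2) * q i t).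
      { rewrite <- Eq. replace (e ^ 2 * q i t * s ^ 2) with ((e * s) ^ 2 * q i t) by ring.
        replace (4 * (di ^ 2 * d ^ 2) * q i t) with ((2 * di * d) ^ 2 * q i t) by ring.
        apply Rmult_le_compat_r; auto. }
      apply Rle_trans with (s / d ^ 2 * (lam i * q i t)).
      + replace (/ 2 * (T t * (s ^ 3 / d ^ 4)) * (lam i / di ^ 2)) with
          ((lam i * (s / d ^ 2)) * (T t * s ^ 2 / (2 * (di ^ 2 * d ^ 2)))) by (field; lra).
        replace (s / d ^ 2 * (lam i * q i t)) with ((lam i * (s / d ^ 2)) * q i t) by ring.
        apply Rmult_le_compat_l.
        * apply Rmult_le_pos; [lra|]. apply Rlt_le, Rdiv_lt_0_compat; lra.
        * assert (0 < di ^ 2 * d ^ 2) by (apply Rmult_lt_0_compat; auto).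
          apply Rmult_le_reg_r with (2 * (di ^ 2 * d ^ 2)); [lra|].
          unfold Rdiv. rewrite Rmult_assoc, Rinv_l by lra. lra.
      + apply Rmult_le_compat_r; auto. apply Rmult_le_pos; lra. }
  assert (D / 2 * / 2 ^ 31 <= D / 2 * mean (fun t => T t * local_kernel z t)) by (apply Rmult_le_compat_l; lra).
  lra.
Qed.

(** * Phi is close to n above the bulk of T *)

Definition koebe (al z : C) : C := (- (2 * (al * z)) / (1 - al * z) ^ 2)%C.

(** [(1 - x)^2 = - x |1 - x|^2] when [|x| = 1]. So [koebe] is real and positive on the circle, where
    it is the share of one unit atom in [phi]. *)
Lemma koebe_circle x : Cmod x = 1 -> (1 - x)%C <> RtoC 0 ->
  (- (2 * x) / (1 - x) ^ 2)%C = RtoC (2 / Cmod (1 - x)%C ^ 2).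
Proof.
  intros Hx Hne.
  assert (Hp : 0 < Cmod (1 - x)%C ^ 2) by (apply pow_lt, Cmod_gt_0; auto).
  assert (E : (RtoC (Cmod (1 - x)%C ^ 2) * x)%C = (- (1 - x) ^ 2)%C).
  { rewrite Cmod_sqr, Re_minus, Im_minus, Re_RtoC, Im_RtoC.
    apply Cmod_1_components in Hx. destruct x as [a b]. unfold Re, Im in Hx; simpl in Hx.
    assert (HP : a * a + b * b - 1 = 0) by lra.
    apply C_eq; unfold Re, Im; simpl; apply Rminus_diag_uniq.
    - transitivity ((a - 1) * (a * a + b * b - 1)); [ring|rewrite HP; ring].
    - transitivity (b * (a * a + b * b - 1)); [ring|rewrite HP; ring]. }
  assert (Hp' : RtoC (Cmod (1 - x)%C ^ 2) <> RtoC 0) by (apply RtoC_nz; lra).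
  rewrite RtoC_div by lra.
  transitivity ((RtoC (Cmod (1 - x)%C ^ 2) * x) * (- (2)) / ((1 - x) ^ 2 * RtoC (Cmod (1 - x)%C ^ 2)))%C.
  - field. split; auto.
  - rewrite E. field. split; auto.
Qed.

(** With [xi = al z] and [xi' = al w], the kernel at [z] minus that at [w] is [2 (xi' - xi)(1 - xi
    xi') / ((1 - xi)^2 (1 - xi')^2)]. The first factor has modulus [|w - z|], which the weight
    absorbs; the second is at most [di + e]. Keeping the atom at distance [d0] from [z] leaves the
    gain [(1 - |z|) / d0]. *)
Lemma koebe_pointwise al z t T q d0 : Cmod al = 1 -> Cmod z < 1 -> 0 <= T -> 0 <= q ->
  Cmod (1 - al * cis t)%C ^ 2 * q = 2 * T -> 0 < d0 <= Cmod (1 - al * z)%C ->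
  Cmod (koebe al z * RtoC T - RtoC q)%C * ((1 - Cmod z) ^ 2 / Cmod (cis t - z)%C ^ 2) <=
  3 * (1 - Cmod z) / d0 * (q + T / Cmod (1 - al * z)%C ^ 2).
Proof.
  intros Hal Hz HT Hq Eq Hd0.
  pose proof (atom_dist_pos al z Hal Hz) as Hdi. pose proof (dist_circle_pos z t Hz) as Hd.
  set (s := 1 - Cmod z) in *.
  assert (Hdd : Cmod (al * z - al * cis t)%C = Cmod (cis t - z)%C).
  { replace (al * z - al * cis t)%C with (- (al * (cis t - z)))%C by ring.
    rewrite Cmod_opp, Cmod_mul_unit by auto. reflexivity. }
  set (d := Cmod (cis t - z)%C) in *. set (di := Cmod (1 - al * z)%C) in *.
  set (xi := (al * z)%C) in *. set (xi' := (al * cis t)%C) in *.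
  assert (Hxi' : Cmod xi' = 1) by (unfold xi'; rewrite Cmod_mult, Hal, Cmod_cis; ring).
  assert (Hxi : Cmod xi <= 1) by (unfold xi; rewrite Cmod_mul_unit by auto; lra).
  assert (Hd2 : 0 < d ^ 2) by (apply pow_lt; lra).
  assert (Hdi2 : 0 < di ^ 2) by (apply pow_lt; lra).
  destruct (classic ((1 - xi')%C = RtoC 0)) as [E0|E0].
  (* At the atom [T = 0] while [q] may be positive; there [d = di], and the weight itself is at most
     [s / d0]. *)
  - rewrite E0, Cmod_0 in Eq. assert (HT0 : T = 0) by lra. subst T.
    assert (Hx1 : xi' = RtoC 1) by (replace xi' with (1 - (1 - xi'))%C by ring; rewrite E0; ring).
    assert (Hddi : d = di).
    { rewrite <- Hdd, Hx1. unfold di. apply Cmod_minus_sym. }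
    replace (koebe al z * 0 - RtoC q)%C with (- RtoC q)%C by ring.
    rewrite Cmod_opp, Cmod_RtoC_pos by auto. unfold Rdiv at 3. rewrite Rmult_0_l, Rplus_0_r.
    rewrite Rmult_comm. apply Rmult_le_compat_r; auto.
    assert (Hsd : s ^ 2 / d ^ 2 <= s / d0).
    { apply Rmult_le_reg_r with (d ^ 2 * d0); [apply Rmult_lt_0_compat; lra|].
      replace (s ^ 2 / d ^ 2 * (d ^ 2 * d0)) with (s * (s * d0)) by (field; lra).
      replace (s / d0 * (d ^ 2 * d0)) with (s * (d * d)) by (field; lra).
      apply Rmult_le_compat_l; [lra|]. apply Rmult_le_compat; lra. }
    assert (0 < s / d0) by (apply Rdiv_lt_0_compat; lra).
    unfold Rdiv in *. lra.
  - set (e := Cmod (1 - xi')%C) in *.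
    assert (He : 0 < e) by (apply Cmod_gt_0; auto).
    assert (He2 : 0 < e ^ 2) by (apply pow_lt; auto).
    assert (Hne : (1 - xi)%C <> RtoC 0) by (apply Cmod_gt_0; fold di; lra).
    assert (Eq' : q = 2 / e ^ 2 * T).
    { apply Rmult_eq_reg_l with (e ^ 2); [|lra]. rewrite Eq. field. lra. }
    assert (Ediff : (koebe al z * RtoC T - RtoC q)%C =
      (RtoC (2 * T) * ((xi' - xi) * (1 - xi * xi')) / ((1 - xi) ^ 2 * (1 - xi') ^ 2))%C).
    { rewrite Eq', RtoC_mult. unfold e. rewrite <- koebe_circle by auto. unfold koebe. fold xi.
      rewrite RtoC_mult. field. auto. }
    assert (Hb : Cmod (koebe al z * RtoC T - RtoC q)%C <= 2 * T * (d * (di + e)) / (di ^ 2 * e ^ 2)).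
    { rewrite Ediff, Cmod_div by (apply Cmult_neq_0; apply Cpow_nz; auto).
      rewrite (Cmod_mult ((1 - xi) ^ 2)%C), !Cmod_pow. fold di e.
      apply Rmult_le_compat_r; [apply Rlt_le, Rinv_0_lt_compat, Rmult_lt_0_compat; auto|].
      rewrite Cmod_mult, Cmod_RtoC_pos by lra. apply Rmult_le_compat_l; [lra|].
      apply Cmod_mult_le.
      - rewrite Cmod_minus_sym. lra.
      - replace (1 - xi * xi')%C with ((1 - xi) + xi * (1 - xi'))%C by ring.
        apply Cmod_plus_le; [fold di; lra|]. rewrite Cmod_mult. fold e. nra. }
    apply Rle_trans with (2 * T * (d * (di + e)) / (di ^ 2 * e ^ 2) * (s ^ 2 / d ^ 2)).
    { apply Rmult_le_compat_r; auto. apply Rmult_le_pos; [apply pow_le; lra|]. apply Rlt_le, Rinv_0_lt_compat; auto. }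
    assert (H1 : 2 * T * (d * (di + e)) / (di ^ 2 * e ^ 2) * (s ^ 2 / d ^ 2) <=
       2 * T * s * (/ (di * e ^ 2) + / (di ^ 2 * e))).
    { replace (2 * T * (d * (di + e)) / (di ^ 2 * e ^ 2) * (s ^ 2 / d ^ 2)) with
        (2 * T * s * (/ (di * e ^ 2) + / (di ^ 2 * e)) * (s / d)) by (field; lra).
      rewrite <- (Rmult_1_r (2 * T * s * (/ (di * e ^ 2) + / (di ^ 2 * e)))) at 2. apply Rmult_le_compat_l.
      - apply Rmult_le_pos; [apply Rmult_le_pos; lra|]. apply Rplus_le_le_0_compat; apply Rlt_le, Rinv_0_lt_compat, Rmult_lt_0_compat; lra.
      - apply Rmult_le_reg_r with d; [lra|]. unfold Rdiv. rewrite Rmult_assoc, Rinv_l; lra. }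
    eapply Rle_trans; [exact H1|].
    set (x := / di). set (y := / e).
    assert (Hx0 : 0 < x) by (apply Rinv_0_lt_compat; lra).
    assert (Hy0 : 0 < y) by (apply Rinv_0_lt_compat; lra).
    assert (Hxd : x <= / d0) by (apply Rinv_le_contravar; lra).
    replace (/ (di * e ^ 2) + / (di ^ 2 * e)) with (x * (y ^ 2 + x * y)) by (unfold x, y; field; lra).
    replace (3 * s / d0 * (q + T / di ^ 2)) with (T * s * (/ d0 * (3 * (2 * y ^ 2 + x ^ 2)))) by (rewrite Eq'; unfold x, y; field; lra).
    replace (2 * T * s * (x * (y ^ 2 + x * y))) with (T * s * (x * (2 * (y ^ 2 + x * y)))) by ring.
    apply Rmult_le_compat_l; [apply Rmult_le_pos; lra|].
    apply Rmult_le_compat; try lra.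
    + assert (0 < x * y) by (apply Rmult_lt_0_compat; auto). assert (0 < y ^ 2) by (apply pow_lt; auto). lra.
    + nra.
Qed.

Definition koebe_sum (N : nat) (lam : nat -> R) (alpha : nat -> C) (z : C) : C :=
  zsum (fun i => RtoC (lam i) * koebe (alpha i) z)%C N.

Lemma koebe_sum_pointwise n N lam alpha g G GS T S q z t d0 :
  setting n N lam alpha g G GS T S q -> Cmod z < 1 -> 0 < d0 ->
  (forall i, (i < N)%nat -> d0 <= Cmod (1 - alpha i * z)%C) ->
  Cmod (koebe_sum N lam alpha z * RtoC (T t) - RtoC (S t))%C * ((1 - Cmod z) ^ 2 / Cmod (cis t - z)%C ^ 2) <=
  3 * (1 - Cmod z) / d0 * (S t + T t * atom_density N lam alpha z).
Proof.
  intros st Hz Hd0 Hd.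
  pose proof (dist_circle_pos z t Hz) as Hdz.
  set (w := (1 - Cmod z) ^ 2 / Cmod (cis t - z)%C ^ 2).
  assert (Hw : 0 <= w).
  { apply Rmult_le_pos; [apply pow_le; lra|]. apply Rlt_le, Rinv_0_lt_compat, pow_lt; lra. }
  assert (E : (koebe_sum N lam alpha z * RtoC (T t) - RtoC (S t))%C =
    zsum (fun i => RtoC (lam i) * (koebe (alpha i) z * RtoC (T t) - RtoC (q i t)))%C N).
  { rewrite (st_S_sum st), <- zsum_RtoC. unfold koebe_sum, Cminus.
    rewrite Cmult_comm, <- zsum_mult_l, <- zsum_opp, <- zsum_plus. apply zsum_ext. intros i _.
    rewrite RtoC_mult. ring. }
  rewrite E. eapply Rle_trans; [apply Rmult_le_compat_r; [auto|apply Cmod_zsum_le]|].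
  rewrite (st_S_sum st). unfold atom_density.
  rewrite Rmult_comm, <- !rsum_scal, <- rsum_plus, <- rsum_scal. apply rsum_le. intros i Hi.
  pose proof (st_lam st i Hi) as Hl.
  pose proof (koebe_pointwise (alpha i) z t (T t) (q i t) d0 (st_alpha st i Hi) Hz
    (st_T_pos st t) (st_q_pos st i t Hi)
    (st_q st i t Hi) (conj Hd0 (Hd i Hi))) as H.
  fold w in H. rewrite Cmod_mult, Cmod_RtoC_pos by lra.
  apply (Rmult_le_compat_l (lam i)) in H; [|lra].
  replace (w * (lam i * Cmod (koebe (alpha i) z * RtoC (T t) - RtoC (q i t))%C)) with
    (lam i * (Cmod (koebe (alpha i) z * RtoC (T t) - RtoC (q i t))%C * w)) by ring.
  eapply Rle_trans; [exact H|]. right. unfold Rdiv. ring.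
Qed.

(* Combining two Poisson kernels on the same radius so that their tails cancel gives a
   kernel comparable to local_kernel. *)
Definition bump (z z2 : C) (t : R) : R :=
  (Cmod z2 * (1 - Cmod z ^ 2) / (1 - Cmod z)) * poisson z2 t
  - (Cmod z * (1 - Cmod z2 ^ 2) / (1 - Cmod z)) * poisson z t.

Lemma Cmod_circle_dist_sqr r u t : Cmod u = 1 ->
  Cmod (cis t - RtoC r * u)%C ^ 2 = 1 + r ^ 2 - 2 * r * Re (cis t * Cconj u)%C.
Proof.
  intros Hu. apply Cmod_1_components in Hu. pose proof (Cmod_1_components _ (Cmod_cis t)) as Hw.
  rewrite Cmod_sqr. destruct u as [a b]. set (w := cis t) in *. destruct w as [x y].
  unfold Re, Im in *; simpl in *. nra.
Qed.

(** By the cosine law [d^2] and [d2^2] are affine in the same [c], and eliminating it gives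
    [r2 d^2 - r d2^2 = (r2 - r)(1 - r r2)], free of [t]. So [bump] is [s^3 / (d^2 d2^2)] times a
    constant between [3/8] and [3/2], and [d], [d2] are comparable because the two points are
    [s / 2] apart. *)
Lemma bump_bounds z u t : Cmod z < 1 -> Cmod u = 1 -> z = (RtoC (Cmod z) * u)%C ->
  / 9 * local_kernel z t <= bump z (RtoC ((1 + Cmod z) / 2) * u)%C t <= 8 * local_kernel z t.
Proof.
  intros Hz Hu Ez. pose proof (Cmod_ge_0 z) as Hr.
  set (r := Cmod z) in *. set (r2 := (1 + r) / 2).
  set (z2 := (RtoC r2 * u)%C).
  assert (Hz2 : Cmod z2 = r2) by (unfold z2; rewrite Cmod_mult, Hu, Cmod_RtoC_pos; unfold r2; lra).
  pose proof (dist_circle_pos z t Hz) as Hd. fold r in Hd.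
  pose proof (dist_circle_pos z2 t ltac:(rewrite Hz2; unfold r2; lra)) as Hd2. rewrite Hz2 in Hd2.
  pose proof (Cmod_circle_dist_sqr r u t Hu) as E1. rewrite <- Ez in E1.
  pose proof (Cmod_circle_dist_sqr r2 u t Hu) as E2. fold z2 in E2.
  assert (Hzz : Cmod (z2 - z)%C = (1 - r) / 2).
  { rewrite Ez. unfold z2. replace (RtoC r2 * u - RtoC r * u)%C with (RtoC (r2 - r) * u)%C by (rewrite RtoC_minus; ring).
    rewrite Cmod_mult, Hu, Cmod_RtoC_pos; unfold r2; lra. }
  pose proof (Cmod_triangle (cis t - z2)%C (z2 - z)%C) as Ht1.
  replace (cis t - z2 + (z2 - z))%C with (cis t - z)%C in Ht1 by ring.
  pose proof (Cmod_triangle_minus (cis t - z)%C (z2 - z)%C) as Ht2.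
  replace (cis t - z - (z2 - z))%C with (cis t - z2)%C in Ht2 by ring.
  rewrite Hzz in Ht1, Ht2.
  unfold bump, poisson, local_kernel. rewrite Hz2. fold r z2.
  set (d := Cmod (cis t - z)%C) in *. set (d2 := Cmod (cis t - z2)%C) in *.
  set (c := Re (cis t * Cconj u)%C) in *. set (s := 1 - r) in *.
  assert (Hs : 0 < s <= 1) by (unfold s; lra).
  assert (Er : r = 1 - s) by (unfold s; ring). assert (Er2 : r2 = 1 - s / 2) by (unfold r2, s; field).
  assert (Hdp : 0 < d ^ 2) by (apply pow_lt; lra). assert (Hd2p : 0 < d2 ^ 2) by (apply pow_lt; lra).
  assert (E : r2 * (1 - r ^ 2) / s * ((1 - r2 ^ 2) / d2 ^ 2) - r * (1 - r2 ^ 2) / s * ((1 - r ^ 2) / d ^ 2)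
     = (2 - s) * (1 - s / 4) * (3 - s) / 4 * (s ^ 3 / (d ^ 2 * d2 ^ 2))).
  { replace (r2 * (1 - r ^ 2) / s * ((1 - r2 ^ 2) / d2 ^ 2) - r * (1 - r2 ^ 2) / s * ((1 - r ^ 2) / d ^ 2))
     with ((1 - r ^ 2) * (1 - r2 ^ 2) / s * (r2 * d ^ 2 - r * d2 ^ 2) / (d ^ 2 * d2 ^ 2)) by (field; lra).
    replace (r2 * d ^ 2 - r * d2 ^ 2) with ((r2 - r) * (1 - r * r2)) by (rewrite E1, E2; ring).
    rewrite Er, Er2. field. lra. }
  rewrite E.
  assert (Hc : 3 / 8 <= (2 - s) * (1 - s / 4) * (3 - s) / 4 <= 3 / 2).
  { split.
    - assert (3 / 4 <= (2 - s) * (1 - s / 4)) by nra. nra.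
    - assert ((2 - s) * (1 - s / 4) <= 2) by nra. assert (0 <= (2 - s) * (1 - s / 4)) by nra. nra. }
  set (k := (2 - s) * (1 - s / 4) * (3 - s) / 4) in *.
  assert (Hs3 : 0 < s ^ 3) by (apply pow_lt; lra).
  assert (Hd4 : 0 < d ^ 4) by (apply pow_lt; lra).
  assert (Hlow : s ^ 3 / d ^ 4 <= 9 / 4 * (s ^ 3 / (d ^ 2 * d2 ^ 2))).
  { assert (Hdd : d2 ^ 2 <= (3 / 2 * d) ^ 2) by (apply pow_incr; lra).
    apply Rmult_le_reg_r with (d ^ 4 * d2 ^ 2); [apply Rmult_lt_0_compat; lra|].
    replace (s ^ 3 / d ^ 4 * (d ^ 4 * d2 ^ 2)) with (s ^ 3 * d2 ^ 2) by (field; lra).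
    replace (9 / 4 * (s ^ 3 / (d ^ 2 * d2 ^ 2)) * (d ^ 4 * d2 ^ 2)) with (s ^ 3 * (3 / 2 * d) ^ 2) by (field; lra).
    apply Rmult_le_compat_l; lra. }
  assert (Hup : s ^ 3 / (d ^ 2 * d2 ^ 2) <= 4 * (s ^ 3 / d ^ 4)).
  { assert (Hdd : d ^ 2 <= (2 * d2) ^ 2) by (apply pow_incr; lra).
    apply Rmult_le_reg_r with (d ^ 4 * d2 ^ 2); [apply Rmult_lt_0_compat; lra|].
    replace (s ^ 3 / (d ^ 2 * d2 ^ 2) * (d ^ 4 * d2 ^ 2)) with (s ^ 3 * d ^ 2) by (field; lra).
    replace (4 * (s ^ 3 / d ^ 4) * (d ^ 4 * d2 ^ 2)) with (s ^ 3 * (2 * d2) ^ 2) by (field; lra).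
    apply Rmult_le_compat_l; lra. }
  assert (0 < s ^ 3 / (d ^ 2 * d2 ^ 2)) by (apply Rdiv_lt_0_compat; auto; apply Rmult_lt_0_compat; auto).
  split; nra.
Qed.

(** [bump] serves both ends: being a combination of Poisson kernels, it lets [harnack_derivative]
    compare the averages of [S] and [n T]; being of the size of [local_kernel], it lets the
    pointwise estimate compare [Phi T] with [S]. Dividing by the average of [T], at least
    [/ (9 * 2 ^ 31)], isolates [Phi]. *)
Lemma koebe_sum_near_n n N lam alpha g G GS T S q z d0 :
  setting n N lam alpha g G GS T S q -> Cmod z < 1 -> 18 <= INR n * (1 - Cmod z) ->
  / 2 ^ 31 <= mean (fun t => T t * local_kernel z t) -> 0 < d0 ->
  (forall i, (i < N)%nat -> d0 <= Cmod (1 - alpha i * z)%C) ->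
  Cmod (koebe_sum N lam alpha z - RtoC (INR n))%C <=
  9 * 2 ^ 31 * (306 / (1 - Cmod z) * Re (G z)
     + 48 * ((1 - Cmod z) / d0) * (2 * INR n * Re (G z) + 2 ^ 33 * INR n * Re (G z) ^ 2)).
Proof.
  intros st Hz Hn Hmass Hd0 Hdi.
  destruct (density_bound _ _ _ _ _ _ _ _ _ _ z st Hz Hn Hmass) as (HGS & HD).
  destruct (st_T st) as (CT & _ & MT).
  destruct (st_S st) as (CS & _ & MS).
  pose proof (st_T_pos st) as HT.
  assert (HS : forall t, 0 <= S t) by (intros; apply (setting_S_pos _ _ _ _ _ _ _ _ _ _ t st)).
  destruct (polar z) as (u & Hu & Ez).
  set (z2 := (RtoC ((1 + Cmod z) / 2) * u)%C).
  pose proof (Cmod_ge_0 z) as Hr.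
  assert (Hz2 : Cmod z2 = (1 + Cmod z) / 2) by (unfold z2; rewrite Cmod_mult, Hu, Cmod_RtoC_pos; lra).
  assert (Hz2' : Cmod z2 < 1) by lra.
  set (D := atom_density N lam alpha z) in *.
  set (s := 1 - Cmod z) in *. assert (Hs : 0 < s <= 1) by (unfold s; lra).
  assert (HG0 : 0 <= Re (G z)).
  { apply (completion_ge_0 T); auto. apply (st_T st). }
  assert (HG2 : Re (G z2) <= 4 * Re (G z)).
  { apply (completion_mono T G T G); auto; try apply (st_T st).
    intros t. replace (4 * (T t * poisson z t)) with (T t * (4 * poisson z t)) by ring.
    apply Rmult_le_compat_l; auto.
    pose proof (dist_circle_pos z t Hz) as Hdz. pose proof (dist_circle_pos z2 t Hz2') as Hdz2.
    assert (Hzz : Cmod (z2 - z)%C = s / 2).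
    { rewrite Ez at 1. unfold z2.
      replace (RtoC ((1 + Cmod z) / 2) * u - RtoC (Cmod z) * u)%C with (RtoC ((1 + Cmod z) / 2 - Cmod z) * u)%C by (rewrite RtoC_minus; ring).
      rewrite Cmod_mult, Hu, Cmod_RtoC_pos; unfold s; lra. }
    pose proof (Cmod_triangle (cis t - z2)%C (z2 - z)%C) as Ht1.
    replace (cis t - z2 + (z2 - z))%C with (cis t - z)%C in Ht1 by ring. rewrite Hzz in Ht1.
    unfold poisson. set (d := Cmod (cis t - z)%C) in *. set (d2 := Cmod (cis t - z2)%C) in *.
    rewrite Hz2 in *. fold s in Hdz.
    assert (Hdd : d ^ 2 <= (2 * d2) ^ 2) by (apply pow_incr; unfold s in *; lra).
    assert (0 < d ^ 2) by (apply pow_lt; lra). assert (0 < d2 ^ 2) by (apply pow_lt; unfold s in *; lra).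
    apply Rmult_le_reg_r with (d ^ 2 * d2 ^ 2); [apply Rmult_lt_0_compat; lra|].
    replace ((1 - ((1 + Cmod z) / 2) ^ 2) / d2 ^ 2 * (d ^ 2 * d2 ^ 2)) with ((1 - ((1 + Cmod z) / 2) ^ 2) * d ^ 2) by (field; lra).
    replace (4 * ((1 - Cmod z ^ 2) / d ^ 2) * (d ^ 2 * d2 ^ 2)) with ((1 - Cmod z ^ 2) * (2 * d2) ^ 2) by (field; lra).
    apply Rmult_le_compat; try lra; nra. }
  assert (CB : cts (bump z z2)).
  { unfold bump. apply cts_minus; apply cts_mult; try apply cts_const; apply cts_poisson; auto. }
  assert (Hbump : forall t, / 9 * local_kernel z t <= bump z z2 t <= 8 * local_kernel z t)
    by (intros t; apply bump_bounds; auto).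
  assert (CK : cts (local_kernel z)) by (apply cts_local_kernel; auto).
  assert (CP : cts (poisson z)) by (apply cts_poisson; auto).
  set (mTg := mean (fun t => T t * bump z z2 t)). set (mSg := mean (fun t => S t * bump z z2 t)).
  assert (HmTg : / (9 * 2 ^ 31) <= mTg).
  { assert (/ 9 * mean (fun t => T t * local_kernel z t) <= mTg).
    { unfold mTg. rewrite <- mean_scal by (apply cts_mult; auto).
      apply mean_le; [apply cts_mult; [apply cts_const|apply cts_mult; auto]|apply cts_mult; auto|].
      intros t. specialize (HT t). specialize (Hbump t).
      replace (/ 9 * (T t * local_kernel z t)) with (T t * (/ 9 * local_kernel z t)) by ring.
      apply Rmult_le_compat_l; lra. }
    rewrite Rinv_mult. lra. }
  set (k1 := Cmod z2 * (1 - Cmod z ^ 2) / s). set (k2 := Cmod z * (1 - Cmod z2 ^ 2) / s).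
  assert (Hk1 : 0 <= k1 <= 2).
  { unfold k1. rewrite Hz2. split.
    - apply Rmult_le_pos; [apply Rmult_le_pos; [lra|nra]|apply Rlt_le, Rinv_0_lt_compat; lra].
    - apply Rmult_le_reg_r with s; [lra|]. unfold Rdiv at 1. rewrite Rmult_assoc, Rinv_l, Rmult_1_r by lra.
      replace ((1 + Cmod z) / 2 * (1 - Cmod z ^ 2)) with (s * ((1 + Cmod z) ^ 2 / 2)) by (unfold s; field).
      rewrite (Rmult_comm 2). apply Rmult_le_compat_l; [lra|]. nra. }
  assert (Hk2 : 0 <= k2 <= 1).
  { unfold k2. rewrite Hz2. split.
    - apply Rmult_le_pos; [apply Rmult_le_pos; [lra|nra]|apply Rlt_le, Rinv_0_lt_compat; lra].
    - apply Rmult_le_reg_r with s; [lra|]. unfold Rdiv at 1. rewrite Rmult_assoc, Rinv_l, Rmult_1_r by lra.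
      replace (Cmod z * (1 - ((1 + Cmod z) / 2) ^ 2)) with (s * (Cmod z * (3 + Cmod z) / 4)) by (unfold s; field).
      rewrite (Rmult_comm 1). apply Rmult_le_compat_l; [lra|]. nra. }
  assert (Hcomb : forall v h, completion v h -> mean (fun t => v t * bump z z2 t) = k1 * Re (h z2) - k2 * Re (h z)).
  { intros v h (Cv & _ & Mv). rewrite <- !Mv by auto.
    rewrite <- !mean_scal by (apply cts_mult; auto; apply cts_poisson; auto).
    rewrite <- mean_minus by (apply cts_mult; [apply cts_const|]; apply cts_mult; auto; apply cts_poisson; auto).
    apply mean_ext. intros t. unfold bump. fold s k1 k2. ring. }
  (* [306 = 2 * 144 + 18], from [k1 <= 2] and [k2 <= 1]; the 144 is [18 * 2 * 4], by the halved
     height at [z2] and the factor 4 of [HG2]. *)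
  assert (Hdiff : Rabs (mSg - INR n * mTg) <= 306 / s * Re (G z)).
  { unfold mSg, mTg. rewrite (Hcomb S GS), (Hcomb T G) by (apply st).
    pose proof (harnack_derivative _ _ _ _ _ _ _ _ _ _ z st Hz) as H1.
    pose proof (harnack_derivative _ _ _ _ _ _ _ _ _ _ z2 st Hz2') as H2.
    rewrite Hz2 in H2. replace (1 - (1 + Cmod z) / 2) with (s / 2) in H2 by (unfold s; field).
    fold s in H1.
    replace (k1 * Re (GS z2) - k2 * Re (GS z) - INR n * (k1 * Re (G z2) - k2 * Re (G z))) with
      (k1 * (Re (GS z2) - INR n * Re (G z2)) - k2 * (Re (GS z) - INR n * Re (G z))) by ring.
    assert (H3 : 18 * Re (G z2) / (s / 2) <= 144 * (Re (G z) / s)).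
    { replace (18 * Re (G z2) / (s / 2)) with (36 * (Re (G z2) * / s)) by (field; lra).
      assert (Re (G z2) * / s <= 4 * Re (G z) * / s) by (apply Rmult_le_compat_r; [apply Rlt_le, Rinv_0_lt_compat; lra|lra]).
      unfold Rdiv. lra. }
    assert (H4 : 18 * Re (G z) / s = 18 * (Re (G z) / s)) by (field; lra).
    assert (H5 : 306 / s * Re (G z) = 306 * (Re (G z) / s)) by (field; lra).
    assert (H6 : 0 <= Re (G z) / s) by (apply Rmult_le_pos; [lra|apply Rlt_le, Rinv_0_lt_compat; lra]).
    apply Rabs_le_between in H1. apply Rabs_le_between in H2.
    rewrite H5. rewrite H4 in H1. apply Rabs_le. split; nra. }
  set (Phi := koebe_sum N lam alpha z) in *.
  (* [24 = 8 * 3], from the upper bound of [bump] and the pointwise estimate; it becomes 48 when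
     real and imaginary parts are added. *)
  set (err := 24 * (s / d0) * (2 * INR n * Re (G z) + 2 ^ 33 * INR n * Re (G z) ^ 2)).
  assert (Hpt : forall t, Cmod (Phi * RtoC (T t) - RtoC (S t))%C * bump z z2 t <=
     24 * (s / d0) * ((S t + D * T t) * poisson z t)).
  { intros t. pose proof (koebe_sum_pointwise _ _ _ _ _ _ _ _ _ _ z t d0 st Hz Hd0 Hdi) as H.
    fold Phi s D in H. pose proof (dist_circle_pos z t Hz) as Hdz. fold s in Hdz.
    pose proof (poisson_bounds z t Hz) as (Hp & _). fold s in Hp.
    specialize (Hbump t). unfold local_kernel in Hbump. fold s in Hbump.
    set (d := Cmod (cis t - z)%C) in *. set (x := Cmod (Phi * RtoC (T t) - RtoC (S t))%C) in *.
    assert (Hx : 0 <= x) by apply Cmod_ge_0.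
    assert (Hd2 : 0 < d ^ 2) by (apply pow_lt; lra).
    apply Rle_trans with (8 * (s / d ^ 2) * (x * (s ^ 2 / d ^ 2))).
    - replace (8 * (s / d ^ 2) * (x * (s ^ 2 / d ^ 2))) with (x * (8 * (s ^ 3 / d ^ 4))) by (field; lra).
      apply Rmult_le_compat_l; lra.
    - replace (24 * (s / d0) * ((S t + D * T t) * poisson z t)) with
        (8 * poisson z t * (3 * s / d0 * (S t + T t * D))) by (field; lra).
      apply Rmult_le_compat; auto.
      + apply Rmult_le_pos; [lra|]. apply Rlt_le, Rdiv_lt_0_compat; lra.
      + apply Rmult_le_pos; auto. apply Rmult_le_pos; [apply pow_le; lra|]. apply Rlt_le, Rinv_0_lt_compat; auto.
      + lra. }
  assert (Herr : 24 * (s / d0) * mean (fun t => (S t + D * T t) * poisson z t) <= err).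
  { unfold err. apply Rmult_le_compat_l; [apply Rmult_le_pos; [lra|apply Rlt_le, Rdiv_lt_0_compat; lra]|].
    rewrite (mean_ext _ (fun t => S t * poisson z t + D * (T t * poisson z t))) by (intros; ring).
    rewrite mean_plus, mean_scal, MS, MT by (auto; try (apply cts_mult; [apply cts_const|]); apply cts_mult; auto).
    assert (D * Re (G z) <= 2 ^ 33 * INR n * Re (G z) * Re (G z)) by (apply Rmult_le_compat_r; auto). lra. }
  (* Means are taken of real functions, so the complex difference is treated through its real and
     imaginary parts, both of this form. *)
  assert (Hgen : forall v : R -> R, cts v -> (forall t, Rabs (v t) <= Cmod (Phi * RtoC (T t) - RtoC (S t))%C) ->
     Rabs (mean (fun t => v t * bump z z2 t)) <= err).
  { intros v Cv Hv. eapply Rle_trans; [|exact Herr].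
    rewrite <- mean_scal by (apply cts_mult; auto; apply cts_plus; auto; apply cts_mult; auto; apply cts_const).
    apply mean_abs_le.
    - apply cts_mult; auto.
    - apply cts_mult; [apply cts_const|]. apply cts_mult; auto. apply cts_plus; auto. apply cts_mult; auto; apply cts_const.
    - intros t. eapply Rle_trans; [|apply Hpt]. rewrite Rabs_mult. specialize (Hbump t).
      assert (0 <= local_kernel z t).
      { pose proof (dist_circle_pos z t Hz) as Hdz. fold s in Hdz. unfold local_kernel.
        apply Rmult_le_pos; [apply pow_le; fold s; lra|apply Rlt_le, Rinv_0_lt_compat, pow_lt; lra]. }
      rewrite (Rabs_pos_eq (bump z z2 t)) by lra. apply Rmult_le_compat_r; [lra|auto]. }
  assert (HRe : Rabs (Re Phi * mTg - mSg) <= err).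
  { unfold mTg, mSg. rewrite <- mean_scal, <- mean_minus by (try (apply cts_mult; [apply cts_const|]); apply cts_mult; auto).
    rewrite (mean_ext _ (fun t => (Re Phi * T t - S t) * bump z z2 t)) by (intros; ring).
    apply Hgen.
    - apply cts_minus; auto. apply cts_mult; auto. apply cts_const.
    - intros t. eapply Rle_trans; [|apply re_le_Cmod]. rewrite Re_minus, (Cmult_comm Phi), Re_scal, Re_RtoC.
      right; f_equal; ring. }
  assert (HIm : Rabs (Im Phi * mTg) <= err).
  { unfold mTg. rewrite <- mean_scal by (apply cts_mult; auto).
    rewrite (mean_ext _ (fun t => (Im Phi * T t) * bump z z2 t)) by (intros; ring).
    apply Hgen.
    - apply cts_mult; auto. apply cts_const.
    - intros t. eapply Rle_trans; [|apply Im_le_Cmod]. rewrite Im_minus, (Cmult_comm Phi), Im_scal, Im_RtoC.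
      right; f_equal; ring. }
  assert (HmT0 : 0 < / (9 * 2 ^ 31)) by (apply Rinv_0_lt_compat; lra).
  assert (Htot : Cmod (Phi - RtoC (INR n))%C * mTg <= 306 / s * Re (G z) + 2 * err).
  { apply Rle_trans with ((Rabs (Re Phi - INR n) + Rabs (Im Phi)) * mTg).
    - apply Rmult_le_compat_r; [lra|]. eapply Rle_trans; [apply Cmod_le_ReIm|].
      rewrite Re_minus, Im_minus, Re_RtoC, Im_RtoC, Rminus_0_r. lra.
    - rewrite Rmult_plus_distr_r. rewrite <- (Rabs_pos_eq mTg) at 1 2 by lra.
      rewrite <- !Rabs_mult.
      replace ((Re Phi - INR n) * mTg) with ((Re Phi * mTg - mSg) + (mSg - INR n * mTg)) by ring.
      pose proof (Rabs_triang (Re Phi * mTg - mSg) (mSg - INR n * mTg)). lra. }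
  assert (Hfin : Cmod (Phi - RtoC (INR n))%C * / (9 * 2 ^ 31) <= 306 / s * Re (G z) + 2 * err).
  { eapply Rle_trans; [|exact Htot]. apply Rmult_le_compat_l; [apply Cmod_ge_0|lra]. }
  apply Rmult_le_reg_r with (/ (9 * 2 ^ 31)); auto.
  eapply Rle_trans; [exact Hfin|]. right. unfold err. field. lra.
Qed.

(** * The two-constants argument *)

Lemma quad_koebe_sum N lam alpha z : (forall i, (i < N)%nat -> Cmod (alpha i) = 1) ->
  Cmod z < 1 -> quad (koebe_sum N lam alpha) z.
Proof.
  intros Hal Hz. apply quad_zsum. intros i Hi. apply quad_scal. unfold koebe.
  apply quad_div.
  - apply quad_opp, quad_scal, quad_scal, quad_id.
  - apply quad_pow. apply quad_minus; [apply quad_const|]. apply quad_scal, quad_id.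
  - apply Cpow_nz, unit_one_minus_nz; auto.
Qed.

Lemma koebe_sum_bound N lam alpha z : (forall i, (i < N)%nat -> 0 < lam i) ->
  (forall i, (i < N)%nat -> Cmod (alpha i) = 1) -> Cmod z < 1 ->
  Cmod (koebe_sum N lam alpha z) <= 2 * atom_density N lam alpha z.
Proof.
  intros Hl Hal Hz. unfold koebe_sum, atom_density. eapply Rle_trans; [apply Cmod_zsum_le|].
  rewrite <- rsum_scal. apply rsum_le. intros i Hi. specialize (Hl i Hi). specialize (Hal i Hi).
  pose proof (unit_one_minus_nz _ z Hal Hz) as Hnz.
  rewrite Cmod_mult, Cmod_RtoC_pos by lra. unfold koebe.
  rewrite Cmod_div by (apply Cpow_nz; auto). rewrite Cmod_opp, (Cmod_mult 2), Cmod_mul_unit, Cmod_pow, Cmod_RtoC_pos by (auto; lra).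
  assert (0 < / Cmod (1 - alpha i * z)%C ^ 2) by (apply Rinv_0_lt_compat, pow_lt, Cmod_gt_0; auto).
  set (x := / Cmod (1 - alpha i * z)%C ^ 2) in *. unfold Rdiv. fold x.
  pose proof (Cmod_ge_0 z). assert (lam i * x > 0) by (apply Rmult_lt_0_compat; auto). nra.
Qed.

(** The constants are fixed in the order [C2], [K], [eps], [B], [A], [c]: side bound for
    [|Phi / n - 1|], exponential rate, smallness required on the floor, height, distance from the
    atoms, ratio. If [N < c n], the maximum principle gives [|F(0)| <= 16 C2^2], whereas
    [Phi(0) = 0], [Re GG(0) >= 1/4] and [|1 + G(0)| <= 3] force [|F(0)| >= 256 C2^2 / 9]. *)
Lemma atoms_lower_bound : exists c, 0 < c /\
  forall n N lam alpha g G GS T S q G0, (1 <= N)%nat ->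
  setting n N lam alpha g G GS T S q ->
  completion (fun t => T t - / 128 * T t ^ 2) G0 ->
  3 / 8 <= Re (G0 (RtoC 0)) -> Cmod (G (RtoC 0)) <= 2 -> c * INR n <= INR N.
Proof.
  (* [|Phi| <= 2^34 n Re G] by [density_bound], and 1 for the subtracted constant. *)
  set (C2 := 2 ^ 34 + 1). assert (HC2 : 1 < C2) by (unfold C2; lra).
  (* From the level [1/8] on the sides to [1/4] at 0 the exponential gains the factor [16 C2]. *)
  set (K := 8 * ln (16 * C2)).
  assert (HK8 : exp (K / 8) = 16 * C2).
  { unfold K. replace (8 * ln (16 * C2) / 8) with (ln (16 * C2)) by field. apply exp_ln. lra. }
  assert (HK4 : exp (K / 4) = 256 * C2 ^ 2).
  { replace (K / 4) with (K / 8 + K / 8) by field. rewrite exp_plus, HK8. ring. }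
  assert (HK0 : 0 < K).
  { unfold K. assert (ln 1 < ln (16 * C2)) by (apply ln_increasing; lra). rewrite ln_1 in H. lra. }
  set (E0 := exp (32 * K)). assert (HE0 : 0 < E0) by apply exp_pos.
  (* Makes [eps] times [exp(32 K)], the bound for the exponential on the floor, equal to the bound
     [C2 exp(K / 8)] on the sides. *)
  set (eps := 16 * C2 ^ 2 / E0).
  assert (Heps : 0 < eps) by (apply Rdiv_lt_0_compat; auto; nra).
  assert (HepsE : eps * E0 = 16 * C2 ^ 2) by (unfold eps; field; lra).
  set (W := 9 * 2 ^ 31). assert (HW : 0 < W) by (unfold W; lra).
  (* [B] brings the Harnack error, and [A] below the error from the atoms, down to [eps / 2] each;
     the summand 18 meets the height condition of [density_bound]. *)
  set (B := 18 + W * 306 * 2 / eps).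
  assert (HB : 18 < B).
  { unfold B. assert (0 < W * 306 * 2 / eps) by (apply Rdiv_lt_0_compat; lra). lra. }
  assert (HB1 : W * (306 / B) <= eps / 2).
  { apply Rmult_le_reg_r with B; [lra|]. replace (W * (306 / B) * B) with (W * 306) by (field; lra).
    apply Rle_trans with (eps / 2 * (W * 306 * 2 / eps)); [right; field; lra|].
    apply Rmult_le_compat_l; [lra|]. unfold B. lra. }
  set (A := 2 * W * 48 * B * (2 ^ 33 + 2) / eps).
  assert (HA : 0 < A).
  { apply Rdiv_lt_0_compat; auto. repeat apply Rmult_lt_0_compat; lra. }
  assert (HA1 : W * (48 * (B / A)) * (2 ^ 33 + 2) = eps / 2).
  { unfold A. field. repeat split; lra. }
  (* As [N >= 1], the first entry forces [n > 2 B], hence [s < 1/2]; the second bounds the cost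
     [v N] at 0. *)
  set (c := Rmin (/ (2 * B)) (B / (256 * A ^ 2))).
  assert (HA2 : 0 < A ^ 2) by (apply pow_lt; auto).
  assert (Hc : 0 < c).
  { apply Rmin_glb_lt; [apply Rinv_0_lt_compat; lra|apply Rdiv_lt_0_compat; lra]. }
  exists c. split; auto.
  intros n N lam alpha g G GS T S q G0 HN st HG0 HG00 HG.
  apply Rnot_lt_le. intros Hlt.
  pose proof (st_lam st) as Hlam.
  pose proof (st_alpha st) as Hal.
  assert (HN1 : 1 <= INR N) by (apply (le_INR 1); auto).
  set (nn := INR n) in *.
  assert (Hn : 2 * B < nn).
  { assert (c <= / (2 * B)) by apply Rmin_l. pose proof (pos_INR n). fold nn in H0.
    assert (1 < / (2 * B) * nn) by nra.
    apply (Rmult_lt_compat_l (2 * B)) in H1; [|lra]. rewrite <- Rmult_assoc, Rinv_r in H1; lra. }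
  assert (HNn : INR N <= B * nn / (256 * A ^ 2)).
  { assert (c <= B / (256 * A ^ 2)) by apply Rmin_r.
    assert (c * nn <= B / (256 * A ^ 2) * nn) by (apply Rmult_le_compat_r; lra).
    replace (B * nn / (256 * A ^ 2)) with (B / (256 * A ^ 2) * nn) by (field; lra). lra. }
  set (s := B / nn). set (r := 1 - s).
  assert (Hs : 0 < s < 1 / 2).
  { unfold s. split; [apply Rdiv_lt_0_compat; lra|].
    apply Rmult_lt_reg_r with nn; [lra|]. replace (B / nn * nn) with B by (field; lra). lra. }
  assert (Hns : nn * s = B) by (unfold s; field; lra).
  (* At height [B / n], a point closer than [A / n] to an atom has [v Re V >= 32], which cancels the
     largest possible [Re G0] and puts it outside the region; at 0 the loss is [v N <= 1/8]. *)
  set (v := 32 * A ^ 2 / (B * nn)).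
  assert (HBn : 0 < B * nn) by (apply Rmult_lt_0_compat; lra).
  assert (Hv : 0 < v) by (apply Rdiv_lt_0_compat; lra).
  set (V := fun z => zsum (fun i => herg (alpha i) z) N).
  set (GG := fun z => (G0 z - RtoC v * V z)%C).
  set (F := fun z => ((koebe_sum N lam alpha z / RtoC nn - 1) * cexp (RtoC K * GG z) / (1 + G z) ^ 2)%C).
  destruct (st_T st) as (CT & QG & MT).
  pose proof (st_T_pos st) as HT.
  assert (HGpos : forall z, Cmod z < 1 -> 0 <= Re (G z)).
  { intros z Hz. apply (completion_ge_0 T); auto. apply (st_T st). }
  assert (H1G : forall z, Cmod z < 1 -> 1 + Re (G z) <= Cmod (1 + G z)%C).
  { intros z Hz. pose proof (Re_le_Cmod (1 + G z)%C). rewrite Re_plus, Re_RtoC in H. lra. }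
  assert (H1G0 : forall z, Cmod z < 1 -> (1 + G z)%C <> RtoC 0).
  { intros z Hz. apply Cmod_gt_0. specialize (H1G z Hz). specialize (HGpos z Hz). lra. }
  assert (HVpos : forall z, Cmod z < 1 -> 0 <= Re (V z)).
  { intros z Hz. unfold V. rewrite Re_zsum. apply rsum_ge_0. intros i Hi. apply Rlt_le, Re_herg_pos; auto. }
  assert (HReGG : forall z, Re (GG z) = Re (G0 z) - v * Re (V z)).
  { intros z. unfold GG. rewrite Re_minus, Re_scal. reflexivity. }
  assert (HG0le : forall z, Cmod z < 1 -> Re (G0 z) <= 32).
  { intros z Hz. destruct HG0 as (C0 & _ & M0). rewrite <- M0 by auto.
    replace 32 with (mean (fun t => 32 * poisson z t)) by (rewrite mean_scal, mean_poisson; auto; [ring|apply cts_poisson; auto]).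
    apply mean_le; [apply cts_mult; auto; apply cts_poisson; auto|apply cts_mult; [apply cts_const|apply cts_poisson; auto]|].
    intros t. apply Rmult_le_compat_r; [apply Rlt_le, poisson_pos; auto|].
    assert (0 <= (T t - 64) ^ 2) by apply pow2_ge_0. lra. }
  assert (HQGG : forall z, Cmod z < 1 -> quad GG z).
  { intros z Hz. apply quad_minus; [apply HG0|]. apply quad_scal. apply quad_zsum. intros i Hi. apply quad_herg; auto. }
  assert (HmodF : forall z, Cmod z < 1 -> Cmod (F z) =
     Cmod (koebe_sum N lam alpha z - RtoC nn)%C / nn * exp (K * Re (GG z)) / Cmod (1 + G z)%C ^ 2).
  { intros z Hz. assert (Hnn : RtoC nn <> RtoC 0) by (apply RtoC_nz; lra).
    unfold F. rewrite Cmod_div, Cmod_mult, Cmod_cexp, Re_scal, Cmod_pow by (apply Cpow_nz; auto).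
    replace (koebe_sum N lam alpha z / RtoC nn - 1)%C with ((koebe_sum N lam alpha z - RtoC nn) / RtoC nn)%C by (field; auto).
    rewrite Cmod_div, (Cmod_RtoC_pos nn) by (auto; lra). reflexivity. }
  assert (HFbound : forall z X Y, Cmod z < 1 -> 0 <= X ->
     Cmod (koebe_sum N lam alpha z - RtoC nn)%C <= nn * (X * (1 + Re (G z)) ^ 2) ->
     exp (K * Re (GG z)) <= Y -> Cmod (F z) <= X * Y).
  { intros z X Y Hz HX HPhi HY. rewrite HmodF by auto.
    specialize (H1G z Hz). specialize (HGpos z Hz).
    pose proof (exp_pos (K * Re (GG z))) as Hex.
    assert (Hsq : (1 + Re (G z)) ^ 2 <= Cmod (1 + G z)%C ^ 2) by (apply pow_incr; lra).
    assert (Hsq0 : 0 < Cmod (1 + G z)%C ^ 2) by (apply pow_lt; lra).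
    apply Rmult_le_reg_r with (Cmod (1 + G z)%C ^ 2); auto.
    unfold Rdiv at 1. rewrite Rmult_assoc, Rinv_l, Rmult_1_r by lra.
    apply Rle_trans with (X * Cmod (1 + G z)%C ^ 2 * Y); [|right; ring].
    apply Rmult_le_compat; try lra.
    - apply Rmult_le_pos; [apply Cmod_ge_0|apply Rlt_le, Rinv_0_lt_compat; lra].
    - apply Rmult_le_reg_r with nn; [lra|]. unfold Rdiv. rewrite Rmult_assoc, Rinv_l, Rmult_1_r by lra.
      eapply Rle_trans; [exact HPhi|]. rewrite Rmult_comm. apply Rmult_le_compat_r; [lra|].
      apply Rmult_le_compat_l; auto. }
  assert (Hregion : forall z, Cmod z <= r -> 1 / 8 <= Re (GG z) ->
     Cmod z < 1 /\ 18 <= nn * (1 - Cmod z) /\ / 2 ^ 31 <= mean (fun t => T t * local_kernel z t)).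
  { intros z Hz HU. assert (Hz1 : Cmod z < 1) by (unfold r in Hz; lra).
    split; auto. split.
    - assert (nn * s <= nn * (1 - Cmod z)) by (apply Rmult_le_compat_l; unfold r in Hz; lra). lra.
    - apply (near_mass T G0); auto. rewrite HReGG in HU.
      assert (0 <= v * Re (V z)) by (apply Rmult_le_pos; [lra|auto]). lra. }
  assert (Hmax : Cmod (F (RtoC 0)) <= 16 * C2 ^ 2).
  { apply (max_principle F GG r (1 / 8)); auto.
    - unfold r; lra.
    - nra.
    - intros z Hz. assert (Hz1 : Cmod z < 1) by (unfold r in Hz; lra).
      unfold F. apply quad_div.
      + apply quad_mult.
        * apply quad_minus; [|apply quad_const].
          apply quad_div; [apply quad_koebe_sum; auto|apply quad_const|apply RtoC_nz; lra].
        * apply quad_cexp, quad_scal; auto.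
      + apply quad_pow. apply quad_plus; [apply quad_const|apply QG].
      + apply Cpow_nz; auto.
    - rewrite HReGG. unfold V.
      rewrite (zsum_ext _ (fun _ => RtoC 1)).
      2:{ intros i Hi. unfold herg. field. }
      rewrite zsum_RtoC, Re_RtoC, rsum_const, Rmult_1_r.
      assert (v * INR N <= v * (B * nn / (256 * A ^ 2))) by (apply Rmult_le_compat_l; lra).
      replace (v * (B * nn / (256 * A ^ 2))) with (1 / 8) in H by (unfold v; field; lra). lra.
    (* The side [Re GG = 1/8]: nothing is known here about the distance to the atoms, so the rough
       bound of [density_bound] has to do. *)
    - intros z Hz HU. destruct (Hregion z Hz ltac:(lra)) as (Hz1 & Hn18 & Hmass).
      destruct (density_bound _ _ _ _ _ _ _ _ _ _ z st Hz1 Hn18 Hmass) as (_ & HD). fold nn in HD.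
      pose proof (koebe_sum_bound N lam alpha z Hlam Hal Hz1) as Hk.
      replace (16 * C2 ^ 2) with (C2 * (16 * C2)) by ring. apply HFbound; auto; [lra| |].
      + eapply Rle_trans; [apply Cmod_triangle_minus|]. rewrite Cmod_RtoC_pos by lra.
        specialize (HGpos z Hz1). set (x := Re (G z)) in *.
        apply Rle_trans with (nn * (2 ^ 34 * x + 1)); [lra|]. apply Rmult_le_compat_l; [lra|].
        unfold C2. assert (0 <= x ^ 2) by (apply pow_le; auto). lra.
      + rewrite HU, <- HK8. right. f_equal. field.
    (* The floor [|z| = 1 - B / n]: membership in the region keeps the atoms at distance [A / n], so
       [Phi] is close to [n]. *)
    - intros z Hz HU. destruct (Hregion z ltac:(lra) HU) as (Hz1 & Hn18 & Hmass).
      rewrite <- HepsE. apply HFbound; auto; [lra| |].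
      + assert (Hsz : 1 - Cmod z = s) by (unfold r in Hz; lra).
        assert (Hd0 : forall i, (i < N)%nat -> A / nn <= Cmod (1 - alpha i * z)%C).
        { intros i Hi. apply Rnot_lt_le. intros Hd.
          pose proof (rsum_term_le (fun i => Re (herg (alpha i) z)) N i
            (fun j Hj => Rlt_le _ _ (Re_herg_pos _ z (Hal j Hj) Hz1)) Hi) as Hterm.
          cbv beta in Hterm. rewrite <- Re_zsum in Hterm. fold (V z) in Hterm.
          rewrite Re_herg in Hterm by auto.
          pose proof (atom_dist_pos _ z (Hal i Hi) Hz1) as Hdi. rewrite Hsz in Hdi.
          set (d := Cmod (1 - alpha i * z)%C) in *.
          assert (Hd2 : d ^ 2 <= (A / nn) ^ 2) by (apply pow_incr; lra).
          assert (Hd20 : 0 < d ^ 2) by (apply pow_lt; lra).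
          assert (Hlow : B * nn / A ^ 2 <= Re (V z)).
          { eapply Rle_trans; [|exact Hterm].
            apply Rle_trans with (s * / (A / nn) ^ 2); [right; unfold s; field; lra|].
            apply Rmult_le_compat; [lra| | |apply Rinv_le_contravar; lra].
            - apply Rlt_le, Rinv_0_lt_compat. lra.
            - pose proof (Cmod_ge_0 z). nra. }
          rewrite HReGG in HU. specialize (HG0le z Hz1).
          assert (v * (B * nn / A ^ 2) <= v * Re (V z)) by (apply Rmult_le_compat_l; lra).
          replace (v * (B * nn / A ^ 2)) with 32 in H by (unfold v; field; lra). lra. }
        pose proof (koebe_sum_near_n _ _ _ _ _ _ _ _ _ _ z (A / nn) st Hz1 Hn18 Hmass
          ltac:(apply Rdiv_lt_0_compat; lra) Hd0) as H.
        fold nn in H. rewrite Hsz in H. fold W in H.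
        eapply Rle_trans; [exact H|].
        specialize (HGpos z Hz1). set (x := Re (G z)) in *.
        replace (W * (306 / s * x + 48 * (s / (A / nn)) * (2 * nn * x + 2 ^ 33 * nn * x ^ 2))) with
          (nn * (W * (306 / B) * x + W * (48 * (B / A)) * (2 * x + 2 ^ 33 * x ^ 2))).
        2:{ unfold s. field. repeat split; lra. }
        apply Rmult_le_compat_l; [lra|].
        assert (Hx2 : 0 <= x ^ 2) by (apply pow_le; auto).
        assert (H1 : W * (306 / B) * x <= eps / 2 * (1 + x) ^ 2).
        { apply Rmult_le_compat; auto; [|lra].
          apply Rmult_le_pos; [lra|]. apply Rlt_le, Rdiv_lt_0_compat; lra. }
        assert (H2 : W * (48 * (B / A)) * (2 * x + 2 ^ 33 * x ^ 2) <= eps / 2 * (1 + x) ^ 2).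
        { rewrite <- HA1. apply Rle_trans with (W * (48 * (B / A)) * ((2 ^ 33 + 2) * (1 + x) ^ 2)); [|right; ring].
          apply Rmult_le_compat_l.
          - apply Rmult_le_pos; [lra|]. apply Rmult_le_pos; [lra|]. apply Rlt_le, Rdiv_lt_0_compat; lra.
          - lra. }
        lra.
      + unfold E0. rewrite HReGG. specialize (HG0le z Hz1). specialize (HVpos z Hz1).
        assert (0 <= v * Re (V z)) by (apply Rmult_le_pos; lra).
        assert (Hle : K * (Re (G0 z) - v * Re (V z)) <= 32 * K) by nra.
        destruct Hle as [Hle|Hle]; [apply Rlt_le, exp_increasing; auto|rewrite Hle; lra]. }
  assert (H0 : Cmod (RtoC 0) < 1) by (rewrite Cmod_0; lra).
  rewrite HmodF in Hmax by auto.
  assert (Hk0 : koebe_sum N lam alpha (RtoC 0) = RtoC 0).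
  { unfold koebe_sum. apply zsum_0. intros i _. unfold koebe. field. }
  rewrite Hk0 in Hmax. replace (0 - RtoC nn)%C with (- RtoC nn)%C in Hmax by ring.
  rewrite Cmod_opp, Cmod_RtoC_pos in Hmax by lra.
  replace (nn / nn) with 1 in Hmax by (field; lra). rewrite Rmult_1_l in Hmax.
  assert (HU0 : 1 / 4 <= Re (GG (RtoC 0))).
  { rewrite HReGG. unfold V. rewrite (zsum_ext _ (fun _ => RtoC 1)).
    2:{ intros i Hi. unfold herg. field. }
    rewrite zsum_RtoC, Re_RtoC, rsum_const, Rmult_1_r.
    assert (v * INR N <= v * (B * nn / (256 * A ^ 2))) by (apply Rmult_le_compat_l; lra).
    replace (v * (B * nn / (256 * A ^ 2))) with (1 / 8) in H by (unfold v; field; lra). lra. }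
  assert (Hexp : 256 * C2 ^ 2 <= exp (K * Re (GG (RtoC 0)))).
  { rewrite <- HK4. assert (Hle : K / 4 <= K * Re (GG (RtoC 0))) by nra.
    destruct Hle as [Hle|Hle]; [apply Rlt_le, exp_increasing; auto|rewrite <- Hle; lra]. }
  assert (H3 : Cmod (1 + G (RtoC 0))%C <= 3).
  { eapply Rle_trans; [apply Cmod_triangle|]. rewrite Cmod_1. lra. }
  pose proof (H1G _ H0) as H4. pose proof (HGpos _ H0) as H5.
  assert (H6 : Cmod (1 + G (RtoC 0))%C ^ 2 <= 3 ^ 2) by (apply pow_incr; lra).
  assert (H7 : 0 < Cmod (1 + G (RtoC 0))%C ^ 2) by (apply pow_lt; lra).
  apply (Rmult_le_compat_r (Cmod (1 + G (RtoC 0))%C ^ 2)) in Hmax; [|lra].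
  unfold Rdiv in Hmax. rewrite Rmult_assoc, Rinv_l, Rmult_1_r in Hmax by lra.
  assert (0 < C2 ^ 2) by (apply pow_lt; lra).
  assert (16 * C2 ^ 2 * Cmod (1 + G (RtoC 0))%C ^ 2 <= 16 * C2 ^ 2 * 3 ^ 2) by (apply Rmult_le_compat_l; lra).
  lra.
Qed.

(** * The extremal function in the abstract setting *)

Definition T_coef (a : nat -> C) (n k : nat) : C :=
  match k with O => Cconj (a n) | _ => (2 * Cconj (a (n - k)%nat))%C end.

(** Real parts do not see conjugation, so [T] can be written with conjugated coefficients and
    nonnegative powers of [w], the form in which [completion] applies; [be] becomes the conjugate of
    [w]. *)
Lemma T_coef_hcoef a n k w : (T_coef a n k * w ^ k = Cconj (a (n - k)%nat * hcoef (Cconj w) k))%C.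
Proof.
  destruct k; cbn [T_coef hcoef].
  - rewrite Nat.sub_0_r, Cmult_conj. f_equal. apply C_eq; unfold Re, Im; simpl; ring.
  - rewrite !Cmult_conj, Cpow_conj, Cconj_conj.
    replace (Cconj 2) with (RtoC 2) by (apply C_eq; unfold Re, Im; simpl; ring). ring.
Qed.

Lemma rsum_rev f n : rsum f n = rsum (fun k => f (n - 1 - k)%nat) n.
Proof.
  apply RtoC_inj. rewrite <- !zsum_RtoC. apply (zsum_rev (fun k => RtoC (f k))).
Qed.

Lemma extremal_setting n f N lam alpha a : extremal_data n f N lam alpha a ->
  setting n N lam alpha (T_coef a n)
    (fun z => zsum (fun k => T_coef a n k * z ^ k) (S n))%C
    (fun z => zsum (fun k => RtoC (INR n - INR k) * (T_coef a n k * z ^ k)) (S n))%C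
    (fun t => Tb a n (Cconj (cis t))) (fun t => Sb a n (Cconj (cis t)))
    (fun i t => qb a n (alpha i) (Cconj (cis t))).
Proof.
  intros E. pose proof (ed_alpha E) as Hal.
  assert (Hu : forall t, Cmod (Cconj (cis t)) = 1) by (intros; rewrite Cmod_conj; apply Cmod_cis).
  pose proof (ed_pos E) as Hpos. pose proof (ed_zero E) as Hzero.
  constructor; auto.
  - apply E.
  - eapply completion_ext; [|intros; reflexivity|apply (completion_poly (T_coef a n))].
    intros t. unfold Tb, pairing. rewrite !Re_zsum. apply rsum_ext. intros k _.
    rewrite T_coef_hcoef, re_conj. reflexivity.
  - eapply completion_ext; [| |apply (completion_poly (fun k => RtoC (INR n - INR k) * T_coef a n k)%C (S n))].
    + intros t. unfold Sb, pairing. cbv beta. rewrite !Re_zsum. apply rsum_ext. intros k Hk.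
      rewrite <- Cmult_assoc, T_coef_hcoef, Re_scal, re_conj, <- Cmult_assoc, Re_scal, minus_INR by lia. reflexivity.
    + intros z. apply zsum_ext. intros; ring.
  - intros t. apply Hpos; auto.
  - intros t. apply (Sb_decomposition n f). exact E.
  - intros i t Hi. exact (qb_nonneg a n (alpha i) _ (Hal i Hi) (Hu t) Hpos (Hzero i Hi)).
  - intros i t Hi.
    cbv beta. rewrite <- (qb_eq a n (alpha i) _ (Hal i Hi) (Hu t) Hpos (Hzero i Hi)).
    f_equal. f_equal.
    replace (Cconj (cis t) - alpha i)%C with (Cconj (cis t) * (1 - alpha i * cis t))%C.
    + rewrite Cmod_mul_unit; auto.
    + transitivity (Cconj (cis t) - alpha i * (cis t * Cconj (cis t)))%C; [ring|].
      rewrite <- Cmod2_conj, Cmod_cis. simpl. rewrite !Rmult_1_l. ring.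
Qed.

Theorem theorem1 :
  exists c : R, 0 < c /\
    forall (n : nat) (f : C -> C), extremal n f ->
      forall (gamma : C) (N : nat) (lam : nat -> R) (alpha : nat -> C),
        atom_rep f gamma N lam alpha -> c * INR n <= INR N.
Proof.
  destruct atoms_lower_bound as (c & Hc & Hmain). exists c. split; auto.
  intros n f Hf gamma N lam alpha Hrep.
  destruct n as [|m].
  { simpl. rewrite Rmult_0_r. apply pos_INR. }
  set (n := S m) in *.
  destruct (extremal_data_intro n f gamma N lam alpha ltac:(lia) Hf Hrep) as (a & E).
  pose proof (extremal_setting n f N lam alpha a E) as st.
  set (T := fun t => Tb a n (Cconj (cis t))) in *.
  set (G := fun z => zsum (fun k => T_coef a n k * z ^ k)%C (S n)) in *.
  pose proof (bessel f a (S n) (ed_taylor E) (ed_bound E)) as Hb.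
  pose proof (st_T st) as HTG.
  assert (ETp : forall t, T t = Re (zsum (fun k => T_coef a n k * cis t ^ k)%C (S n))).
  { intros t. unfold T, Tb, pairing. rewrite !Re_zsum. apply rsum_ext. intros k _.
    rewrite T_coef_hcoef, re_conj. reflexivity. }
  destruct (completion_square (T_coef a n) (S n)) as (g2 & Hg2).
  assert (HG0 : completion (fun t => T t - / 128 * T t ^ 2) (fun z => G z + RtoC (- / 128) * g2 z)%C).
  { eapply completion_ext; [|intros; reflexivity|apply completion_plus; [exact HTG|apply completion_scal; exact Hg2]].
    intros t. cbv beta. rewrite <- ETp. ring. }
  assert (HGz : G (RtoC 0) = Cconj (a n)).
  { unfold G. rewrite zsum_head, zsum_0; [cbn [T_coef]; simpl; ring|].
    intros k _. rewrite Cpow_S. ring. }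
  apply (Hmain n N lam alpha _ _ _ _ _ _ _ (extremal_data_atoms n f N lam alpha a ltac:(lia) E) st HG0).
  - destruct Hg2 as (_ & _ & M2).
    assert (H0 : Cmod (RtoC 0) < 1) by (rewrite Cmod_0; lra).
    rewrite Re_plus, Re_scal, HGz, re_conj, <- M2 by auto.
    pose proof (ed_half E) as Hhalf.
    (* The coefficients of [T] are at most [2 |a_k|] in modulus, so its mean square is at most four
       times the Bessel bound 4. With the factor [/ 128] this takes [1/8] from [a_n >= 1/2] and
       leaves [3/8]. *)
    assert (Hm : mean (fun t => Re (zsum (fun k => T_coef a n k * cis t ^ k)%C (S n)) ^ 2 * poisson (RtoC 0) t) <= 16).
    { apply Rle_trans with (mean (fun t => Cmod (zsum (fun k => T_coef a n k * cis t ^ k)%C (S n)) ^ 2)).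
      - apply mean_le.
        + apply cts_mult; [|apply cts_poisson; auto].
          destruct (completion_square (T_coef a n) (S n)) as (g3 & C3 & _). exact C3.
        + apply cts_Cmod_poly_sqr.
        + intros t. unfold poisson. rewrite Cmod_0. replace (cis t - 0)%C with (cis t) by ring.
          rewrite Cmod_cis, Cmod_sqr. set (x := Re _). set (y := Im _).
          assert (0 <= y ^ 2) by apply pow2_ge_0. lra.
      - rewrite parseval.
        apply Rle_trans with (4 * rsum (fun k => Cmod (a k) ^ 2) (S n)); [|lra].
        rewrite (rsum_rev (fun k => Cmod (a k) ^ 2)), <- rsum_scal. apply rsum_le. intros k Hk.
        replace (S n - 1 - k)%nat with (n - k)%nat by lia.
        destruct k; cbn [T_coef].
        + rewrite Cmod_conj, Nat.sub_0_r. pose proof (pow2_ge_0 (Cmod (a n))). lra.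
        + rewrite Cmod_mult, Cmod_conj, Cmod_RtoC_pos by lra. right. ring. }
    lra.
  - rewrite HGz, Cmod_conj.
    pose proof (rsum_term_le (fun k => Cmod (a k) ^ 2) (S n) n (fun i _ => pow2_ge_0 _) ltac:(lia)) as H.
    cbv beta in H. pose proof (Cmod_ge_0 (a n)). nra.
Qed.
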